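(* Let $\rho_0\in \mathrm{L}^\infty(\mathbb{R})$ satisfy $0\le\rho_0\le 1$ and $\mathrm{TV}(\rho_0)<+\infty$, and let $V\in\mathrm{Lip}([0,1])$ be a real-valued Lipschitz function with $V'\le 0$ in $[0,1]$. For every $\varepsilon,h>0$ let the quadrature weights be $$\gamma_k^{\varepsilon,h}=\gamma_0^{\varepsilon,h}\big(1-\gamma_0^{\varepsilon,h}\big)^k,\quad k\ge 0,\qquad\text{with}\qquad 0<\gamma_0^{\varepsilon,h}<1,\quad \frac{1-\gamma_0^{\varepsilon,h}}{\gamma_0^{\varepsilon,h}}\le c\,\frac{\varepsilon}{h},$$ where $c>0$ is a constant independent of $\varepsilon,h$. Fix $\lambda=\tau/h>0$ and assume the CFL condition $\lambda\big(\|V\|_{\mathrm{L}^\infty}+\|V'\|_{\mathrm{L}^\infty}\big)\le 1$. Let $\{\rho_j^n\}_{j\in\mathbb{Z}}^{n\ge 0}$ and $\{W_j^n\}_{j\in\mathbb{Z}}^{n\ge 0}$ be the numerical solutions produced by the scheme described in the context, with piecewise constant reconstructions $$\rho_{\varepsilon,h}=\sum_{n=0}^\infty\sum_{j\in\mathbb{Z}}\rho_j^n\,\mathds{1}_{[n\tau,(n+1)\tau)\times[(j-\frac12)h,(j+\frac12)h)},\qquad W_{\varepsilon,h}=\sum_{n=0}^\infty\sum_{j\in\mathbb{Z}}W_j^n\,\mathds{1}_{[n\tau,(n+1)\tau)\times[(j-\frac12)h,(j+\frac12)h)} .$$ Then, as $\varepsilon,h\searrow0$, both $W_{\varepsilon,h}$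 and $\rho_{\varepsilon,h}$ converge strongly in $\mathrm{L}^1_{\mathrm{loc}}(\mathbb{R}_+\times\mathbb{R})$ to the unique entropy solution $\rho$ of $$\partial_t\rho+\partial_x\big(V(\rho)\rho\big)=0\ \text{ in }\mathbb{R}_+\times\mathbb{R},\qquad \rho(0,\cdot)=\rho_0 .$$ Moreover, for every $\varepsilon,h>0$ and $t>0$, $$\|W_{\varepsilon,h}(t,\cdot)-\rho(t,\cdot)\|_{\mathrm{L}^1(\mathbb{R})}\le K\big(\varepsilon+h+\sqrt{\varepsilon t}+\sqrt{ht}\big)\,\mathrm{TV}(\rho_0),$$ $$\|\rho_{\varepsilon,h}(t,\cdot)-\rho(t,\cdot)\|_{\mathrm{L}^1(\mathbb{R})}\le K\big(\varepsilon+h+\sqrt{\varepsilon t}+\sqrt{ht}\big)\,\mathrm{TV}(\rho_0),$$ where the constant $K>0$ depends only on $\lambda$, $\|V\|_{\mathrm{L}^\infty}$, $\|V'\|_{\mathrm{L}^\infty}$ and $c$.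
   Context: Numerical scheme: let $\varepsilon>0$ be the nonlocal horizon parameter, $h>0$ the spatial mesh size, $\tau>0$ the time step, and $\lambda=\tau/h$ the CFL ratio. Given weights $\{\gamma_k^{\varepsilon,h}\}_{k\ge0}$, define, for $j\in\mathbb{Z}$ and $n\ge 0$, $$\rho_j^0=\frac1h\int_{(j-\frac12)h}^{(j+\frac12)h}\rho_0(x)\,dx,\qquad W_j^n=\sum_{k=0}^\infty\gamma_k^{\varepsilon,h}\rho_{j+k}^n,\qquad \rho_j^{n+1}=\rho_j^n+\lambda\big(\rho_{j-1}^nV(W_j^n)-\rho_j^nV(W_{j+1}^n)\big).$$ The dependence of $\rho_j^n,W_j^n$ on $\varepsilon,h$ is suppressed in the notation. $\mathds{1}_A$ is the indicator function of $A$; $\mathrm{TV}$ is the total variation over $\mathbb{R}$; $\|V\|_{\mathrm{L}^\infty}$ and $\|V'\|_{\mathrm{L}^\infty}$ are norms over $[0,1]$. Entropy solution means the Kruzhkov entropy solution: $\rho\in\mathrm{L}^\infty(\mathbb{R}_+\times\mathbb{R})$ with values in $[0,1]$ such that for every $c'\in[0,1]$ and every nonnegative $\phi\in \mathrm{C}^1_{\mathrm{c}}([0,\infty)\times\mathbb{R})$, $\int_0^\infty\int_{\mathbb{R}}\big(|\rho-c'|\partial_t\phi+\mathrm{sign}(\rho-c')(\rho V(\rho)-c'V(c'))\partial_x\phi\big)\,dx\,dt+\int_{\mathbb{R}}|\rho_0(x)-c'|\phi(0,x)\,dx\ge 0$; it is taken in its representative continuous in time with values in $\mathrm{L}^1_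{\mathrm{loc}}(\mathbb{R})$.
   Formalization: V is additionally assumed nonnegative on [0,1]; without this the scheme can leave [0,1], where V is undefined, and for V = -1 extended constantly with λ = 1/2 the scheme is unstable and the stated error bounds fail. *)

(* Defs.v *)
(* MathComp / MathComp-Analysis, over an arbitrary R : realType. *)
From HB Require Import structures.
From mathcomp Require Import all_boot all_order all_algebra.
From mathcomp Require Import all_classical all_reals all_analysis.

Set Implicit Arguments.
Unset Strict Implicit.
Unset Printing Implicit Defensive.

Import Order.TTheory GRing.Theory Num.Theory.
Import numFieldNormedType.Exports.

Local Open Scope classical_set_scope.
Local Open Scope ring_scope.

Section Norms.
Context {R : realType}.
Notation mu := (@lebesgue_measure R).

(* Norm of L^oo([0,1]); f is extended by zero outside [0,1]. *)
Definition Linfty01 (f : R -> R) : \bar R :=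
  Lnorm mu +oo%E (EFin \o (f \_ `[0, 1])).

Definition pointwise_TV (f : R -> R) : \bar R :=
  ereal_sup [set total_variation ab.1 ab.2 f | ab in [set ab : R * R | ab.1 <= ab.2]].

(* Total variation over the real line of an element of L^oo, which is only
   defined almost everywhere: least pointwise variation of a representative. *)
Definition TV (f : R -> R) : \bar R :=
  ereal_inf [set pointwise_TV g | g in [set g | {ae mu, forall x, f x = g x}]].

End Norms.

Section Scheme.
Context {R : realType}.
Notation mu := (@lebesgue_measure R).

Definition nonlocal_average (gamma : nat -> R) (r : int -> R) (j : int) : R :=
  limn [series gamma k * r (j + k%:Z)]_k.

Definition cell_average (rho0 : R -> R) (h : R) (j : int) : R :=
  h^-1 * \int[mu]_(x in `[(j%:~R - 2^-1) * h, (j%:~R + 2^-1) * h]) rho0 x.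

(* V : R -> R stands for a function on [0,1]. When 0 <= V on [0,1], V' <= 0 and
   the CFL condition holds, the scheme stays in [0,1] and the values of V
   elsewhere are never used. *)
Fixpoint scheme_rho (V : R -> R) (lambda : R) (gamma : nat -> R)
    (r0 : int -> R) (n : nat) : int -> R :=
  if n is m.+1 then
    let r := scheme_rho V lambda gamma r0 m in
    let W := nonlocal_average gamma r in
    fun j => r j + lambda * (r (j - 1) * V (W j) - r j * V (W (j + 1)))
  else r0.

Definition scheme_W (V : R -> R) (lambda : R) (gamma : nat -> R)
    (r0 : int -> R) (n : nat) : int -> R :=
  nonlocal_average gamma (scheme_rho V lambda gamma r0 n).

Definition cell (tau h : R) (n : nat) (j : int) : set (R * R) :=
  `[n%:R * tau, n.+1%:R * tau[ `*`
  `[(j%:~R - 2^-1) * h, (j%:~R + 2^-1) * h[.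

(* The cells are disjoint, so at each point at most one term of each of the two
   sums is nonzero and these finitely supported sums are the intended ones. *)
Definition reconstruct (tau h : R) (u : nat -> int -> R) (t x : R) : R :=
  \sum_(n \in [set: nat]) \sum_(j \in [set: int])
     u n j * \1_(cell tau h n j) (t, x).

Definition geometric_weights (g : R) (k : nat) : R := g * (1 - g) ^+ k.

Definition rho_approx (V : R -> R) (lambda : R) (gamma : nat -> R)
    (rho0 : R -> R) (h : R) : R -> R -> R :=
  reconstruct (lambda * h) h (scheme_rho V lambda gamma (cell_average rho0 h)).

Definition W_approx (V : R -> R) (lambda : R) (gamma : nat -> R)
    (rho0 : R -> R) (h : R) : R -> R -> R :=
  reconstruct (lambda * h) h (scheme_W V lambda gamma (cell_average rho0 h)).

End Scheme.

(* Space-time functions are curried, time first: u t x. Only their values at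
   t >= 0 matter. *)
Section EntropySolution.
Context {R : realType}.
Notation mu := (@lebesgue_measure R).
Implicit Types (V : R -> R) (rho phi u v : R -> R -> R).

Definition dt phi (t x : R) : R := derive1 (fun s => phi s x) t.
Definition dx phi (t x : R) : R := derive1 (phi t) x.

Definition C1 phi : Prop :=
  [/\ forall t x, derivable (fun s => phi s x) t 1 /\ derivable (phi t) x 1,
      continuous (fun z : R * R => phi z.1 z.2),
      continuous (fun z : R * R => dt phi z.1 z.2) &
      continuous (fun z : R * R => dx phi z.1 z.2)].

(* Nonnegative elements of C^1_c([0,oo) x R), represented by compactly supported
   C^1 extensions to R x R; such an extension may be negative for t < 0. *)
Definition test_function phi : Prop :=
  [/\ C1 phi,
      compact (closure [set z : R * R | phi z.1 z.2 != 0]) &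
      forall t x, 0 <= t -> 0 <= phi t x].

Definition entropy_solution V (rho0 : R -> R) rho : Prop :=
  [/\ measurable_fun [set z : R * R | 0 <= z.1] (fun z : R * R => rho z.1 z.2),
      forall t x, 0 <= t -> 0 <= rho t x <= 1 &
      forall (k : R) phi, 0 <= k <= 1 -> test_function phi ->
        (0 <= \int[mu]_(t in `[0%R, +oo[) \int[mu]_x
                (`|rho t x - k| * dt phi t x
                 + Num.sg (rho t x - k) * (rho t x * V (rho t x) - k * V k)
                   * dx phi t x)%:E
              + \int[mu]_x (`|rho0 x - k| * phi 0 x)%:E)%E].

Definition time_continuous_L1loc rho : Prop :=
  forall t0 M : R, 0 <= t0 ->
    (fun t => \int[mu]_(x in `[(- M)%R, M]) `|rho t x - rho t0 x|%:E)%E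
      @ within `[0, +oo[ (nbhs t0) --> 0%E.

Definition ae_equal u v : Prop :=
  {ae (mu \x mu)%E, forall z : R * R, 0 <= z.1 -> u z.1 z.2 = v z.1 z.2}.

(* Convergence of u eps h to v in L^1_loc([0,oo) x R) as (eps, h) -> (0+, 0+). *)
Definition cvg_L1loc (u : R -> R -> R -> R -> R) v : Prop :=
  forall T M : R,
    (fun p : R * R =>
       \int[(mu \x mu)%E]_(z in `[0%R, T] `*` `[(- M)%R, M])
         `|u p.1 p.2 z.1 z.2 - v z.1 z.2|%:E)%E
      @ filter_prod (0 : R)^'+ (0 : R)^'+ --> 0%E.

Definition L1_dist (f g : R -> R) : \bar R :=
  (\int[mu]_x `|f x - g x|%:E)%E.

End EntropySolution.

(* Main.v *)
(** For geometric weights [gamma_0 rho_j = W_j - (1 - gamma_0) W_(j+1)], so the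
    averages [W] evolve by a closed conservative recursion.  Under the CFL
    condition this recursion is total variation diminishing and satisfies a
    discrete Kruzhkov inequality whose numerical flux differs from the exact one
    by an error summing to [O(TV / gamma_0)] at each time step; moreover [rho - W]
    is [O(eps TV)] in L1.  A Kuznetsov comparison of [W] with an arbitrary entropy
    solution, tested against products of splines in [t/tau] and [x/h] smoothed over
    [K] cells, costs [O(K h TV)] at the initial and final times and [O(eps + h) / K]
    per step; [K h ~ sqrt (t (eps + h))] gives the rate.  Since the solution is
    arbitrary and [W] may be taken at mesh sizes tending to 0, the same estimate
    gives uniqueness.  Existence comes from the scheme with [gamma_0 = 1]: a
    discrete doubling of variables compares it at mesh sizes [2 d] and [d], with
    error [O(sqrt d)], so that it is Cauchy along [d = 4 ^ -m], and the discrete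
    entropy inequality passes to the limit. *)

Require Import Defs.
From mathcomp Require Import all_boot all_order all_algebra.
From mathcomp Require Import all_classical all_reals all_analysis.
From mathcomp Require Import measurable_realfun ess_sup_inf.
From mathcomp Require Import ring lra zify.

Set Implicit Arguments.
Unset Strict Implicit.
Unset Printing Implicit Defensive.

Import Order.TTheory GRing.Theory Num.Theory.
Import numFieldNormedType.Exports.

Local Open Scope classical_set_scope.
Local Open Scope ring_scope.

(** * Geometric averages and the scheme *)

Section GeometricAverage.
Context {R : realType}.
Implicit Types (g C : R) (r : int -> R).

(** An arbitrary entropy solution [u] has no regularity and [u - W] no integrability; the comparison
    is arranged around this. At a fixed point [(t, x)] the number [u t x] is an admissible constant
    in the discrete entropy inequality; at a fixed [(n, j)] the number [W n j] is an admissible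
    constant in the inequality for [u]. Every pair [(n, j)] has its own test function, chosen so
    that its partial derivatives are, up to a cutoff, differences in [n] and [j]. Summation by parts
    at fixed [(t, x)] then cancels the main terms, and the errors left involve only increments and
    consistency errors of [W]. The cutoff shrinks at a speed that is a Lipschitz constant of the
    entropy flux, so its derivatives have a favourable sign. The result bounds a gap averaged over
    about two time steps. This is enough for uniqueness; at a fixed time the Lipschitz continuity in
    time of the constructed solution is used as well. Averages are infinite series, but a bounded
    sequence with [x j = g * r j + (1 - g) * x (j + 1)] is the average of [r], so identities and
    most bounds reduce to one step of this recursion. *)

Definition gavg g r : int -> R := nonlocal_average (geometric_weights g) r.

Lemma is_cvg_gavg g C r j : 0 < g <= 1 -> (forall k, `|r (j + k%:Z)| <= C) ->
  cvgn (series (fun k => geometric_weights g k * r (j + k%:Z))).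
Proof.
move=> /andP[g0 g1] rC; apply: normed_cvg.
have C0 : 0 <= C by exact: le_trans (rC 0%N).
apply: (@series_le_cvg _ _ (geometric (g * C) (1 - g))).
- by move=> n; exact: normr_ge0.
- by move=> n /=; rewrite mulr_ge0 ?mulr_ge0 ?exprn_ge0// ?subr_ge0// ltW.
- move=> n /=; rewrite normrM [X in X * _]ger0_norm; last first.
    by rewrite /geometric_weights mulr_ge0 ?exprn_ge0 ?subr_ge0// ltW.
  rewrite /geometric_weights -mulrA -mulrA ler_pM2l// mulrC.
  by rewrite ler_wpM2r ?exprn_ge0 ?subr_ge0.
- apply: is_cvg_geometric_series; rewrite ger0_norm ?subr_ge0//.
  by rewrite ltrBlDr ltrDl.
Qed.

Lemma gavg_rec g C r j : 0 < g <= 1 -> (forall i, `|r i| <= C) ->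
  gavg g r j = g * r j + (1 - g) * gavg g r (j + 1).
Proof.
move=> g01 rC; have c0 := @is_cvg_gavg g C r j g01 (fun=> rC _).
have c1 := @is_cvg_gavg g C r (j + 1) g01 (fun=> rC _).
rewrite /gavg /nonlocal_average.
apply/cvg_lim => //; rewrite -cvg_shiftS/=.
rewrite (_ : (fun n => _) = (fun n => g * r j + (1 - g) *
    series (fun k => geometric_weights g k * r (j + 1 + k%:Z)) n)); last first.
  apply/funext => n; rewrite /series/= big_nat_recl//=.
  rewrite /geometric_weights expr0 mulr1 addr0; congr (_ + _).
  rewrite mulr_sumr; apply: eq_bigr => i _; rewrite exprS intS addrA; ring.
by apply: cvgD; [exact: cvg_cst|apply: cvgM => //; exact: cvg_cst].
Qed.

(** Iteration gives [x j <= (1 - g) ^+ n * x (j + n)], and the right-hand side tends to 0 because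
    [x] is bounded. This is the comparison principle behind [le_gavg], [ge_gavg] and
    [gavg_unique]. *)
Lemma geom_contraction_eq0 g C (x : int -> R) : 0 < g <= 1 ->
  (forall j, `|x j| <= C) -> (forall j, x j <= (1 - g) * x (j + 1)) ->
  forall j, x j <= 0.
Proof.
move=> /andP[g0 g1] xC xr j.
have xn n : x j <= (1 - g) ^+ n * x (j + n%:Z).
  elim: n => [|n IH]; first by rewrite expr0 mul1r addr0.
  apply: (le_trans IH); rewrite exprSr -mulrA ler_wpM2l ?exprn_ge0 ?subr_ge0//.
  by rewrite (le_trans (xr _))// (_ : j + n%:Z + 1 = j + n.+1%:Z)//; lia.
have : (1 - g) ^+ n * C @[n --> \oo] --> (0 : R).
  rewrite -(mul0r C); apply: cvgM; last exact: cvg_cst.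
  by apply: cvg_expr; rewrite ger0_norm ?subr_ge0// ltrBlDr ltrDl.
move=> /cvg_lim <- //; apply: limr_ge.
  apply: is_cvgM; last exact: is_cvg_cst.
  by apply/cvg_ex; exists 0; apply: cvg_expr; rewrite ger0_norm ?subr_ge0// ltrBlDr ltrDl.
apply: nearW => n; apply: (le_trans (xn n)).
rewrite ler_wpM2l ?exprn_ge0 ?subr_ge0//.
by rewrite (le_trans (ler_norm _)).
Qed.

Lemma sum_geometric_weights g n :
  \sum_(0 <= k < n) geometric_weights g k = 1 - (1 - g) ^+ n.
Proof.
elim: n => [|n IH]; first by rewrite big_geq// expr0 subrr.
rewrite big_nat_recr//= IH /geometric_weights exprS; ring.
Qed.

(** Only values at and to the right of [j] are constrained. This one-sided form is what controls the
    end term of a window in [gap_step_wsum]. *)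
Lemma gavg_bound_from g C r j : 0 < g <= 1 ->
  (forall k, `|r (j + k%:Z)| <= C) -> `|gavg g r j| <= C.
Proof.
move=> g01 rC; have cr := @is_cvg_gavg g C r j g01 rC.
have C0 : 0 <= C by exact: le_trans (rC 0%N).
have bd n : `|series (fun k => geometric_weights g k * r (j + k%:Z)) n| <= C.
  rewrite /series/=; apply: (le_trans (ler_norm_sum _ _ _)).
  apply: (@le_trans _ _ (\sum_(0 <= k < n) geometric_weights g k * C)).
    apply: ler_sum => k _; rewrite normrM ger0_norm.
      by rewrite ler_wpM2l// /geometric_weights mulr_ge0 ?exprn_ge0; lra.
    by rewrite /geometric_weights mulr_ge0 ?exprn_ge0; lra.
  rewrite -mulr_suml sum_geometric_weights ler_piMl//.
  by rewrite gerBl exprn_ge0//; lra.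
rewrite ler_norml; apply/andP; split.
  by apply: limr_ge => //; apply: nearW => n; have := bd n; rewrite ler_norml => /andP[].
by apply: limr_le => //; apply: nearW => n; have := bd n; rewrite ler_norml => /andP[].
Qed.

Lemma gavg_bound g C r j : 0 < g <= 1 -> (forall i, `|r i| <= C) ->
  `|gavg g r j| <= C.
Proof. by move=> g01 rC; apply: gavg_bound_from. Qed.

Lemma le_gavg g C C' (x r : int -> R) : 0 < g <= 1 ->
  (forall i, `|x i| <= C) -> (forall i, `|r i| <= C') ->
  (forall i, x i <= g * r i + (1 - g) * x (i + 1)) ->
  forall j, x j <= gavg g r j.
Proof.
move=> g01 xC rC xr j; rewrite -subr_le0.
apply: (@geom_contraction_eq0 g (C + C') (fun i => x i - gavg g r i)) => // i.
  by rewrite (le_trans (ler_normB _ _))// lerD// gavg_bound.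
rewrite (gavg_rec i g01 rC) mulrBr; have := xr i; lra.
Qed.

Lemma ge_gavg g C C' (x r : int -> R) : 0 < g <= 1 ->
  (forall i, `|x i| <= C) -> (forall i, `|r i| <= C') ->
  (forall i, g * r i + (1 - g) * x (i + 1) <= x i) ->
  forall j, gavg g r j <= x j.
Proof.
move=> g01 xC rC xr j; rewrite -subr_le0.
apply: (@geom_contraction_eq0 g (C' + C) (fun i => gavg g r i - x i)) => // i.
  by rewrite (le_trans (ler_normB _ _))// lerD// gavg_bound.
rewrite (gavg_rec i g01 rC) mulrBr; have := xr i; lra.
Qed.

Lemma gavg_unique g C C' (x r : int -> R) : 0 < g <= 1 ->
  (forall i, `|x i| <= C) -> (forall i, `|r i| <= C') ->
  (forall i, x i = g * r i + (1 - g) * x (i + 1)) -> x =1 gavg g r.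
Proof.
move=> g01 xC rC xr j; apply: le_anti; apply/andP; split.
  by apply: (le_gavg g01 xC rC) => i; rewrite -xr.
by apply: (ge_gavg g01 xC rC) => i; rewrite -xr.
Qed.

Lemma gavg_itv g (r : int -> R) : 0 < g <= 1 ->
  (forall i, 0 <= r i <= 1) -> forall j, 0 <= gavg g r j <= 1.
Proof.
move=> g01 r01 j.
have rC i : `|r i| <= 1 by have := r01 i; rewrite ler_norml; lra.
have xC (c : R) : 0 <= c <= 1 -> forall i : int, `|c| <= 1.
  by move=> ? _; rewrite ler_norml; lra.
apply/andP; split.
  apply: (@le_gavg g 1 1 (fun=> 0)) => //; first by apply: xC; lra.
  by move=> i; have := r01 i; nra.
apply: (@ge_gavg g 1 1 (fun=> 1)) => //; first by apply: xC; lra.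
by move=> i; have := r01 i; nra.
Qed.

Lemma normr_gavg_le g C (r s : int -> R) : 0 < g <= 1 ->
  (forall i, `|s i| <= C) -> (forall i, `|r i| <= s i) ->
  forall j, `|gavg g r j| <= gavg g s j.
Proof.
move=> g01 sC rs j.
have rC i : `|r i| <= C by rewrite (le_trans (rs i))// (le_trans (ler_norm _)).
rewrite ler_norml lerNl; apply/andP; split.
  apply: (@le_gavg g C C (fun j => - gavg g r j)) => // i.
    by rewrite normrN gavg_bound.
  rewrite (gavg_rec i g01 rC); have := rs i; rewrite ler_norml => /andP[h _].
  have : g * - s i <= g * r i by rewrite ler_wpM2l//; lra.
  lra.
apply: (@le_gavg g C C (fun j => gavg g r j)) => // i.
  by rewrite gavg_bound.
rewrite (gavg_rec i g01 rC); have := rs i; rewrite ler_norml => /andP[_ h].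
have : g * r i <= g * s i by rewrite ler_wpM2l//; lra.
lra.
Qed.

(* For nonnegative [f] this says that the sum of [f] over all integers is at most [T]. *)
Definition wsum_le (f : int -> R) (T : R) : Prop :=
  forall (a : int) n, \sum_(i < n) f (a + i%:Z) <= T.

Lemma wsum_le_ge0 f T : wsum_le f T -> 0 <= T.
Proof. by move=> /(_ 0 0%N); rewrite big_ord0. Qed.

Lemma wsum_le_term f T : wsum_le f T -> forall j, f j <= T.
Proof. by move=> /(_ _ 1%N) h j; have := h j; rewrite big_ord1 addr0. Qed.

Lemma wsum_le_shift f T k : wsum_le f T -> wsum_le (fun j => f (j + k)) T.
Proof.
move=> fT a n; under eq_bigr do rewrite addrAC; exact: fT.
Qed.

Lemma wsum_le_le f f' T : (forall j, f' j <= f j) -> wsum_le f T -> wsum_le f' T.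
Proof. by move=> f'f fT a n; apply: le_trans (fT a n); apply: ler_sum. Qed.

Lemma wsum_leM f T c : 0 <= c -> wsum_le f T -> wsum_le (fun j => c * f j) (c * T).
Proof. by move=> c0 fT a n; rewrite -mulr_sumr ler_wpM2l//; exact: fT. Qed.

Lemma wsum_leD f f' T T' : wsum_le f T -> wsum_le f' T' ->
  wsum_le (fun j => f j + f' j) (T + T').
Proof. by move=> fT fT' a n; rewrite big_split/=; apply: lerD; [exact: fT|exact: fT']. Qed.

(** Window sums commute with averaging: the window sum of the average is the average of the window
    sums of [f], all of which are at most [T]. *)
Lemma wsum_gavg g (f : int -> R) T : 0 < g <= 1 -> (forall j, 0 <= f j) ->
  wsum_le f T -> wsum_le (gavg g f) T.
Proof.
move=> g01 f0 fT a n.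
have fC i : `|f i| <= T by rewrite ger0_norm// wsum_le_term.
have F0 b m : 0 <= \sum_(i < m) f (b + i%:Z) by apply: sumr_ge0.
have FT b m : `|\sum_(i < m) f (b + i%:Z)| <= T by rewrite ger0_norm.
have -> : \sum_(i < n) gavg g f (a + i%:Z) =
    gavg g (fun b => \sum_(i < n) f (b + i%:Z)) a.
  apply: (@gavg_unique g (n%:R * T) T
    (fun b => \sum_(i < n) gavg g f (b + i%:Z))) => // b.
  - apply: (le_trans (ler_norm_sum _ _ _)).
    apply: (@le_trans _ _ (\sum_(i < n) T)).
      by apply: ler_sum => i _; apply: gavg_bound.
    by rewrite sumr_const card_ord mulr_natl.
  - rewrite !mulr_sumr -big_split/=; apply: eq_bigr => i _.
    by rewrite (gavg_rec _ g01 fC) (_ : b + i%:Z + 1 = b + 1 + i%:Z)//; lia.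
by have := @gavg_bound g T (fun b => \sum_(i < n) f (b + i%:Z)) a g01 (fun b => FT b n);
  rewrite ler_norml => /andP[].
Qed.

End GeometricAverage.

(** * Velocities and the Kruzhkov entropy flux *)

Section Velocity.
Context {R : realType}.

(** Pointwise substitute for the almost everywhere assumptions on [V], from which [velocity_of_ae]
    derives it. *)
Definition velocity (V : R -> R) (vM lV : R) : Prop :=
  [/\ 0 <= vM, 0 <= lV, forall x, 0 <= x <= 1 -> 0 <= V x <= vM &
      forall x y, 0 <= x -> x <= y -> y <= 1 -> 0 <= V x - V y <= lV * (y - x)].

(* For [0 <= u], [0 <= k] and antitone [V] this is [sgn (u - k) (u V u - k V k)],
   see [kfluxE]; written so, it involves no [sgn]. *)
Definition kflux (V : R -> R) (u k : R) : R :=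
  V k * `|u - k| - u * `|V u - V k|.

Variables (V : R -> R) (vM lV : R).
Hypothesis hV : velocity V vM lV.

Lemma velocity_lip x y : 0 <= x <= 1 -> 0 <= y <= 1 ->
  `|V x - V y| <= lV * `|x - y|.
Proof.
move: hV => [_ _ _ h] x01 y01; have [xy|yx] := leP x y.
  have := h x y; move/(_ ltac:(lra) xy ltac:(lra)) => ?.
  by rewrite (ler0_norm (_ : x - y <= 0)); [rewrite ger0_norm; lra|lra].
have := h y x; move/(_ ltac:(lra) (ltW yx) ltac:(lra)) => ?.
by rewrite (gtr0_norm (_ : 0 < x - y)); [rewrite ler0_norm; lra|lra].
Qed.

Lemma kfluxE u k : 0 <= u <= 1 -> 0 <= k <= 1 ->
  kflux V u k = Num.sg (u - k) * (u * V u - k * V k).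
Proof.
move: hV => [_ _ _ h] u01 k01; rewrite /kflux.
have [uk|ku|<-] := ltgtP u k.
- have := h u k; move/(_ ltac:(lra) (ltW uk) ltac:(lra)) => /andP[? _].
  rewrite ltr0_sg ?subr_lt0// ltr0_norm ?subr_lt0// ger0_norm//; ring.
- have := h k u; move/(_ ltac:(lra) (ltW ku) ltac:(lra)) => /andP[? _].
  rewrite gtr0_sg ?subr_gt0// gtr0_norm ?subr_gt0// ler0_norm//; last by lra.
  ring.
- by rewrite !subrr normr0 sgr0 !mulr0 subrr.
Qed.

(** The three terms of the decomposition contribute [vM], [vM] and [lV]. Rounded up to
    [2 * (vM + lV)], the constant times [lambda] is at most 2 under the CFL condition. *)
Lemma kflux_lip u w k : 0 <= u <= 1 -> 0 <= w <= 1 -> 0 <= k <= 1 ->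
  `|kflux V u k - kflux V w k| <= (2 * (vM + lV)) * `|u - w|.
Proof.
move=> u01 w01 k01; move: (hV) => [vM0 lV0 hb _].
have Vk := hb _ k01; have Vu := hb _ u01; have Vw := hb _ w01.
have e1 : `|(`|u - k| - `|w - k|)| <= `|u - w|.
  by rewrite (le_trans (ler_dist_dist _ _))// opprB addrA subrK.
have e2 : `|(`|V u - V k| - `|V w - V k|)| <= lV * `|u - w|.
  rewrite (le_trans (ler_dist_dist _ _))// opprB addrA subrK.
  exact: velocity_lip.
have e3 : `|V u - V k| <= vM by rewrite ler_norml; lra.
have -> : kflux V u k - kflux V w k =
  V k * (`|u - k| - `|w - k|) - (u - w) * `|V u - V k|
  - w * (`|V u - V k| - `|V w - V k|) by rewrite /kflux; ring.
have b1 : `|V k * (`|u - k| - `|w - k|)| <= vM * `|u - w|.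
  by rewrite normrM ler_pM// ger0_norm; lra.
have b2 : `|(u - w) * (`|V u - V k|)| <= vM * `|u - w|.
  by rewrite normrM mulrC ler_pM// normr_id.
have b3 : `|w * (`|V u - V k| - `|V w - V k|)| <= lV * `|u - w|.
  rewrite normrM -[leRHS]mul1r ler_pM// ger0_norm; lra.
have b4 : 0 <= lV * `|u - w| by rewrite mulr_ge0.
rewrite (le_trans (ler_normB _ _))// (le_trans (lerD (ler_normB _ _) (lexx _)))//.
lra.
Qed.

Lemma kfluxC u k : 0 <= u <= 1 -> 0 <= k <= 1 -> kflux V u k = kflux V k u.
Proof.
move=> u01 k01; rewrite !kfluxE// -opprB sgrN -[k * V k - _]opprB; ring.
Qed.

Lemma kflux_le u k : 0 <= u <= 1 -> 0 <= k <= 1 ->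
  `|kflux V u k| <= (2 * (vM + lV)) * `|u - k|.
Proof.
move=> u01 k01; have := kflux_lip u01 k01 k01.
by rewrite {2}/kflux !subrr normr0 !mulr0 !subr0.
Qed.

End Velocity.

(** Since [e] has the sign of [a] and [s * e] is dominated by [(1 - p) * a], the subtraction lowers
    the modulus by the full amount [s] times the modulus of [e]. This gain pays for the remaining
    velocity differences in each contraction and entropy estimate below. *)
Lemma absorb_same_sign (R : realDomainType) (a e p s c : R) : 0 <= s ->
  0 <= a * e -> `|e| <= c * `|a| -> s * c <= 1 - p ->
  `|(1 - p) * a - s * e| <= (1 - p) * `|a| - s * `|e|.
Proof.
move=> s0 ae ec scp.
have h : s * `|e| <= (1 - p) * `|a|.
  by rewrite (le_trans (ler_wpM2l s0 ec))// mulrA ler_wpM2r.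
have [a0|a0|a0] := ltgtP a 0.
- have e0 : e <= 0 by rewrite -(nmulr_rge0 _ a0).
  move: h; rewrite (ltr0_norm a0) (ler0_norm e0) => h.
  rewrite ler0_norm; lra.
- have e0 : 0 <= e by rewrite -(pmulr_rge0 _ a0).
  move: h; rewrite (gtr0_norm a0) (ger0_norm e0) => h.
  rewrite ger0_norm; lra.
- move: ec; rewrite a0 normr0 mulr0 normr_le0 => /eqP ->.
  by rewrite normr0 !mulr0 subrr normr0.
Qed.

(** * One step of the nonlocal scheme *)

Section SchemeStep.
Context {R : realType}.
Variables (V : R -> R) (vM lV lambda g : R).
Hypotheses (hV : velocity V vM lV) (l0 : 0 < lambda)
  (cfl : lambda * (vM + lV) <= 1) (g01 : 0 < g <= 1).
Variable r : int -> R.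
Hypothesis r01 : forall j, 0 <= r j <= 1.
Let W := gavg g r.
Let r' j := r j + lambda * (r (j - 1) * V (W j) - r j * V (W (j + 1))).
Let W' := gavg g r'.
Let b := 1 - g.

Let rC i : `|r i| <= 1. Proof. by have := r01 i; rewrite ler_norml; lra. Qed.

Lemma W01 j : 0 <= W j <= 1. Proof. exact: gavg_itv. Qed.

Lemma Wrec j : W j = g * r j + b * W (j + 1).
Proof. exact: (gavg_rec j g01 rC). Qed.

Let VW j : 0 <= V (W j) <= vM.
Proof. by case: hV => _ _ h _; apply: h; exact: W01. Qed.

Lemma cfl_vM v : 0 <= v <= vM -> 0 <= lambda * v <= 1 - lambda * lV.
Proof.
move=> v0; rewrite mulr_ge0 ?(ltW l0)//=; last by lra.
have : lambda * v <= lambda * vM by rewrite ler_pM2l//; lra.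
move: cfl; rewrite mulrDr; lra.
Qed.

Lemma scheme_step_itv j : 0 <= r' j <= 1.
Proof.
have g01' := g01; have [_ lV0 _ _] := hV.
have c1 := cfl_vM (VW j); have c2 := cfl_vM (VW (j + 1)).
have rj := r01 j; have rj1 := r01 (j - 1); apply/andP; split.
  have -> : r' j = r j * (1 - lambda * V (W (j + 1))) +
    r (j - 1) * (lambda * V (W j)) by rewrite /r'; ring.
  have := mulr_ge0 (ltW l0) lV0 => ?.
  by rewrite addr_ge0// mulr_ge0//; lra.
have h1 : r (j - 1) * (lambda * V (W j)) <= lambda * V (W j).
  by rewrite -[leRHS]mul1r ler_wpM2r//; lra.
(* The recursion gives [W (j + 1) - W j = g * (W (j + 1) - r j)], at most [1 - r j]. So the speed
   drops across the cell by at most [lV * (1 - r j)], and a nearly full cell cannot overflow. *)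
have h2 : lambda * (V (W j) - V (W (j + 1))) <= lambda * lV * (1 - r j).
  rewrite -mulrA ler_pM2l//.
  have w := W01 j; have w1 := W01 (j + 1).
  have [ww|ww] := leP (W j) (W (j + 1)).
    case: hV => _ _ _ /(_ (W j) (W (j + 1))).
    move/(_ ltac:(lra) ww ltac:(lra)) => /andP[_ h]; apply: (le_trans h).
    rewrite ler_wpM2l// (Wrec j) /b.
    have : g * (W (j + 1) - r j) <= 1 * (1 - r j).
      have [?|?] := leP (W (j + 1)) (r j).
        have : g * (W (j + 1) - r j) <= 0 
          by apply: mulr_ge0_le0; [case/andP: g01 => /ltW|rewrite subr_le0].
        lra.
      by apply: ler_pM; lra.
    lra.
  case: hV => _ _ _ /(_ (W (j + 1)) (W j)).
  move/(_ ltac:(lra) (ltW ww) ltac:(lra)) => /andP[h _].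
  have : 0 <= lV * (1 - r j) by rewrite mulr_ge0//; lra.
  lra.
have h3 : lambda * lV * (1 - r j) + (1 - r j) * (lambda * V (W (j + 1))) <= 1 - r j.
  have : 0 <= (1 - r j) * (1 - lambda * lV - lambda * V (W (j + 1))) by rewrite mulr_ge0//; lra.
  lra.
rewrite /r'; lra.
Qed.

Let r'C i : `|r' i| <= 1.
Proof. by have := scheme_step_itv i; rewrite ler_norml; lra. Qed.
Let F i := r i * V (W (i + 1)).

Let FC i : `|F i| <= vM.
Proof.
have := VW (i + 1); have := r01 i => ? ?.
rewrite /F ger0_norm; last by rewrite mulr_ge0//; lra.
by rewrite -[leRHS]mul1r; apply: ler_pM; lra.
Qed.

Let Grec i : gavg g F i = g * (r i * V (W (i + 1))) + b * gavg g F (i + 1).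
Proof. exact: (gavg_rec i g01 FC). Qed.

Let Gpred i : gavg g F (i - 1) = g * (r (i - 1) * V (W i)) + b * gavg g F i.
Proof. by rewrite (Grec (i - 1)) subrK. Qed.

(** Averaging commutes with translation by one cell, hence turns the conservative update of [r] into
    a conservative update of [W] with the averaged flux. *)
Lemma W'_conservative j : W' j = W j + lambda * (gavg g F (j - 1) - gavg g F j).
Proof.
apply/esym; apply: (@gavg_unique _ g (1 + lambda * (vM + vM)) 1
  (fun j => W j + lambda * (gavg g F (j - 1) - gavg g F j))) => // i.
  rewrite (le_trans (ler_normD _ _))// lerD// ?gavg_bound//.
  rewrite normrM gtr0_norm// ler_pM2l//.
  by rewrite (le_trans (ler_normB _ _))// lerD// gavg_bound.
rewrite (Wrec i) (Gpred i) addrK /r'.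
by rewrite {1}(_ : gavg g F i = g * gavg g F i + b * gavg g F i) ?(Grec i) /b; ring.
Qed.

Let D j := W (j + 1) - W j.
Let E j := W j * (V (W j) - V (W (j + 1))).

Lemma ED j : `|E j| <= lV * `|D j|.
Proof.
have w := W01 j; rewrite /E normrM ger0_norm; last by lra.
have h := velocity_lip hV w (W01 (j + 1)).
rewrite /D [in leRHS]distrC (le_trans _ h)//.
by rewrite -[leRHS]mul1r ler_wpM2r//; lra.
Qed.

Let EC i : `|E i| <= lV.
Proof.
have [_ lV0 _ _] := hV.
rewrite (le_trans (ED i))// -[leRHS]mulr1 ler_wpM2l// ler_norml /D.
by have := W01 i; have := W01 (i + 1); lra.
Qed.

(** Nonconservative form: [W] is transported from the left at its own speed [V (W j)], and the
    average of [E] collects the change of speed further to the right. It rests on [gavg g E i = g *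
    (V (W i) * W i - gavg g F i)], proved by uniqueness for the recursion. *)
Lemma W'_transport j :
  W' j = W j - lambda * V (W j) * D (j - 1) + lambda * gavg g E j.
Proof.
have g01' := g01.
have key i : gavg g E i = g * (V (W i) * W i - gavg g F i).
  apply/esym.
  apply: (@gavg_unique _ g (1 * (vM + vM)) lV
    (fun i => g * (V (W i) * W i - gavg g F i))) => // k.
    rewrite normrM; apply: ler_pM => //; first by rewrite gtr0_norm; lra.
    rewrite (le_trans (ler_normB _ _))// lerD// ?gavg_bound//.
    have := VW k; have := W01 k => ? ?.
    rewrite ger0_norm; last by rewrite mulr_ge0//; lra.
    by rewrite -[leRHS]mulr1; apply: ler_pM; lra.
  rewrite (Grec k) /E /b.
  have -> : g * (V (W k) * W k - (g * (r k * V (W (k + 1))) + (1 - g) * gavg g F (k + 1)))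
    = g * (V (W k) * W k - (g * r k) * V (W (k + 1)) - (1 - g) * gavg g F (k + 1)) by ring.
  have -> : g * r k = W k - (1 - g) * W (k + 1) by rewrite (Wrec k) /b; ring.
  ring.
rewrite W'_conservative key (Gpred j) /D subrK.
have -> : g * (r (j - 1) * V (W j)) = (W (j - 1) - (1 - g) * W j) * V (W j).
  have -> : W (j - 1) = g * r (j - 1) + b * W j by rewrite (Wrec (j - 1)) subrK.
  rewrite /b; ring.
rewrite /b; ring.
Qed.

Let Erec i : gavg g E i = g * E i + b * gavg g E (i + 1).
Proof. exact: (gavg_rec i g01 EC). Qed.

Let A := gavg g (fun i => `|E i|).

Let Arec i : A i = g * `|E i| + b * A (i + 1).
Proof. by apply: (@gavg_rec _ g lV) => // k; rewrite normr_id. Qed.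

Let EA i : `|gavg g E i| <= A i.
Proof. by apply: (@normr_gavg_le _ g lV) => // k; rewrite normr_id. Qed.

Lemma velocity_antitone x y : 0 <= x <= 1 -> 0 <= y <= 1 ->
  0 <= (y - x) * (V x - V y).
Proof.
case: (hV) => _ _ _ h x01 y01; have [xy|yx] := leP x y.
  have /andP[h0 _] := h x y ltac:(lra) xy ltac:(lra).
  by apply: mulr_ge0; [rewrite subr_ge0|exact: h0].
have /andP[h0 _] := h y x ltac:(lra) (ltW yx) ltac:(lra).
rewrite -mulrNN !opprB.
by apply: mulr_ge0; [rewrite subr_ge0 ltW|exact: h0].
Qed.

Let DE j : 0 <= D j * E j.
Proof.
have w := W01 j; rewrite /D /E mulrCA; apply: mulr_ge0; first by lra.
exact: velocity_antitone (W01 _) (W01 _).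
Qed.

(** [E j] has the sign of [D j], so [absorb_same_sign] gains [lambda * g] times its modulus. By the
    recursion for [A], this gain and the nonlocal contribution [lambda * g * A (j + 1)] combine into
    [lambda * (A (j + 1) - A j)], which telescopes like the transport terms. *)
Lemma gap_step_le j : `|W' (j + 1) - W' j| <= `|D j| +
  lambda * (V (W j) * `|D (j - 1)| - V (W (j + 1)) * `|D j|) +
  lambda * (A (j + 1) - A j).
Proof.
have g01' := g01; have l0' := l0; have [_ lV0 _ _] := hV.
have -> : W' (j + 1) - W' j =
  ((1 - lambda * V (W (j + 1))) * D j - (lambda * g) * E j) +
  (lambda * V (W j)) * D (j - 1) + (lambda * g) * gavg g E (j + 1).
  rewrite !W'_transport addrK (Erec j) /b /D; ring.
have lV1 : 0 <= lambda * lV by rewrite mulr_ge0// ltW.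
have lg : 0 <= lambda * g by rewrite mulr_ge0//; lra.
have s := @absorb_same_sign _ (D j) (E j) (lambda * V (W (j + 1))) (lambda * g) lV
  lg (DE j) (ED j).
have /s {}s : lambda * g * lV <= 1 - lambda * V (W (j + 1)).
  have := cfl_vM (VW (j + 1)).
  have : lambda * lV * g <= lambda * lV * 1 by rewrite ler_wpM2l//; lra.
  lra.
rewrite (le_trans (ler_normD _ _))// (le_trans (lerD (ler_normD _ _) (lexx _)))//.
have := cfl_vM (VW j) => vj.
rewrite (normrM (_ * V _)) (normrM (_ * g)) (ger0_norm lg) (ger0_norm (_ : 0 <= lambda * V (W j))); last by lra.
have e := ler_wpM2l lg (EA (j + 1)).
rewrite (Arec j) /b; lra.
Qed.

(** After telescoping over a window, the inflow at the left is at most the gap at [a - 1], while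
    [A (a + n)] averages quantities bounded by gaps to the right of the window. These gaps are
    disjoint from the window, so a larger window of the old sequence bounds everything. *)
Lemma gap_step_wsum T : wsum_le (fun j => `|D j|) T ->
  wsum_le (fun j => `|W' (j + 1) - W' j|) T.
Proof.
move=> DT a n.
have g01' := g01; have l0' := l0; have [_ lV0 _ _] := hV.
have lV1 : 0 <= lambda * lV by rewrite mulr_ge0// ltW.
have tel (f : int -> R) : \sum_(i < n) (f (a + i%:Z + 1) - f (a + i%:Z)) =
    f (a + n%:Z) - f a.
  rewrite -(big_mkord xpredT (fun i : nat => f (a + i%:Z + 1) - f (a + i%:Z))).
  rewrite (eq_bigr (fun i : nat => f (a + i.+1%:Z) - f (a + i%:Z))).
    by rewrite (telescope_sumr (fun i => f (a + i%:Z)))// addr0.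
  by move=> i _; congr (f _ - _); lia.
pose B j := V (W j) * `|D (j - 1)|.
have : \sum_(i < n) `|W' (a + i%:Z + 1) - W' (a + i%:Z)| <=
    \sum_(i < n) `|D (a + i%:Z)| + lambda * (B a - B (a + n%:Z))
    + lambda * (A (a + n%:Z) - A a).
  rewrite -(tel A) -opprB -(tel B) -sumrN !mulr_sumr -!big_split/=.
  apply: ler_sum => i _; rewrite (le_trans (gap_step_le _))//.
  by rewrite /B addrK opprB.
move=> /le_trans; apply.
have B0 j : 0 <= B j by rewrite mulr_ge0//; have := VW j; lra.
have A0 j : 0 <= A j by exact: le_trans (EA j).
have Ba : lambda * B a <= `|D (a - 1)|.
  rewrite /B mulrA -[leRHS]mul1r ler_wpM2r//.
  by have := cfl_vM (VW a); lra.
(* An average is at most any bound of its entries, so one entry [a + n + k] is treated at a time: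
   the [n + k + 2] gaps starting at [a - 1] contain it, the left gap and the whole window. *)
have lA : lambda * A (a + n%:Z) <=
    T - `|D (a - 1)| - \sum_(i < n) `|D (a + i%:Z)|.
  rewrite -ler_pdivlMl// (le_trans (ler_norm _))//.
  apply: gavg_bound_from => // k; rewrite ler_pdivlMl// normr_id.
  rewrite (le_trans (ler_wpM2l (ltW l0) (ED _)))// mulrA.
  apply: (@le_trans _ _ `|D (a + n%:Z + k%:Z)|).
    rewrite -[leRHS]mul1r ler_wpM2r//; move: cfl; rewrite mulrDr.
    by have := mulr_ge0 (ltW l0) (le_trans (proj1 (andP (VW 0))) (proj2 (andP (VW 0)))); lra.
  have := DT (a - 1) (n + k).+2.
  rewrite big_ord_recl/= addr0 big_ord_recr/=.
  rewrite (_ : a - 1 + _ = a + n%:Z + k%:Z); last by rewrite /bump/=; lia.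
  suff : \sum_(i < n) `|D (a + i%:Z)| <=
     \sum_(i < n + k) `|D (a - 1 + (bump 0 (widen_ord (leqnSn (n + k)) i))%:Z)| by lra.
  rewrite big_split_ord/= -[leLHS]addr0 lerD//; last by apply: sumr_ge0.
  by apply: ler_sum => i _ /=; rewrite (_ : a - 1 + _ = a + i%:Z)// /bump/=; lia.
have := mulr_ge0 (ltW l0) (A0 a); have := mulr_ge0 (ltW l0) (B0 (a + n%:Z)); lra.
Qed.

(** Transport contributes [lambda * vM * T] and the averaged term [lambda * lV * T]; the CFL
    condition makes the sum at most [T]. *)
Lemma time_step_wsum T : wsum_le (fun j => `|D j|) T ->
  wsum_le (fun j => `|W' j - W j|) T.
Proof.
have [vM0 lV0 _ _] := hV.
move=> DT; apply: (@wsum_le_le _ (fun j => lambda * vM * `|D (j - 1)| + lambda * A j)).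
  move=> j; have -> : W' j - W j = - (lambda * V (W j) * D (j - 1)) + lambda * gavg g E j.
    rewrite W'_transport; ring.
  rewrite (le_trans (ler_normD _ _))// normrN !normrM (gtr0_norm l0).
  apply: lerD; last by rewrite ler_wpM2l ?(ltW l0).
  by rewrite ler_wpM2r// ler_wpM2l ?(ltW l0)// ger0_norm; have := VW j; lra.
have h1 : wsum_le (fun j => lambda * vM * `|D (j - 1)|) (lambda * vM * T).
  apply: wsum_leM; first by rewrite mulr_ge0// ltW.
  exact: (wsum_le_shift (- 1) DT).
have h2 : wsum_le (fun j => lambda * A j) (lambda * (lV * T)).
  apply: wsum_leM; first by rewrite ltW.
  apply: wsum_gavg => //.
  by apply: (wsum_le_le ED); exact: wsum_leM.
move=> a n; apply: (le_trans (wsum_leD h1 h2 a n)).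
rewrite mulrA -mulrDl -mulrDr -[leRHS]mul1r ler_wpM2r//.
exact: wsum_le_ge0 DT.
Qed.

(** Compared with [kflux], the second term is replaced by an average of products of the density [r]
    with the velocity difference one cell ahead; this makes the flux follow the recursion of
    [gavg]. *)
Definition kphi k j : R :=
  V k * `|W j - k| - gavg g (fun i => r i * `|V k - V (W (i + 1))|) j.

(** Comparison with the constant speed [V k] writes the averaged flux as [V k * W] minus the average
    of [y]. As [V] is antitone, [V k - V (W j)] has the sign of [W j - k], which allows
    [absorb_same_sign]; the recursion then assembles the modulus terms into a flux difference. *)
Lemma entropy_step k j : 0 <= k <= 1 ->
  `|W' j - k| <= `|W j - k| + lambda * (kphi k (j - 1) - kphi k j).
Proof.
move=> k01; have g01' := g01; have l0' := l0; have [vM0 lV0 hb _] := hV.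
pose y i := r i * (V k - V (W (i + 1))).
have Vk := hb _ k01.
have yl i : `|V k - V (W i)| <= vM by have := VW i; rewrite ler_norml; lra.
have yC i : `|y i| <= vM.
  rewrite /y normrM -[leRHS]mul1r; apply: ler_pM => //.
have yC' i : `|r i * `|V k - V (W (i + 1))| | <= vM.
  by rewrite normrM normr_id -normrM; exact: yC i.
have GE i : gavg g F i = V k * W i - gavg g y i.
  apply/esym; apply: (@gavg_unique _ g (vM * 1 + vM) vM
     (fun i => V k * W i - gavg g y i)) => // m.
    rewrite (le_trans (ler_normB _ _))// lerD ?gavg_bound// normrM ler_pM//.
      by rewrite ger0_norm; lra.
    exact: gavg_bound.
  rewrite (gavg_rec m g01 yC) {1}(Wrec m) /y /F /b; ring.
have Yrec i : gavg g y i = g * y i + b * gavg g y (i + 1).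
  exact: (gavg_rec i g01 yC).
have Zrec i := gavg_rec i g01 yC'.
have Ypred : gavg g y (j - 1) = g * (r (j - 1) * (V k - V (W j))) + b * gavg g y j.
  by rewrite (Yrec (j - 1)) /y subrK.
have Zpred : gavg g (fun i => r i * `|V k - V (W (i + 1))|) (j - 1) =
  g * (r (j - 1) * `|V k - V (W j)|) +
  b * gavg g (fun i => r i * `|V k - V (W (i + 1))|) j.
  by rewrite (Zrec (j - 1)) subrK.
have -> : W' j - k = ((1 - lambda * V k) * (W j - k) -
    lambda * g * (r (j - 1) * (V k - V (W j)))) +
    lambda * V k * (W (j - 1) - k) + lambda * g * gavg g y j.
  rewrite W'_conservative !GE Ypred /b; ring.
have lg : 0 <= lambda * g by rewrite mulr_ge0//; lra.
have lVk := cfl_vM Vk.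
have lV1 : 0 <= lambda * lV by rewrite mulr_ge0// ltW.
have rj := r01 (j - 1).
have w := W01 j.
have s := @absorb_same_sign _ (W j - k) (r (j - 1) * (V k - V (W j))) (lambda * V k)
   (lambda * g) lV lg.
rewrite (le_trans (ler_normD _ _))// (le_trans (lerD (ler_normD _ _) (lexx _)))//.
have {}s : `|(1 - lambda * V k) * (W j - k) -
    lambda * g * (r (j - 1) * (V k - V (W j)))| <=
   (1 - lambda * V k) * `|W j - k| - lambda * g * `|r (j - 1) * (V k - V (W j))|.
  apply: s.
  - rewrite mulrCA; apply: mulr_ge0; first by lra.
    rewrite -mulrNN !opprB; exact: velocity_antitone.
  - rewrite normrM distrC -[leRHS]mul1r; apply: ler_pM => //.
    exact: (velocity_lip hV w k01).
  - have : lambda * lV * g <= lambda * lV * 1 by rewrite ler_wpM2l//; lra.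
    lra.
have rn : `|r (j - 1) * (V k - V (W j))| = r (j - 1) * `|V k - V (W j)|.
  by rewrite normrM ger0_norm//; lra.
rewrite rn in s.
rewrite !normrM (gtr0_norm l0) (ger0_norm (_ : 0 <= V k)); last by lra.
rewrite (ger0_norm (_ : 0 <= g)); last by lra.
have Z : `|gavg g y j| <= gavg g (fun i => r i * `|V k - V (W (i + 1))|) j.
  apply: (@normr_gavg_le _ g vM) => // i.
  by rewrite /y normrM ger0_norm//; have := r01 i; lra.
have Zl := ler_wpM2l lg Z.
rewrite /kphi Zpred /b; lra.
Qed.

(** The consistency error [e] satisfies the recursion of an average with a source at most [lV] times
    the gap. In that recursion the source is [g] times the averaged sequence, whence the factor
    [lV / g]. *)
Lemma kphi_consistent k j : 0 <= k <= 1 ->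
  `|kphi k j - kflux V (W j) k| <= gavg g (fun i => lV / g * `|D i|) j.
Proof.
move=> k01; have g01' := g01; have [vM0 lV0 hb _] := hV.
have Vk := hb _ k01.
have yl i : `|V k - V (W i)| <= vM by have := VW i; rewrite ler_norml; lra.
pose z i := r i * `|V k - V (W (i + 1))|.
have zC i : `|z i| <= vM.
  by rewrite normrM normr_id -[leRHS]mul1r; apply: ler_pM.
have DC i : `|lV / g * `|D i| | <= lV / g.
  rewrite normrM normr_id ger0_norm; last by rewrite divr_ge0//; lra.
  rewrite -[leRHS]mulr1 ler_wpM2l//; first by rewrite divr_ge0//; lra.
  by have := W01 i; have := W01 (i + 1); rewrite /D ler_norml; lra.
pose e i := W i * `|V k - V (W i)| - gavg g z i.
have eC i : `|e i| <= 1 * vM + vM.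
  rewrite (le_trans (ler_normB _ _))// lerD ?gavg_bound// normrM normr_id ler_pM//.
  by rewrite ger0_norm; have := W01 i; lra.
have -> : kphi k j - kflux V (W j) k = e j.
  rewrite /kphi /kflux /e /z (distrC (V (W j))); ring.
apply: (@le_gavg _ g (1 * vM + vM) (lV / g) (fun i => `|e i|)) => // i.
  by rewrite normr_id.
have -> : e i = W i * (`|V k - V (W i)| - `|V k - V (W (i + 1))|) + b * e (i + 1).
  rewrite /e (gavg_rec i g01 zC) /z /b.
  have -> : W i * (`|V k - V (W i)| - `|V k - V (W (i + 1))|) =
    W i * `|V k - V (W i)| - (g * r i + b * W (i + 1)) * `|V k - V (W (i + 1))|.
    by rewrite mulrBr -Wrec.
  rewrite /b; ring.
rewrite (le_trans (ler_normD _ _))// [X in _ + X <= _]normrM lerD//; last first.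
  by rewrite ger0_norm /b//; lra.
have -> : g * (lV / g * `|D i|) = lV * `|D i|.
  by rewrite mulrA mulrCA divff ?mulr1// gt_eqF//; lra.
rewrite normrM -[leRHS]mul1r; apply: ler_pM => //.
  by rewrite ger0_norm; have := W01 i; lra.
rewrite (le_trans (ler_dist_dist _ _))//.
rewrite (_ : V k - V (W i) - (V k - V (W (i + 1))) = V (W (i + 1)) - V (W i)); last by ring.
exact: (velocity_lip hV (W01 _) (W01 _)).
Qed.

Lemma avg_gap j : g * `|r j - W j| = b * `|D j|.
Proof.
have g01' := g01.
rewrite -[X in X * _ = _](ger0_norm (_ : 0 <= g)); last by lra.
rewrite -[X in _ = X * _](ger0_norm (_ : 0 <= b)); last by rewrite /b; lra.
rewrite -!normrM; have -> : g * (r j - W j) = - (b * D j).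
  by rewrite mulrBr /D {1 2}[W j]Wrec /b; have := Wrec j; rewrite /b; lra.
by rewrite normrN.
Qed.

End SchemeStep.

(* The numerical entropy flux [Phi] need not be local: the one of [W] involves all the
   values to the right. Only the summability of its consistency error [E] matters. *)
Definition discrete_entropy {R : realType} (V : R -> R) (lambda : R)
    (W : nat -> int -> R) (T S : R) : Prop :=
  exists (Phi : nat -> R -> int -> R) (E : nat -> int -> R),
  [/\ forall n j, 0 <= W n j <= 1,
      forall n, wsum_le (fun j => `|W n (j + 1) - W n j|) T,
      forall n, wsum_le (fun j => `|W n.+1 j - W n j|) T,
      forall n, wsum_le (E n) S &
      forall n k j, 0 <= k <= 1 ->
        `|W n.+1 j - k| <= `|W n j - k| + lambda * (Phi n k (j - 1) - Phi n k j) /\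
        `|Phi n k j - kflux V (W n j) k| <= E n j].

(** * Iteration of the nonlocal scheme *)

Section SchemeSteps.
Context {R : realType}.
Variables (V : R -> R) (vM lV lambda g T : R).
Hypotheses (hV : velocity V vM lV) (l0 : 0 < lambda)
  (cfl : lambda * (vM + lV) <= 1) (g01 : 0 < g <= 1).
Variable r0 : int -> R.
Hypothesis r01 : forall j, 0 <= r0 j <= 1.
Hypothesis r0T : wsum_le (fun j => `|r0 (j + 1) - r0 j|) T.
Let r := scheme_rho V lambda (geometric_weights g) r0.
Let W := scheme_W V lambda (geometric_weights g) r0.

Lemma scheme_rho_itv n j : 0 <= r n j <= 1.
Proof.
elim: n j => [|n IH] j; first exact: r01.
exact: (scheme_step_itv hV l0 cfl g01 IH).
Qed.

Lemma scheme_W_itv n j : 0 <= W n j <= 1.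
Proof. exact: (W01 g01 (scheme_rho_itv n)). Qed.

Lemma scheme_W_gap n : wsum_le (fun j => `|W n (j + 1) - W n j|) T.
Proof.
elim: n => [|n IH]; last first.
  exact: (gap_step_wsum hV l0 cfl g01 (scheme_rho_itv n) IH).
have rC i : `|r0 i| <= 1 by have := r01 i; rewrite ler_norml; lra.
have dC i : `|r0 (i + 1) - r0 i| <= T by apply: wsum_le_term r0T i.
apply: (@wsum_le_le _ (gavg g (fun j => `|r0 (j + 1) - r0 j|))); last first.
  by apply: wsum_gavg.
have WC i : `|W 0%N i| <= 1 by have := scheme_W_itv 0 i; rewrite ler_norml; lra.
have Wrec0 i : W 0%N i = g * r0 i + (1 - g) * W 0%N (i + 1).
  exact: (gavg_rec i g01 rC).
apply: (@le_gavg _ g (1 + 1) T) => // i; rewrite ?normr_id//.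
  by rewrite (le_trans (ler_normB _ _))// lerD.
rewrite (_ : W 0%N (i + 1) - W 0%N i = g * (r0 (i + 1) - r0 i) +
   (1 - g) * (W 0%N (i + 1 + 1) - W 0%N (i + 1))); last first.
  by rewrite {1}(Wrec0 (i + 1)) {1}(Wrec0 i); ring.
by rewrite (le_trans (ler_normD _ _))// lerD// normrM ger0_norm//; have := g01; lra.
Qed.

Lemma scheme_rho_W n j : `|r n j - W n j| <= (1 - g) / g * `|W n (j + 1) - W n j|.
Proof.
have g0 : 0 < g by have := g01; lra.
rewrite mulrAC ler_pdivlMr// mulrC.
by rewrite (avg_gap g01 (scheme_rho_itv n) j).
Qed.

Lemma scheme_W_entropy : discrete_entropy V lambda W T (lV / g * T).
Proof.
have g0 : 0 < g by have := g01; lra.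
have [vM0 lV0 _ _] := hV.
have lVg : 0 <= lV / g by rewrite divr_ge0// ltW.
exists (fun n k j => kphi V g (r n) k j),
  (fun n => gavg g (fun i => lV / g * `|W n (i + 1) - W n i|)); split.
- exact: scheme_W_itv.
- exact: scheme_W_gap.
- move=> n.
  exact: (time_step_wsum hV l0 cfl g01 (scheme_rho_itv n) (scheme_W_gap n)).
- move=> n; apply: wsum_gavg => //; last exact: wsum_leM (scheme_W_gap n).
  by move=> j; rewrite mulr_ge0.
- move=> n k j k01; split.
    exact: (entropy_step hV l0 cfl g01 (scheme_rho_itv n)).
  exact: (kphi_consistent hV g01 (scheme_rho_itv n)).
Qed.

End SchemeSteps.

(** * The velocity from its almost everywhere derivative *)

Section LipschitzDerivative.
Context {R : realType}.
Notation mu := (@lebesgue_measure R).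
Implicit Types (f F : R -> R).

(** Continuous induction: the supremum of the points with [F x <= F a] belongs to this set by the
    Lipschitz bound, and were it below [b], local decrease would carry the set past it. *)
Lemma le_from_local_decrease F (a b C : R) : a <= b ->
  (forall x y, a <= x <= b -> a <= y <= b -> `|F x - F y| <= C * `|x - y|) ->
  (forall s, a <= s < b -> exists2 y, s < y <= b & F y <= F s) ->
  F b <= F a.
Proof.
move=> ab lip loc; pose A := [set x | a <= x <= b /\ F x <= F a].
have Aa : A a by split; rewrite ?lexx.
have hA : has_sup A by split; [exists a|exists b => x [/andP[]]].
set s := sup A.
have as_ : a <= s by apply: ub_le_sup Aa; case: hA.
have sb : s <= b by apply: ge_sup; [exists a|move=> x [/andP[]]].
have Fs : F s <= F a.
  apply/ler_addgt0Pr => e e0.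
  have C0 : 0 < `|C| + 1 by rewrite ltr_wpDl.
  have [x [xab Fx] xs] := sup_adherent (divr_gt0 e0 C0) hA.
  have xles : x <= s by apply: ub_le_sup; [case: hA|split].
  have := lip s x; rewrite as_ sb => /(_ isT xab) h.
  have h2 : C * `|s - x| <= e.
    rewrite ger0_norm ?subr_ge0//.
    apply: (@le_trans _ _ ((`|C| + 1) * (s - x))).
      by rewrite ler_wpM2r ?subr_ge0// ler_wpDr// ler_norm.
    by rewrite mulrC -ler_pdivlMr//; move: xs; rewrite -/s; lra.
  have := ler_norm (F s - F x); lra.
have [sltb|] := ltP s b; last first.
  by move=> bs; have -> : b = s by apply/le_anti; rewrite sb bs.
have [|y /andP[sy yb] Fy] := loc s; first by rewrite as_.
suff : y <= s by rewrite leNgt sy.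
by apply: ub_le_sup; [case: hA|split; [rewrite yb andbT; lra|lra]].
Qed.

Lemma derive1_le_slope f x M e : derivable f x 1 -> derive1 f x <= M -> 0 < e ->
  exists2 d, 0 < d & forall h, 0 < h < d -> f (x + h) - f x <= (M + e) * h.
Proof.
move=> df dM e0.
have cf : (fun h => h^-1 *: (f (h + x) - f x)) @ 0^' --> derive1 f x.
  have : cvg ((fun h => h^-1 *: (f (h + x) - f x)) @ 0^').
    move: df; rewrite /derivable.
    by under eq_fun => h do rewrite [h *: 1]mulr1.
  by [].
move/cvgrPdist_lt : cf => /(_ _ e0) [d /= d0 hd].
exists d => // h /andP[h0 hdlt].
have := hd h; rewrite /ball/= sub0r normrN gtr0_norm// => /(_ hdlt).
move=> /(_ (lt0r_neq0 h0)); rewrite /GRing.scale/= => hlt.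
have : h^-1 * (f (h + x) - f x) < M + e.
  by have := ler_norm (h^-1 * (f (h + x) - f x) - derive1 f x); rewrite distrC in hlt; lra.
by rewrite ltr_pdivrMl// => /ltW; rewrite (addrC x h) (mulrC _ h).
Qed.

(** The exceptional null set is enclosed in an open set [U] of measure below [d]. Subtracting [C2]
    times the measure of [U] up to [x] forces decrease on [U], where only the Lipschitz bound is
    known, at a total cost of [C2 * d]; off [U] the bound on the derivative gives the decrease. *)
Lemma le_of_ae_derive1_le f (a b C M : R) : a <= b ->
  (forall x y, a <= x <= b -> a <= y <= b -> `|f x - f y| <= C * `|x - y|) ->
  {ae mu, forall x, x \in `]a, b[ -> derivable f x 1 /\ derive1 f x <= M} ->
  f b - f a <= M * (b - a).
Proof.
move=> ab lip [A [mA A0 NA]].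
(* The left end joins the null set because the derivative is controlled only in the open
   interval. *)
pose N := A `|` [set a].
have mN : measurable N by exact: measurableU.
have N0 : mu N = 0%E.
  rewrite measureU0//; exact: lebesgue_measure_set1.
apply/ler_addgt0Pr => e e0.
pose C2 := `|C| + `|M|; have C20 : 0 <= C2 by rewrite addr_ge0.
have k0 : 0 < (b - a) + C2 + 1 by rewrite ltr_wpDl// addr_ge0// subr_ge0.
(* The total loss will be [(b - a) * d + C2 * d], at most [e]. *)
set d := e / ((b - a) + C2 + 1); have d0 : 0 < d by rewrite divr_gt0.
have [|U [oU NU muU]] := @lebesgue_regularity_outer R N d mN _ d0.
  by apply: (@le_lt_trans _ _ 0%E); [rewrite le_eqVlt; apply/orP; left; apply/eqP; exact: N0|exact: ltry].
have muUd : (mu U < d%:E)%E.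
  have {1}-> : U = (U `\` N) `|` N by rewrite setUC setDUK.
  rewrite measureU0//; apply: measurableD => //; exact: open_measurable.
have mU : measurable U by exact: open_measurable.
pose psi x := fine (mu (U `&` `[a, x])).
have fin x : mu (U `&` `[a, x]) \is a fin_num.
  rewrite ge0_fin_numE//; apply: (@le_lt_trans _ _ (mu U)); last exact: lt_trans muUd (ltry _).
  by apply: le_measure; rewrite ?inE//; (exact: measurableI || exact: subIsetl).
have psiD x y : a <= x -> x <= y -> psi y = psi x + fine (mu (U `&` `]x, y])).
  move=> ax xy; rewrite /psi.
  have -> : U `&` `[a, y] = (U `&` `[a, x]) `|` (U `&` `]x, y]).
    by rewrite -setIUr -(@itv_bndbnd_setU _ _ (BLeft a) (BRight x) (BRight y)).
  have finxy : mu (U `&` `]x, y]) \is a fin_num.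
    rewrite ge0_fin_numE//; apply: (@le_lt_trans _ _ (mu U)); last exact: lt_trans muUd (ltry _).
    by apply: le_measure; rewrite ?inE//; (exact: measurableI || exact: subIsetl).
  rewrite measureU//; [|exact: measurableI|exact: measurableI|].
    exact: fineD (fin x) finxy.
  rewrite -setIIr (_ : `[a, x]%classic `&` `]x, y]%classic = set0) ?setI0//.
  apply/seteqP; split => // z [/=]; rewrite !in_itv/= => /andP[_ zx] /andP[xz _].
  by move: (lt_le_trans xz zx); rewrite ltxx.
have psiI x y : a <= x -> x <= y -> 0 <= psi y - psi x <= y - x.
  move=> ax xy; rewrite (psiD _ _ ax xy) [psi x + _]addrC addrK fine_ge0//=.
  have mxy : mu `]x, y] = (y - x)%:E.
    rewrite lebesgue_measure_itv/= lte_fin; case: ltP => // yx.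
    by rewrite (_ : y = x) ?subrr//; apply/le_anti; rewrite yx xy.
  have le2 : (mu (U `&` `]x, y]) <= (y - x)%:E)%E.
    rewrite -mxy; apply: le_measure; rewrite ?inE//; (exact: measurableI || exact: subIsetr).
  by rewrite -lee_fin fineK// ge0_fin_numE// (le_lt_trans le2) ?ltry.
pose F x := f x - (M + d) * x - C2 * psi x.
have : F b <= F a.
  apply: (@le_from_local_decrease F a b (C + `|M + d| + C2)) => //.
    have C0 x y : a <= x -> a <= y -> `|psi x - psi y| <= `|x - y|.
      move=> ax ay; have [xy|yx] := leP x y.
        by have h := psiI _ _ ax xy; rewrite !ler0_norm; lra.
      by have h := psiI _ _ ay (ltW yx); rewrite !ger0_norm; lra.
    move=> x y xab yab.
    have -> : F x - F y = (f x - f y) - (M + d) * (x - y) - C2 * (psi x - psi y).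
      by rewrite /F; ring.
    rewrite (le_trans (ler_normB _ _))// [leRHS]mulrDl lerD//; last first.
      by rewrite normrM (ger0_norm C20) ler_wpM2l// C0//; [case/andP: xab|case/andP: yab].
    by rewrite (le_trans (ler_normB _ _))// [leRHS]mulrDl lerD ?lip// normrM.
  move=> s /andP[as_ sb].
  have [sU|sU] := pselect (U s).
    move: (oU) => /(_ s sU) [r /= r0 rU].
    pose y := Num.min b (s + r / 2).
    have sy : s < y by rewrite lt_min sb/=; lra.
    have yb : y <= b by rewrite ge_min lexx.
    have yr : y <= s + r / 2 by rewrite ge_min lexx orbT.
    exists y; first by rewrite sy.
    have psy : psi y = psi s + (y - s).
      rewrite (psiD s y)//; last exact: ltW.
      rewrite (_ : U `&` `]s, y] = `]s, y]%classic).
        by rewrite lebesgue_measure_itv/= lte_fin sy.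
      apply/setIidPr => z /=; rewrite in_itv/= => /andP[sz zy].
      by apply: rU; rewrite /ball/= ltr0_norm; lra.
    have := lip y s; rewrite yb (le_trans as_ (ltW sy)) as_ (ltW sb).
    move=> /(_ isT isT); rewrite (gtr0_norm (_ : 0 < y - s)) ?subr_gt0// => h.
    have h1 := le_trans (ler_norm _) h.
    have ys : 0 <= y - s by lra.
    have h2 : C * (y - s) <= `|C| * (y - s) by rewrite ler_wpM2r ?ler_norm.
    have h3 : - M * (y - s) <= `|M| * (y - s).
      by rewrite ler_wpM2r// -normrN ler_norm.
    have h4 : 0 <= d * (y - s) by rewrite mulr_ge0// ltW.
    rewrite /F psy /C2; lra.
  have as' : a < s.
    rewrite lt_neqAle as_ andbT; apply/eqP => sa; apply: sU; apply: NU.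
    by right; rewrite /= sa.
  have [ds dM] : derivable f s 1 /\ derive1 f s <= M.
    apply: contrapT => h; apply: sU; apply: NU; left; apply: NA => /= h'.
    by apply: h; apply: h'; rewrite in_itv/= as' sb.
  have [r r0 hr] := derive1_le_slope ds dM d0.
  pose y := Num.min b (s + r / 2).
  have sy : s < y by rewrite lt_min sb/=; lra.
  have yb : y <= b by rewrite ge_min lexx.
  have yr : y <= s + r / 2 by rewrite ge_min lexx orbT.
  exists y; first by rewrite sy.
  have := hr (y - s); rewrite subrKC => /(_ ltac:(lra)) h1.
  have [h2 _] := andP (psiI s y as_ (ltW sy)).
  have h3 : 0 <= C2 * (psi y - psi s) by rewrite mulr_ge0.
  rewrite /F; lra.
have : C2 * (psi b - psi a) <= C2 * d.
  rewrite ler_wpM2l//; apply: (@le_trans _ _ (psi b)).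
    by rewrite gerBl fine_ge0.
  rewrite -lee_fin fineK//; apply: le_trans (ltW muUd).
  by apply: le_measure; rewrite ?inE//; (exact: measurableI || exact: subIsetl).
rewrite /F.
have : (b - a) * d + C2 * d <= e.
  rewrite -mulrDl /d mulrA ler_pdivrMr// mulrC ler_wpM2l ?(ltW e0)//; lra.
lra.
Qed.

End LipschitzDerivative.

Section VelocityOfDerivative.
Context {R : realType}.
Notation mu := (@lebesgue_measure R).

Lemma lebesgue_setT_gt0 : (0 < mu [set: R])%E.
Proof.
apply: (@lt_le_trans _ _ (mu `[0%R, 1%R])).
  by rewrite lebesgue_measure_itv/= lte_fin ltr01 oppr0 adde0 lte01.
by apply: le_measure; rewrite ?inE.
Qed.

Lemma aeS (P Q : R -> Prop) : (forall x, P x -> Q x) ->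
  {ae mu, forall x, P x} -> {ae mu, forall x, Q x}.
Proof.
move=> PQ [A [mA A0 NA]]; exists A; split => // x /= nQ; apply: NA => /= Px.
exact/nQ/PQ.
Qed.

Lemma aeI (P Q : R -> Prop) : {ae mu, forall x, P x} -> {ae mu, forall x, Q x} ->
  {ae mu, forall x, P x /\ Q x}.
Proof.
move=> [A [mA A0 NA]] [B [mB B0 NB]]; exists (A `|` B); split.
- exact: measurableU.
- by rewrite -A0; exact: measureU0.
- move=> x /= /not_andP[] h; [left|right].
    exact: NA.
  exact: NB.
Qed.

Lemma Linfty01_ae (f : R -> R) (M : R) : Linfty01 f = M%:E ->
  {ae mu, forall x, 0 <= x <= 1 -> `|f x| <= M}.
Proof.
rewrite /Linfty01 unlock /= lebesgue_setT_gt0 => h.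
have := ess_sup_ge mu (abse \o (EFin \o f \_ `[0, 1])); rewrite h.
apply: aeS => x /= + x01; rewrite lee_fin patchE ifT//.
by rewrite inE/= in_itv.
Qed.

Lemma ae_itv_exists (P : R -> Prop) (a b : R) : a < b -> {ae mu, forall x, P x} ->
  exists x, a <= x <= b /\ P x.
Proof.
move=> ab [A [mA A0 NA]]; apply: contrapT => h.
have : (mu `[a, b] <= mu A)%E.
  apply: le_measure; rewrite ?inE// => x /=; rewrite in_itv/= => xab.
  by apply: NA => /= Px; apply: h; exists x.
rewrite A0 lebesgue_measure_itv/= lte_fin ab lee_fin; lra.
Qed.

Lemma velocity_of_ae (V : R -> R) (normV normV' : R) :
  [lipschitz V x | x in `[0, 1]] ->
  (forall x, x \in `[0, 1] -> 0 <= V x) ->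
  {ae mu, forall x, x \in `]0, 1[ -> derivable V x 1 /\ derive1 V x <= 0} ->
  Linfty01 V = normV%:E -> Linfty01 (derive1 V) = normV'%:E ->
  velocity V normV normV'.
Proof.
move=> lipV V0 dV nV nV'.
have [C lip] : exists C, forall x y, 0 <= x <= 1 -> 0 <= y <= 1 ->
    `|V x - V y| <= C * `|x - y|.
  move: lipV => [C [_ /(_ (C + 1))]]; rewrite ltrDl ltr01 => /(_ isT) h.
  exists (C + 1) => x y x01 y01; apply: (h (x, y)); split; rewrite /= in_itv/=.
    exact: x01.
  exact: y01.
have le0 : 0 <= normV.
  have [x [x01 h]] := ae_itv_exists ltr01 (Linfty01_ae nV).
  exact: le_trans (h x01).
have le0' : 0 <= normV'.
  have [x [x01 h]] := ae_itv_exists ltr01 (Linfty01_ae nV').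
  exact: le_trans (h x01).
have lipW x y : 0 <= x -> x <= y -> y <= 1 -> 0 <= V x - V y <= normV' * (y - x).
  move=> x0 xy y1.
  have sub z : x <= z <= y -> 0 <= z <= 1 by lra.
  have subo z : z \in `]x, y[ -> z \in `]0, 1[ by rewrite !in_itv/=; lra.
  have h1 : V y - V x <= 0 * (y - x).
    apply: (@le_of_ae_derive1_le _ V x y C 0) => //.
      by move=> u w /sub u01 /sub w01; exact: lip.
    by apply: aeS dV => z h /subo; exact: h.
  have h2 : - V y - - V x <= normV' * (y - x).
    apply: (@le_of_ae_derive1_le _ (fun z => - V z) x y C normV') => //.
      move=> u w /sub u01 /sub w01; rewrite -opprD normrN; exact: lip.
    apply: aeS (aeI dV (Linfty01_ae nV')) => z [hd1 hd2] /subo z01.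
    have [dz dz0] := hd1 z01; split; first exact: derivableN.
    rewrite derive1E deriveN// -derive1E.
    have := hd2; move: z01; rewrite in_itv/= => /andP[z0 z1] /(_ ltac:(lra)).
    by rewrite ler_norml; lra.
  lra.
split => // x x01; apply/andP; split; first by apply: V0; rewrite in_itv.
(* The bound by [normV] is only known almost everywhere. Some [y] within [d] of 0 satisfies it, and
   [V x <= V 0 <= V y + normV' * y]. *)
apply/ler_addgt0Pr => e e0.
have [d d0 [hd1 hd2]] : exists2 d, 0 < d & normV' * d <= e /\ d <= 1.
  exists (Num.min 1 (e / (normV' + 1))).
    by rewrite lt_min ltr01 divr_gt0// ltr_wpDl.
  split; last by rewrite ge_min lexx.
  apply: (@le_trans _ _ (normV' * (e / (normV' + 1)))).
    by rewrite ler_wpM2l// ge_min lexx orbT.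
  by rewrite mulrA ler_pdivrMr ?ltr_wpDl// mulrC ler_wpM2l ?(ltW e0)// lerDl.
have [y [yd h]] := ae_itv_exists d0 (Linfty01_ae nV).
have y01 : 0 <= y <= 1 by lra.
have Vx0 : V x <= V 0 by have := lipW 0 x; lra.
have V0y : V 0 - V y <= normV' * y by have := lipW 0 y; rewrite subr0; lra.
have : normV' * y <= normV' * d by rewrite ler_wpM2l//; lra.
have := ler_norm (V y); have := h y01; lra.
Qed.

End VelocityOfDerivative.

(** * Integrals over the line and total variation *)

Section LineIntegral.
Context {R : realType}.
Notation mu := (@lebesgue_measure R).
Implicit Types (f g : R -> R) (s : R).

Lemma measurable_shift s : measurable_fun [set: R] (fun x : R => x + s).
Proof. exact: measurable_funD. Qed.

Lemma lebesgue_measure_shift s (A : set R) : measurable A ->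
  pushforward mu ((fun x => x + s) : _ -> measurableTypeR R) A = mu A.
Proof.
move=> mA; apply/esym/lebesgue_measure_unique => //=.
  exact: measurable_shift.
move=> ? _ [[a b]] _ <-; rewrite /pushforward/=.
have -> : (fun x => x + s) @^-1` `]a, b] = `]a - s, b - s]%classic.
  by apply/seteqP; split => x /=; rewrite !in_itv/= ltrBlDr lerBrDr.
rewrite !lebesgue_measure_itv/= !lte_fin ltrD2r; case: ifPn => // _.
by rewrite -!EFinD; congr EFin; ring.
Qed.

Lemma ge0_integral_shift s (f : R -> \bar R) : measurable_fun [set: R] f ->
  (forall x, 0 <= f x)%E -> (\int[mu]_x f (x + s)%R = \int[mu]_x f x)%E.
Proof.
move=> mf f0.
transitivity (\int[pushforward mu ((fun x => x + s)%R : _ -> measurableTypeR R)]_x f x)%E.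
  by rewrite ge0_integral_pushforward//=; exact: measurable_shift.
apply: eq_measure_integral => //=; first exact: measurable_shift.
move=> ? A mA _; exact: lebesgue_measure_shift.
Qed.

Lemma ge0_integral_exhaust (f : R -> \bar R) (C : \bar R) :
  measurable_fun [set: R] f -> (forall x, 0 <= f x)%E ->
  (forall n : nat, \int[mu]_(x in `[(- n%:R)%R, n%:R]) f x <= C)%E ->
  (\int[mu]_x f x <= C)%E.
Proof.
move=> mf f0 fC; pose F (n : nat) := `[- n%:R, n%:R : R]%classic.
have FT : \bigcup_n F n = setT.
  apply/seteqP; split => // x _; exists (Num.truncn `|x|).+1 => //=.
  by rewrite /F/= in_itv/= -ler_norml ltW// truncnS_gt.
have h : (\int[mu]_(x in F n) f x @[n --> \oo] --> \int[mu]_x f x)%E.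
  rewrite -FT; apply: ge0_nondecreasing_set_cvg_integral => //.
  - move=> n m nm; rewrite subsetEset => x; rewrite /F/= !in_itv/= => /andP[h1 h2].
    have : (n%:R : R) <= m%:R by rewrite ler_nat.
    by lra.
  - by move=> n; exact: measurable_itv.
  - by move=> n; exact: measurable_funTS.
rewrite -(cvg_lim _ h)//; apply: lime_le; first by apply/cvg_ex; eexists; exact: h.
by apply: nearW => n; exact: fC.
Qed.

Definition L1 f : Prop := mu.-integrable [set: R] (EFin \o f).

Lemma L1_measurable f : L1 f -> measurable_fun [set: R] f.
Proof. by move=> /measurable_int/measurable_EFinP. Qed.

Lemma L1D f g : L1 f -> L1 g -> L1 (fun x => f x + g x).
Proof. by move=> hf hg; have := integrableD measurableT hf hg. Qed.

Lemma L1B f g : L1 f -> L1 g -> L1 (fun x => f x - g x).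
Proof. by move=> hf hg; have := integrableB measurableT hf hg. Qed.

Lemma L1Z c f : L1 f -> L1 (fun x => c * f x).
Proof. by move=> hf; have := integrableZl measurableT c hf. Qed.

Lemma L1_abs f : L1 f -> L1 (fun x => `|f x|).
Proof. by move=> hf; have := integrable_abse hf. Qed.

Lemma L1_le f g : measurable_fun [set: R] f -> (forall x, `|f x| <= g x) ->
  L1 g -> L1 f.
Proof.
move=> mf fg; apply: le_integrable => //; first exact/measurable_EFinP.
by move=> x _; rewrite /= lee_fin (le_trans (fg x))// ler_norm.
Qed.

Lemma L1_0 : L1 (fun=> 0).
Proof. exact: integrable0. Qed.

Lemma L1_sum n (F : nat -> R -> R) : (forall i, L1 (F i)) ->
  L1 (fun x => \sum_(i < n) F i x).
Proof.
move=> hF; elim: n => [|n IH].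
  by under eq_fun do rewrite big_ord0; exact: L1_0.
by under eq_fun do rewrite big_ord_recr/=; exact: L1D.
Qed.

Lemma L1_ge0 f (C : \bar R) : measurable_fun [set: R] f -> (forall x, 0 <= f x) ->
  (\int[mu]_x (f x)%:E <= C)%E -> (C < +oo)%E -> L1 f.
Proof.
move=> mf f0 fC Coo; apply/integrableP; split; first exact/measurable_EFinP.
apply: le_lt_trans Coo; apply: le_trans fC.
by under eq_integral => x _ do rewrite /= ger0_norm//.
Qed.

Notation J f := (\int[mu]_x f x).

Lemma J_E f : L1 f -> (\int[mu]_x (f x)%:E = (J (fun x => f x))%:E)%E.
Proof. by move=> hf; rewrite /Rintegral fineK//; exact: integrable_fin_num. Qed.

Lemma J_D f g : L1 f -> L1 g -> J (fun x => f x + g x) = J f + J g.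
Proof. by move=> hf hg; exact: RintegralD. Qed.

Lemma J_B f g : L1 f -> L1 g -> J (fun x => f x - g x) = J f - J g.
Proof. by move=> hf hg; exact: RintegralB. Qed.

Lemma J_Z c f : L1 f -> J (fun x => c * f x) = c * J f.
Proof. by move=> hf; exact: RintegralZl. Qed.

Lemma J_sum n (F : nat -> R -> R) : (forall i, L1 (F i)) ->
  J (fun x => \sum_(i < n) F i x) = \sum_(i < n) J (F i).
Proof.
move=> hF; elim: n => [|n IH].
  by under eq_Rintegral do rewrite big_ord0; rewrite big_ord0 Rintegral_cst// mul0r.
under eq_Rintegral do rewrite big_ord_recr/=.
by rewrite J_D ?IH ?big_ord_recr//; exact: L1_sum.
Qed.

Lemma J_le f g : L1 f -> L1 g -> (forall x, f x <= g x) -> J f <= J g.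
Proof. by move=> hf hg fg; apply: le_Rintegral. Qed.

Lemma J_ge0 f : (forall x, 0 <= f x) -> 0 <= J f.
Proof. by move=> f0; apply: Rintegral_ge0. Qed.

Lemma J_abs f : L1 f -> `|J f| <= J (fun x => `|f x|).
Proof. by move=> hf; apply: le_normr_Rintegral. Qed.

Lemma J_ge0_le f C : measurable_fun [set: R] f -> (forall x, 0 <= f x) ->
  (\int[mu]_x (f x)%:E <= C%:E)%E -> L1 f /\ J f <= C.
Proof.
move=> mf f0 fC; have hf : L1 f by apply: (L1_ge0 mf f0 fC); exact: ltry.
by split => //; rewrite -lee_fin -J_E.
Qed.

Lemma L1_shift s f : L1 f -> L1 (fun x => f (x + s)).
Proof.
move=> hf; have mf := L1_measurable hf.
have mfs : measurable_fun [set: R] (fun x => f (x + s)).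
  by apply: measurableT_comp => //; exact: measurable_shift.
apply/integrableP; split; first exact/measurable_EFinP.
move/integrableP : hf => [_]; apply: le_lt_trans.
rewrite (ge0_integral_shift s (f := fun x => `|(f x)%:E|%E))//.
by apply: measurableT_comp => //; exact/measurable_EFinP.
Qed.

Lemma J_shift s f : L1 f -> J (fun x => f (x + s)) = J f.
Proof.
move=> hf; have mf := L1_measurable hf; have hfs := L1_shift s hf.
pose p x := Num.max (f x) 0; pose m x := Num.max (- f x) 0.
have mp : measurable_fun [set: R] p by apply: measurable_maxr.
have mm : measurable_fun [set: R] m by apply: measurable_maxr => //; exact: measurable_funN.
have hp : L1 p.
  apply: L1_le (L1_abs hf) => // x; rewrite /p ger0_norm ?le_max ?lexx ?orbT//.
  by rewrite ge_max ler_norm normr_ge0.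
have hm : L1 m.
  apply: L1_le (L1_abs hf) => // x; rewrite /m ger0_norm ?le_max ?lexx ?orbT//.
  by rewrite ge_max -normrN ler_norm normr_ge0.
have pm x : f x = p x - m x.
  rewrite /p /m; have [h|h] := leP (f x) 0.
    by rewrite max_l ?oppr_ge0// sub0r opprK.
  by rewrite max_r ?subr0// oppr_le0 ltW.
have e g : measurable_fun [set: R] g -> (forall x, 0 <= g x) ->
    J (fun x => g (x + s)) = J g.
  move=> mg g0; congr fine.
  by apply: (ge0_integral_shift s (f := fun x => (g x)%:E)) => //; exact/measurable_EFinP.
transitivity (J (fun x => p (x + s) - m (x + s))).
  by apply: eq_Rintegral => x _; rewrite pm.
rewrite J_B; [|exact: L1_shift|exact: L1_shift].
rewrite (e p)//; last by move=> x; rewrite /p le_max lexx orbT.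
rewrite (e m)//; last by move=> x; rewrite /m le_max lexx orbT.
by rewrite -J_B//; apply: eq_Rintegral => x _; rewrite pm.
Qed.

End LineIntegral.

(** * Total variation and translations *)

Section Variation.
Context {R : realType}.
Notation mu := (@lebesgue_measure R).
Implicit Types (g m : R -> R).

Lemma lebesgue_itv (a b : R) (b0 b1 : bool) : a <= b ->
  mu [set` Interval (BSide b0 a) (BSide b1 b)] = (b - a)%:E.
Proof.
move=> ab; rewrite lebesgue_measure_itv/= lte_fin; case: ltP => // ba.
by rewrite (_ : b = a) ?subrr//; apply/le_anti; rewrite ba ab.
Qed.

Lemma integral_cst_itv (c a b : R) (b0 b1 : bool) : a <= b ->
  (\int[mu]_(x in [set` Interval (BSide b0 a) (BSide b1 b)]) c%:E = (c * (b - a))%:E)%E.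
Proof.
move=> ab; rewrite integral_cst; last exact: measurable_itv.
rewrite EFinM -(@lebesgue_itv a b b0 b1 ab) //.
Qed.

Lemma pointwise_TV_ge0 g : (0 <= pointwise_TV g)%E.
Proof.
apply: (@le_trans _ _ (total_variation 0 0 g)); first by rewrite total_variationxx.
by apply: ereal_sup_ubound; exists (0, 0) => /=.
Qed.

Lemma TV_ge0 g : (0 <= TV g)%E.
Proof. by apply: le_ereal_inf_tmp => _ [h _ <-]; exact: pointwise_TV_ge0. Qed.

(** [m x] is the variation of [g] on the half-line to the left of [x]. It converts oscillations of
    [g] into increments of a bounded monotone function, whose translates are easy to integrate. *)
Lemma variation_function g (T : R) : (pointwise_TV g <= T%:E)%E ->
  exists m, [/\ {homo m : x y / x <= y}, forall x, 0 <= m x <= T &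
    forall x y, x <= y -> `|g y - g x| <= m y - m x].
Proof.
move=> gT; pose M x := ereal_sup [set total_variation a x g | a in [set a | a <= x]].
have M0 x : (0 <= M x)%E.
  apply: (@le_trans _ _ (total_variation x x g)); first by rewrite total_variationxx.
  by apply: ereal_sup_ubound; exists x => /=.
have MT x : (M x <= T%:E)%E.
  apply: le_trans gT; apply: ge_ereal_sup => _ [a /= ax <-].
  by apply: ereal_sup_ubound; exists (a, x).
have Mfin x : M x \is a fin_num.
  by rewrite ge0_fin_numE// (le_lt_trans (MT x))// ltry.
have Mstep x y : x <= y -> (M x + `|g y - g x|%:E <= M y)%E.
  move=> xy; rewrite -leeBrDr//; apply: ge_ereal_sup => _ [a /= ax <-].
  rewrite EFinN leeBrDr//; apply: (@le_trans _ _ (total_variation a y g)).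
    rewrite (@total_variationD _ a y x)// leeD2l//; exact: total_variation_ge.
  by apply: ereal_sup_ubound; exists a => //=; exact: le_trans xy.
have key x y : x <= y -> `|g y - g x| <= fine (M y) - fine (M x).
  move=> xy; rewrite lerBrDl -lee_fin EFinD !fineK//; exact: Mstep.
exists (fine \o M); split => //=.
- by move=> x y /key h; rewrite -subr_ge0; apply: le_trans h.
- by move=> x; rewrite fine_ge0//= -lee_fin fineK.
Qed.

Definition ae_variation (f : R -> R) (T : R) m : Prop :=
  [/\ {homo m : x y / x <= y}, forall x, 0 <= m x <= T &
    exists g, {ae mu, forall x, f x = g x} /\
      forall x y, x <= y -> `|g y - g x| <= m y - m x].

Lemma TV_ae_variation (f : R -> R) e : (TV f < +oo)%E -> 0 < e ->
  exists m, ae_variation f (fine (TV f) + e) m.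
Proof.
move=> fT e0; have Tfin : TV f \is a fin_num by rewrite ge0_fin_numE// TV_ge0.
have : (TV f < (fine (TV f) + e)%:E)%E.
  by rewrite EFinD fineK// lteDl// lte_fin.
move=> /ereal_inf_lt[_ [g fg <-]] /ltW gT.
have [m [mh mT gm]] := variation_function gT.
by exists m; split => //; exists g.
Qed.

(** On [[-n, n]] the integrals of [m] and of its translate cancel on the overlap; what remains is at
    most the integral of [m] over a strip of length [s] at the right end. *)
Lemma monotone_shift_le (m : R -> R) (T s : R) : {homo m : x y / x <= y} ->
  (forall x, 0 <= m x <= T) -> 0 <= s ->
  (\int[mu]_x (m (x + s) - m x)%:E <= (s * T)%:E)%E.
Proof.
move=> mh mT s0.
have mm : measurable_fun [set: R] m by apply: nondecreasing_measurable.
have mms : measurable_fun [set: R] (fun x => m (x + s)).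
  by apply: measurableT_comp => //; exact: measurable_shift.
apply: ge0_integral_exhaust.
- by apply/measurable_EFinP; exact: measurable_funB.
- by move=> x; rewrite lee_fin subr_ge0 mh// lerDl.
move=> n; set I := `[(- n%:R)%R, n%:R]%classic.
have mI : measurable I by exact: measurable_itv.
have fin : (\int[mu]_(x in I) (m x)%:E < +oo)%E.
  apply: (@le_lt_trans _ _ (\int[mu]_(x in I) T%:E)%E).
    apply: ge0_le_integral => //.
    - by move=> x _; rewrite lee_fin; case/andP: (mT x).
    - by apply/measurable_EFinP; exact: measurable_funTS.
    - by move=> x _; rewrite lee_fin; case/andP: (mT x).
  by rewrite /I integral_cst_itv ?ltry//; have := ler0n R n; lra.
have I0 : (0 <= \int[mu]_(x in I) (m x)%:E)%E.
  by apply: integral_ge0 => x _; rewrite lee_fin; case/andP: (mT x).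
rewrite -(leeD2rE (x := \int[mu]_(x in I) (m x)%:E)%E); last by rewrite ge0_fin_numE.
rewrite -ge0_integralD//=; last 4 first.
- by move=> x _; rewrite lee_fin subr_ge0 mh// lerDl.
- by apply/measurable_EFinP; apply: measurable_funTS; exact: measurable_funB.
- by move=> x _; rewrite lee_fin; case/andP: (mT x).
- by apply/measurable_EFinP; exact: measurable_funTS.
under eq_integral do rewrite -EFinD subrK.
have -> : (\int[mu]_(x in I) (m (x + s))%:E =
  \int[mu]_(x in `[(- n%:R + s)%R, (n%:R + s)%R]) (m x)%:E)%E.
  rewrite integral_mkcond [RHS]integral_mkcond.
  rewrite -[RHS](ge0_integral_shift s); last 2 first.
  - apply/(measurable_restrictT _ _).1; first exact: measurable_itv.
    by apply/measurable_EFinP; exact: measurable_funTS.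
  - by move=> x; rewrite patchE; case: ifP => // _; rewrite lee_fin; case/andP: (mT x).
  apply: eq_integral => x _; rewrite !patchE.
  congr (if _ then _ else _).
  by apply/idP/idP => /set_mem h; apply/mem_set; move: h; rewrite /I/= !in_itv/= !lerD2r.
apply: (@le_trans _ _ (\int[mu]_(x in I `|` `]n%:R, (n%:R + s)%R]) (m x)%:E)%E).
  apply: ge0_subset_integral => //=.
  - by apply: measurableU; exact: measurable_itv.
  - by apply/measurable_EFinP; exact: measurable_funTS.
  - by move=> x _; rewrite lee_fin; case/andP: (mT x).
  - move=> x /=; rewrite /I/= !in_itv/= => /andP[h1 h2].
    by have [xn|xn] := leP x n%:R; [left|right] => //; apply/andP; split => //; lra.
have mJ : measurable `]n%:R : R, (n%:R + s)%R] by exact: measurable_itv.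
rewrite ge0_integral_setU//=; last 3 first.
- by apply/measurable_EFinP; exact: measurable_funTS.
- by move=> x _; rewrite lee_fin; case/andP: (mT x).
- rewrite disj_set2E; apply/eqP/seteqP; split => // x [].
  by rewrite /I/= !in_itv/= => /andP[_ h1] /andP[h2 _]; lra.
rewrite addeC leeD2r//.
apply: (@le_trans _ _ (\int[mu]_(x in `]n%:R, (n%:R + s)%R]) T%:E)%E).
  apply: ge0_le_integral => //.
  - by move=> x _; rewrite lee_fin; case/andP: (mT x).
  - by apply/measurable_EFinP; exact: measurable_funTS.
  - by move=> x _; rewrite lee_fin; case/andP: (mT x).
by rewrite integral_cst_itv ?lerDl// lee_fin addrC addKr mulrC.
Qed.

Lemma aeT (P : R -> Prop) : (forall x, P x) -> {ae mu, forall x, P x}.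
Proof. by move=> hP; exists set0; split => // x /= []; exact: hP. Qed.

Lemma shift_null (A : set R) s : measurable A -> mu A = 0%E ->
  mu [set x | A (x + s)] = 0%E.
Proof. by move=> mA A0; rewrite -A0 -(lebesgue_measure_shift s mA). Qed.

Lemma measurable_shift_set (A : set R) s : measurable A ->
  measurable [set x | A (x + s)].
Proof. by move=> mA; rewrite -[X in measurable X]setTI; exact: measurable_shift. Qed.

Lemma ae_shift (P : R -> Prop) s : {ae mu, forall x, P x} ->
  {ae mu, forall x, P (x + s)}.
Proof.
move=> [A [mA A0 NA]]; exists [set x | A (x + s)]; split.
- exact: measurable_shift_set.
- exact: shift_null.
- by move=> x /= h; apply: NA.
Qed.

Lemma ae_ge0_integral_le (D : set R) (f g : R -> R) : measurable D ->
  measurable_fun [set: R] f ->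
  measurable_fun [set: R] g -> (forall x, 0 <= f x) -> (forall x, 0 <= g x) ->
  {ae mu, forall x, D x -> f x <= g x} ->
  (\int[mu]_(x in D) (f x)%:E <= \int[mu]_(x in D) (g x)%:E)%E.
Proof.
move=> mD mf mg f0 g0 fg.
apply: (@le_trans _ _ (\int[mu]_(x in D) (Num.min (f x) (g x))%:E)%E).
  rewrite le_eqVlt; apply/orP; left; apply/eqP.
  apply: ge0_ae_eq_integral => //.
  - by apply/measurable_EFinP; exact: measurable_funTS.
  - by apply/measurable_EFinP; apply: measurable_funTS; exact: measurable_minr.
  - by move=> x _; rewrite lee_fin.
  - by move=> x _; rewrite lee_fin le_min f0 g0.
  - by apply: aeS fg => x h Dx; rewrite min_l// h.
apply: ge0_le_integral => //.
- by move=> x _; rewrite lee_fin le_min f0 g0.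
- by apply/measurable_EFinP; apply: measurable_funTS; exact: measurable_minr.
- by apply/measurable_EFinP; exact: measurable_funTS.
- by move=> x _; rewrite lee_fin ge_min lexx orbT.
Qed.

Lemma translation_le (f : R -> R) s : measurable_fun [set: R] f -> (TV f < +oo)%E ->
  (\int[mu]_x `|f (x + s) - f x|%:E <= (`|s| * fine (TV f))%:E)%E.
Proof.
move=> mf fT.
have mfs t : measurable_fun [set: R] (fun x => f (x + t)).
  by apply: measurableT_comp => //; exact: measurable_shift.
have mabs t : measurable_fun [set: R] (fun x => `|f (x + t) - f x|).
  by apply: measurableT_comp => //; exact: measurable_funB.
wlog s0 : s / 0 <= s => [H|].
  have [/H//|s0] := leP 0 s.
  rewrite -(ge0_integral_shift (- s) (f := fun x => `|f (x + s) - f x|%:E)).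
  - under eq_integral do rewrite subrK distrC.
    by rewrite -normrN; apply: H; rewrite oppr_ge0 ltW.
  - exact/measurable_EFinP.
  - by move=> x; rewrite lee_fin.
apply/lee_addgt0Pr => e e0.
(* The infimum defining [TV] need not be attained; a slack [e / (s + 1)] in the variation costs at
   most [e] after multiplication by [s]. *)
have [m [mh mT [g [fg gm]]]] := TV_ae_variation fT (divr_gt0 e0 (ltr_wpDl s0 ltr01)).
rewrite (ger0_norm s0) -EFinD.
apply: (@le_trans _ _ (s * (fine (TV f) + e / (s + 1)))%:E); last first.
  rewrite lee_fin mulrDr lerD2l mulrA ler_pdivrMr ?ltr_wpDl// mulrC ler_wpM2l ?(ltW e0)//.
  by rewrite lerDl.
apply: le_trans (monotone_shift_le mh mT s0).
have mm : measurable_fun [set: R] m by apply: nondecreasing_measurable.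
apply: ae_ge0_integral_le => //.
- apply: measurable_funB => //.
  by apply: measurableT_comp => //; exact: measurable_shift.
- by move=> x; rewrite subr_ge0 mh// lerDl.
- apply: aeS (aeI fg (ae_shift s fg)) => x [-> ->] _.
  by apply: gm; rewrite lerDl.
Qed.

End Variation.

(** * Cell averages of the initial datum *)

Section CellAverage.
Context {R : realType}.
Notation mu := (@lebesgue_measure R).
Variables (f : R -> R).
Hypotheses (mf : measurable_fun [set: R] f) (f01 : forall x, 0 <= f x <= 1).

Lemma bounded_integrable_itv (u : R -> R) (C a b : R) (b0 b1 : bool) : a <= b ->
  measurable_fun [set: R] u -> (forall x, `|u x| <= C) ->
  mu.-integrable [set` Interval (BSide b0 a) (BSide b1 b)] (EFin \o u).
Proof.
move=> ab mu_ uC; apply: measurable_bounded_integrable.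
- exact: measurable_itv.
- apply: (@le_lt_trans _ _ (b - a)%:E); last exact: ltry.
  by rewrite -(lebesgue_itv b0 b1 ab).
- exact: measurable_funTS.
- exists C; split; first by rewrite num_real.
  by move=> y Cy x _ /=; rewrite (le_trans (uC x))// ltW.
Qed.

Lemma average_osc (g : R -> R) (a b o : R) (z : R) : a < b ->
  {ae mu, forall x, f x = g x} ->
  (forall x, a <= x <= b -> `|g x - z| <= o) ->
  `|(b - a)^-1 * (\int[mu]_(x in `[a, b]) f x) - z| <= o.
Proof.
move=> ab fg go; have ba : 0 < b - a by rewrite subr_gt0.
have int_ c : mu.-integrable `[a, b] (EFin \o (fun x => f x - c)).
  apply: (@bounded_integrable_itv _ (1 + `|c|)); first exact: ltW.
    exact: measurable_funB.
  move=> x; rewrite (le_trans (ler_normB _ _))// lerD2r ger0_norm.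
    by case/andP: (f01 x).
  by case/andP: (f01 x).
have -> : (b - a)^-1 * (\int[mu]_(x in `[a, b]) f x) - z =
    (b - a)^-1 * \int[mu]_(x in `[a, b]) (f x - z).
  rewrite (@RintegralB _ _ _ mu _ f (fun=> z)) //; last 2 first.
  - by have := int_ 0; under [X in _.-integrable _ X]eq_fun do rewrite /= subr0.
  - apply: (@bounded_integrable_itv _ `|z|) => //; exact: ltW.
  rewrite Rintegral_cst// mulrBr; congr (_ - _).
  rewrite (_ : fine _ = b - a); last first.
    exact: (f_equal fine (@lebesgue_itv _ a b true false (ltW ab))).
  by rewrite mulrCA mulVf ?mulr1// gt_eqF.
rewrite normrM gtr0_norm ?invr_gt0// ler_pdivrMl//.
apply: (le_trans (le_normr_Rintegral _ _)) => //.
rewrite -lee_fin.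
have -> : ((\int[mu]_(x in `[a, b]) `|f x - z|)%:E = \int[mu]_(x in `[a, b]) (`|f x - z|)%:E)%E.
  rewrite /Rintegral fineK//; apply: integrable_fin_num => //.
  exact: integrable_abse (int_ z).
rewrite mulrC -(integral_cst_itv o true false (ltW ab)).
have o0 : 0 <= o by apply: le_trans (go a _) => //; rewrite lexx ltW.
apply: ae_ge0_integral_le => //.
  by apply: measurableT_comp => //; exact: measurable_funB.
by apply: aeS fg => x -> /=; rewrite in_itv/=; exact: go.
Qed.

Lemma cell_endpoints (h : R) (j : int) : 0 < h ->
  (j%:~R - 2^-1) * h < (j%:~R + 2^-1) * h /\
  (j%:~R + 2^-1) * h - (j%:~R - 2^-1) * h = h.
Proof.
move=> h0; split; last by field.
by rewrite ltr_pM2r//; lra.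
Qed.

Lemma cell_average_itv (h : R) (j : int) : 0 < h -> 0 <= cell_average f h j <= 1.
Proof.
move=> h0; have [ab e] := cell_endpoints j h0.
have ff : {ae mu, forall x, f x = f x} by exact: aeT.
have := @average_osc f _ _ 2^-1 2^-1 ab ff.
rewrite e -/(cell_average f h j) => hh.
have : `|cell_average f h j - 2^-1| <= 2^-1.
  by apply: hh => x _; have := f01 x; rewrite ler_norml; lra.
by rewrite ler_norml; lra.
Qed.

Lemma cell_average_near (h : R) (m g : R -> R) (k : int) (z : R) : 0 < h ->
  {homo m : x y / x <= y} -> {ae mu, forall x, f x = g x} ->
  (forall x y, x <= y -> `|g y - g x| <= m y - m x) ->
  (k%:~R - 2^-1) * h <= z <= (k%:~R + 2^-1) * h ->
  `|cell_average f h k - g z| <= m ((k%:~R + 2^-1) * h) - m ((k%:~R - 2^-1) * h).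
Proof.
move=> h0 mh fg gm zI; have [ab e'] := cell_endpoints k h0.
rewrite /cell_average -{1}e'; apply: (average_osc ab fg) => y yI.
have [xy|yx] := leP z y.
  have := gm _ _ xy; have := mh ((k%:~R - 2^-1) * h) z; have := mh y ((k%:~R + 2^-1) * h).
  by case/andP: zI => -> _; case/andP: yI => _ -> => /(_ isT) ? /(_ isT) ? ?; lra.
have := gm _ _ (ltW yx); have := mh ((k%:~R - 2^-1) * h) y; have := mh z ((k%:~R + 2^-1) * h).
by case/andP: yI => -> _; case/andP: zI => _ -> => /(_ isT) ? /(_ isT) ?; rewrite distrC; lra.
Qed.

(** Neighbouring averages are both compared with the value at their common endpoint. The oscillation
    of each cell is then used by both of its neighbours, which is the origin of the factor 2. *)
Lemma cell_average_wsum (h : R) : 0 < h -> (TV f < +oo)%E ->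
  wsum_le (fun j => `|cell_average f h (j + 1) - cell_average f h j|) (2 * fine (TV f)).
Proof.
move=> h0 fT a n; apply/ler_addgt0Pr => e e0.
have [m fm] := TV_ae_variation fT (divr_gt0 e0 (ltr0n R 2)).
have [mh mT [g [fg gm]]] := fm.
pose M j := m ((j%:~R - 2^-1) * h).
have Mp j : m ((j%:~R + 2^-1) * h) = M (j + 1).
  by rewrite /M intrD; congr (m (_ * _)); lra.
have tel (F : int -> R) : \sum_(i < n) (F (a + i%:Z + 1) - F (a + i%:Z)) = F (a + n%:Z) - F a.
  rewrite -(big_mkord xpredT (fun i : nat => F (a + i%:Z + 1) - F (a + i%:Z))).
  rewrite (eq_bigr (fun i : nat => F (a + i.+1%:Z) - F (a + i%:Z))).
    by rewrite (telescope_sumr (fun i => F (a + i%:Z)))// addr0.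
  by move=> i _; congr (F _ - _); lia.
apply: (@le_trans _ _ (\sum_(i < n) ((M (a + i%:Z + 1 + 1) + M (a + i%:Z + 1)) -
   (M (a + i%:Z + 1) + M (a + i%:Z))))).
  apply: ler_sum => i _; set j := a + i%:Z.
  pose z := (j%:~R + 2^-1) * h.
  have jh : (j%:~R - 2^-1) * h <= z by rewrite /z ler_pM2r//; lra.
  have jh' : z <= ((j + 1)%:~R + 2^-1) * h by rewrite /z ler_pM2r// intrD; lra.
  have jz : ((j + 1)%:~R - 2^-1) * h = z by rewrite /z intrD; congr (_ * _); lra.
  have near (k : int) : (k%:~R - 2^-1) * h <= z <= (k%:~R + 2^-1) * h ->
      `|cell_average f h k - g z| <= M (k + 1) - M k.
    by rewrite -Mp; exact: cell_average_near.
  have n1 := near j; rewrite jh lexx in n1; have {}n1 := n1 isT.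
  have n2 := near (j + 1); rewrite jz lexx jh' in n2; have {}n2 := n2 isT.
  have := ler_distD (g z) (cell_average f h (j + 1)) (cell_average f h j).
  rewrite (distrC (g z)); lra.
rewrite (tel (fun j => M (j + 1) + M j)).
have := mT (((a + n%:Z + 1)%:~R - 2^-1) * h); have := mT (((a + n%:Z)%:~R - 2^-1) * h).
have := mT (((a + 1)%:~R - 2^-1) * h); have := mT ((a%:~R - 2^-1) * h).
rewrite /M; lra.
Qed.

Definition cell_index (h x : R) : int := Num.floor (x / h + 2^-1).

Lemma cell_indexP (h x : R) : 0 < h ->
  ((cell_index h x)%:~R - 2^-1) * h <= x < ((cell_index h x)%:~R + 2^-1) * h.
Proof.
move=> h0; rewrite -ler_pdivlMr// -ltr_pdivrMr//.
have := floor_le_tmp (x / h + 2^-1); rewrite /cell_index.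
have := lt_succ_floor (x / h + 2^-1); rewrite intrD => ? ?; apply/andP; split; lra.
Qed.

Lemma cell_index_unique (h x : R) (j : int) : 0 < h ->
  (j%:~R - 2^-1) * h <= x < (j%:~R + 2^-1) * h -> cell_index h x = j.
Proof.
move=> h0; rewrite -ler_pdivlMr// -ltr_pdivrMr// => /andP[h1 h2].
by apply: floor_def; rewrite intrD; apply/andP; split; lra.
Qed.

Lemma measurable_cell_index (h : R) (u : int -> R) : 0 < h ->
  measurable_fun [set: R] (fun x => u (cell_index h x)).
Proof.
move=> h0 _ Y mY; rewrite setTI.
have -> : (fun x => u (cell_index h x)) @^-1` Y =
  \bigcup_(j in [set j | Y (u j)]) `[(j%:~R - 2^-1) * h, (j%:~R + 2^-1) * h[%classic.
  apply/seteqP; split => x /=.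
    move=> Yx; exists (cell_index h x) => //=; rewrite in_itv/=; exact: cell_indexP.
  by move=> [j /= Yj]; rewrite in_itv/= => /(cell_index_unique h0) ->.
rewrite bigcup_mkcond; apply: countable_bigcupT_measurable => //.
by move=> j; case: ifP => // _; exact: measurable_itv.
Qed.

(** After a translation by [h], the cell containing [x + h] lies in [[x, x + 2 * h]], so the error
    at that point is at most an increment of the variation function over a step [2 * h]. *)
Lemma cell_average_L1 (h : R) : 0 < h -> (TV f < +oo)%E ->
  (\int[mu]_x `|f x - cell_average f h (cell_index h x)|%:E <= (2 * h * fine (TV f))%:E)%E.
Proof.
move=> h0 fT; apply/lee_addgt0Pr => e e0.
have h20 : 0 < 2 * h by rewrite mulr_gt0.
have [m [mh mT [g [fg gm]]]] := TV_ae_variation fT (divr_gt0 e0 h20).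
apply: (@le_trans _ _ ((2 * h) * (fine (TV f) + e / (2 * h)))%:E); last first.
  by rewrite mulrDr mulrCA divff ?gt_eqF// mulr1 EFinD.
apply: le_trans (monotone_shift_le mh mT (ltW h20)).
have mm : measurable_fun [set: R] m by apply: nondecreasing_measurable.
have mI : measurable_fun [set: R] (fun x => cell_average f h (cell_index h x)).
  exact: measurable_cell_index.
rewrite -(ge0_integral_shift h (f := fun x => `|f x - cell_average f h (cell_index h x)|%:E)); last 2 first.
- by apply/measurable_EFinP; apply: measurableT_comp => //; exact: measurable_funB.
- by move=> x; rewrite lee_fin.
apply: ae_ge0_integral_le => //.
- apply: measurableT_comp => //; apply: measurable_funB.
    by apply: measurableT_comp => //; exact: measurable_shift.
  by apply: (measurableT_comp mI); exact: measurable_shift.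
- by apply: measurable_funB => //; apply: measurableT_comp => //; exact: measurable_shift.
- by move=> x; rewrite subr_ge0 mh// lerDl ltW.
apply: aeS (ae_shift h fg) => x -> _.
have /andP[i1 i2] := cell_indexP (x + h) h0; set k := cell_index h (x + h) in i1 i2 *.
rewrite distrC; have := @cell_average_near h m g k (x + h) h0 mh fg gm.
rewrite i1 (ltW i2) => /(_ isT) hk; apply: (le_trans hk).
rewrite lerB// mh//; have [_ e'] := cell_endpoints k h0; lra.
Qed.

End CellAverage.

Section VelocityMeasurable.
Context {R : realType}.
Variables (V : R -> R) (vM lV : R).
Hypothesis hV : velocity V vM lV.

Definition clip (x : R) : R := Num.max 0 (Num.min x 1).

Lemma clip_itv x : 0 <= clip x <= 1.
Proof. by rewrite /clip le_max lexx ge_max ler01 ge_min lexx orbT. Qed.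

Lemma clip_id x : 0 <= x <= 1 -> clip x = x.
Proof. by move=> /andP[x0 x1]; rewrite /clip min_l// max_r. Qed.

Lemma le_clip : {homo clip : x y / x <= y}.
Proof.
move=> x y xy; rewrite /clip ge_max le_max lexx/= le_max; apply/orP; right.
by rewrite le_min !ge_min lexx orbT xy.
Qed.

Lemma measurable_clip : measurable_fun [set: R] clip.
Proof. by apply: nondecreasing_measurable => //; exact: le_clip. Qed.

(** Outside [[0, 1]] the values of [V] are arbitrary; composed with [clip] it becomes antitone on
    the whole line, hence measurable. *)
Lemma measurable_velocity d (T : measurableType d) (D : set T) (u : T -> R) :
  measurable D -> measurable_fun D u ->
  (forall x, D x -> 0 <= u x <= 1) -> measurable_fun D (V \o u).
Proof.
move=> mD mu_ u01.
have mVc : measurable_fun [set: R] (V \o clip).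
  apply: nonincreasing_measurable => // x y xy /=.
  case: hV => _ _ _ /(_ (clip x) (clip y)).
  have := clip_itv x; have := clip_itv y => /andP[? ?] /andP[? ?].
  by move=> /(_ ltac:(lra) (le_clip xy) ltac:(lra)); lra.
apply: (@eq_measurable_fun _ _ _ _ D ((V \o clip) \o u)).
  by move=> x /set_mem Dx /=; rewrite clip_id// u01.
exact: measurableT_comp.
Qed.

End VelocityMeasurable.

(** * The local scheme *)

Section LocalScheme.
Context {R : realType}.
Variables (V : R -> R) (vM lV lambda : R).
Hypotheses (hV : velocity V vM lV) (l0 : 0 < lambda) (cfl : lambda * (vM + lV) <= 1).
Implicit Types (h s T : R) (f Z : R -> R).

(* The scheme with [gamma_0 = 1], acting on functions of [x] rather than on cell values
   so that it commutes with all translations, not just those by multiples of [h]. *)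
Definition local_step h Z : R -> R :=
  fun x => Z x + lambda * (Z (x - h) * V (Z x) - Z x * V (Z (x + h))).

Definition local_scheme h f (n : nat) : R -> R := iter n (local_step h) f.

Definition field Z : Prop := measurable_fun [set: R] Z /\ forall x, 0 <= Z x <= 1.

Lemma field_shift s Z : field Z -> field (fun x => Z (x + s)).
Proof.
by move=> [mZ Z01]; split => //; apply: measurableT_comp => //; exact: measurable_shift.
Qed.

Lemma measurable_V Z : field Z -> measurable_fun [set: R] (fun x => V (Z x)).
Proof. by move=> [mZ Z01]; apply: (measurable_velocity hV). Qed.

Lemma velocity_le v : 0 <= v <= 1 -> 0 <= lambda * V v <= 1 - lambda * lV.
Proof. by case: (hV) => _ _ hb _ /hb; exact: cfl_vM. Qed.

Let lV0 : 0 <= lambda * lV.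
Proof. by case: hV => _ h _ _; rewrite mulr_ge0// ltW. Qed.

Lemma V_antitone x y : 0 <= x <= 1 -> 0 <= y <= 1 -> 0 <= (y - x) * (V x - V y).
Proof. exact: (velocity_antitone hV). Qed.

Lemma V_lip x y : 0 <= x <= 1 -> 0 <= y <= 1 -> `|V x - V y| <= lV * `|x - y|.
Proof. exact: (velocity_lip hV). Qed.

(** Flux of the distance of two solutions, deliberately asymmetric: the speed of [Z1] transports the
    distance, and the density [Z2] multiplies the difference of speeds. For constant [Z1] it is a
    numerical Kruzhkov flux for [Z2]. *)
Definition lflux h Z1 Z2 y : R :=
  V (Z1 (y + h)) * `|Z1 y - Z2 y| - Z2 y * `|V (Z1 (y + h)) - V (Z2 (y + h))|.

(** One pointwise inequality serves two purposes: integrated, it gives the L1 contraction; with a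
    constant for [Z1], which the scheme preserves, it is the entropy inequality. *)
Lemma local_step_contraction h Z1 Z2 x : (forall x, 0 <= Z1 x <= 1) ->
  (forall x, 0 <= Z2 x <= 1) ->
  `|local_step h Z1 x - local_step h Z2 x| <=
  `|Z1 x - Z2 x| + lambda * (lflux h Z1 Z2 (x - h) - lflux h Z1 Z2 x).
Proof.
move=> h1 h2; rewrite /lflux !subrK.
have a1 := h1 x; have a2 := h2 x; have b2 := h2 (x - h).
have a3 := velocity_le (h1 (x + h)); have a4 := velocity_le (h1 x).
have -> : local_step h Z1 x - local_step h Z2 x =
  ((1 - lambda * V (Z1 (x + h))) * (Z1 x - Z2 x)
     - lambda * (Z2 (x - h) * (V (Z2 x) - V (Z1 x)))) +
  lambda * V (Z1 x) * (Z1 (x - h) - Z2 (x - h)) +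
  lambda * Z2 x * (V (Z2 (x + h)) - V (Z1 (x + h))) by rewrite /local_step; ring.
have s : `|(1 - lambda * V (Z1 (x + h))) * (Z1 x - Z2 x)
     - lambda * (Z2 (x - h) * (V (Z2 x) - V (Z1 x)))| <=
   (1 - lambda * V (Z1 (x + h))) * `|Z1 x - Z2 x|
     - lambda * `|Z2 (x - h) * (V (Z2 x) - V (Z1 x))|.
  apply: (absorb_same_sign (c := lV)).
  - exact: ltW.
  - rewrite mulrCA; apply: mulr_ge0; [by case/andP: b2|exact: V_antitone].
  - rewrite normrM -[leRHS]mul1r [X in _ <= _ * (_ * X)]distrC.
    apply: ler_pM => //; first by rewrite ger0_norm; lra.
    exact: V_lip.
  - lra.
have n1 : `|Z2 (x - h) * (V (Z2 x) - V (Z1 x))| = Z2 (x - h) * `|V (Z1 x) - V (Z2 x)|.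
  by rewrite normrM distrC ger0_norm//; case/andP: b2.
have n2 : `|lambda * V (Z1 x) * (Z1 (x - h) - Z2 (x - h))| =
    lambda * V (Z1 x) * `|Z1 (x - h) - Z2 (x - h)|.
  by rewrite normrM ger0_norm//; case/andP: a4.
have n3 : `|lambda * Z2 x * (V (Z2 (x + h)) - V (Z1 (x + h)))| =
    lambda * Z2 x * `|V (Z1 (x + h)) - V (Z2 (x + h))|.
  by rewrite normrM distrC ger0_norm// mulr_ge0 ?(ltW l0)//; case/andP: a2.
rewrite (le_trans (ler_normD _ _))// n3 (le_trans (lerD (ler_normD _ _) (lexx _)))//.
by rewrite n2; rewrite n1 in s; lra.
Qed.

Lemma local_step_field h Z : field Z -> field (local_step h Z).
Proof.
move=> fZ; have [mZ Z01] := fZ; split.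
  apply: measurable_funD => //; apply: measurable_funM => //.
  apply: measurable_funB; apply: measurable_funM => //.
  - exact: (field_shift (- h) fZ).1.
  - exact: measurable_V.
  - exact: measurable_V (field_shift h fZ).
move=> x; have a1 := Z01 x; have a2 := Z01 (x - h); have a3 := Z01 (x + h).
have v1 := velocity_le a1; have v3 := velocity_le a3.
have lV1 := lV0; rewrite /local_step; apply/andP; split.
  have -> : Z x + lambda * (Z (x - h) * V (Z x) - Z x * V (Z (x + h))) =
    Z x * (1 - lambda * V (Z (x + h))) + Z (x - h) * (lambda * V (Z x)) by ring.
  by rewrite addr_ge0// mulr_ge0//; lra.
have e1 : Z (x - h) * (lambda * V (Z x)) <= lambda * V (Z x).
  by rewrite -[leRHS]mul1r ler_wpM2r//; lra.
have e2 : lambda * (V (Z x) - V (Z (x + h))) <= lambda * lV * (1 - Z x).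
  rewrite -mulrA ler_pM2l//.
  have [_ lV0' _ hh] := hV.
  have [ww|ww] := leP (Z x) (Z (x + h)).
    have := hh (Z x) (Z (x + h)) ltac:(lra) ww ltac:(lra) => /andP[_ h0].
    by rewrite (le_trans h0)// ler_wpM2l//; lra.
  have := hh (Z (x + h)) (Z x) ltac:(lra) (ltW ww) ltac:(lra) => /andP[h0 _].
  have : 0 <= lV * (1 - Z x) by rewrite mulr_ge0//; lra.
  lra.
have e3 : 0 <= (1 - Z x) * (1 - lambda * lV - lambda * V (Z (x + h))).
  by rewrite mulr_ge0//; lra.
lra.
Qed.

Lemma local_scheme_field h f n : field f -> field (local_scheme h f n).
Proof. by move=> ff; elim: n => //= n; exact: local_step_field. Qed.

Lemma local_scheme_shift h s f n x :
  local_scheme h (fun y => f (y + s)) n x = local_scheme h f n (x + s).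
Proof.
elim: n x => //= n IH x; rewrite /local_step !IH.
by rewrite (_ : x - h + s = x + s - h) 1?(_ : x + h + s = x + s + h)//; ring.
Qed.

Lemma local_entropy h Z k x : (forall x, 0 <= Z x <= 1) -> 0 <= k <= 1 ->
  `|local_step h Z x - k| <=
  `|Z x - k| + lambda * (lflux h (fun=> k) Z (x - h) - lflux h (fun=> k) Z x).
Proof.
move=> Z01 k01; have := @local_step_contraction h (fun=> k) Z x (fun=> k01) Z01.
by rewrite {1}/local_step subrr mulr0 addr0 distrC (distrC k).
Qed.

Lemma lflux_consistent h Z k x : (forall x, 0 <= Z x <= 1) -> 0 <= k <= 1 ->
  `|lflux h (fun=> k) Z x - kflux V (Z x) k| <= lV * `|Z (x + h) - Z x|.
Proof.
move=> Z01 k01; have a1 := Z01 x; have a2 := Z01 (x + h).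
have -> : lflux h (fun=> k) Z x - kflux V (Z x) k =
   Z x * (`|V (Z x) - V k| - `|V (Z (x + h)) - V k|).
  by rewrite /lflux /kflux (distrC (V k)) (distrC k); ring.
rewrite normrM -[leRHS]mul1r; apply: ler_pM => //; first by rewrite ger0_norm; lra.
rewrite (le_trans (ler_dist_dist _ _))//.
rewrite (_ : V (Z x) - V k - (V (Z (x + h)) - V k) = V (Z x) - V (Z (x + h))); last by ring.
by rewrite [X in _ <= _ * X]distrC; exact: V_lip.
Qed.

Notation J f := (\int[@lebesgue_measure R]_x f x).

Lemma L1_eq (u v : R -> R) : u =1 v -> L1 u -> L1 v.
Proof. by move=> /funext ->. Qed.

Lemma J_telescope h (P : R -> R) : L1 P -> J (fun x => P (x - h) - P x) = 0.
Proof.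
by move=> hP; rewrite J_B ?(J_shift (- h) hP) ?subrr//; exact: L1_shift.
Qed.

Lemma measurable_lflux h Z1 Z2 : field Z1 -> field Z2 ->
  measurable_fun [set: R] (lflux h Z1 Z2).
Proof.
move=> f1 f2; have s1 := field_shift h f1; have s2 := field_shift h f2.
apply: measurable_funB; apply: measurable_funM => //.
- exact: measurable_V s1.
- by apply: measurableT_comp => //; apply: measurable_funB; [exact: f1.1|exact: f2.1].
- exact: f2.1.
- apply: measurableT_comp => //; apply: measurable_funB.
    exact: measurable_V s1.
  exact: measurable_V s2.
Qed.

Lemma L1_lflux h Z1 Z2 : field Z1 -> field Z2 -> L1 (fun x => Z1 x - Z2 x) ->
  L1 (lflux h Z1 Z2).
Proof.
move=> f1 f2 d; have [vM0 lVp hb _] := hV.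
apply: (@L1_le _ _ (fun x => vM * `|Z1 x - Z2 x| + lV * `|Z1 (x + h) - Z2 (x + h)|)).
- exact: measurable_lflux.
- move=> x; rewrite /lflux (le_trans (ler_normB _ _))// !normrM !normr_id; apply: lerD.
    by rewrite ler_wpM2r// ger0_norm; have := hb _ (f1.2 (x + h)); lra.
  rewrite -[leRHS]mul1r; apply: ler_pM => //.
    by have := f2.2 x; rewrite ler_norml; lra.
  by apply: V_lip; [exact: f1.2|exact: f2.2].
- apply: L1D; first exact/L1Z/L1_abs.
  exact/L1Z/L1_abs/(L1_shift h d).
Qed.

Lemma local_step_L1 h Z1 Z2 : field Z1 -> field Z2 -> L1 (fun x => Z1 x - Z2 x) ->
  L1 (fun x => local_step h Z1 x - local_step h Z2 x) /\
  J (fun x => `|local_step h Z1 x - local_step h Z2 x|) <= J (fun x => `|Z1 x - Z2 x|).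
Proof.
move=> f1 f2 d; have hq := L1_lflux h f1 f2 d.
have hr : L1 (fun x => lambda * (lflux h Z1 Z2 (x - h) - lflux h Z1 Z2 x)).
  by apply/L1Z/L1B => //; exact: L1_shift.
have hs : L1 (fun x => `|Z1 x - Z2 x| +
    lambda * (lflux h Z1 Z2 (x - h) - lflux h Z1 Z2 x)).
  by apply: L1D => //; exact: L1_abs.
have le x := @local_step_contraction h Z1 Z2 x f1.2 f2.2.
have hd : L1 (fun x => local_step h Z1 x - local_step h Z2 x).
  apply: (L1_le _ le hs).
  by apply: measurable_funB; [exact: (local_step_field h f1).1|exact: (local_step_field h f2).1].
split => //; apply: (le_trans (J_le (L1_abs hd) hs le)).
rewrite J_D//; last exact: L1_abs.
rewrite J_Z ?J_telescope ?mulr0 ?addr0//.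
by apply: L1B => //; exact: L1_shift.
Qed.

Variables (f : R -> R) (T : R).
Hypotheses (ff : field f) (fT : forall s,
  (\int[@lebesgue_measure R]_x `|f (x + s) - f x|%:E <= (`|s| * T)%:E)%E).

Lemma T_ge0 : 0 <= T.
Proof.
rewrite -lee_fin; have := fT 1; rewrite normr1 mul1r; apply: le_trans.
by apply: integral_ge0 => x _; rewrite lee_fin.
Qed.

(** The step commutes with translations and contracts L1 distances, so the translation bound of the
    datum persists. It plays the part of a variation bound for functions on the line. *)
Lemma local_scheme_translation h n s :
  L1 (fun x => local_scheme h f n (x + s) - local_scheme h f n x) /\
  J (fun x => `|local_scheme h f n (x + s) - local_scheme h f n x|) <= `|s| * T.
Proof.
have fs := field_shift s ff.
suff [a b] : L1 (fun x => local_scheme h (fun y => f (y + s)) n x - local_scheme h f n x) /\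
  J (fun x => `|local_scheme h (fun y => f (y + s)) n x - local_scheme h f n x|) <= `|s| * T.
  split; first by under eq_fun do rewrite -local_scheme_shift.
  by under eq_Rintegral do rewrite -local_scheme_shift.
elim: n => [|n [a b]] /=.
  have m1 : measurable_fun [set: R] (fun x => f (x + s) - f x).
    by apply: measurable_funB; [exact: fs.1|exact: ff.1].
  have [h1 h2] := @J_ge0_le _ (fun x => `|f (x + s) - f x|) (`|s| * T)
    ltac:(exact: measurableT_comp) ltac:(by []) (fT s).
  by split => //; apply: L1_le h1.
have [c d] := local_step_L1 h (local_scheme_field h n fs) (local_scheme_field h n ff) a.
by split => //; exact: le_trans b.
Qed.

Lemma local_scheme_time h n : 0 < h ->
  L1 (fun x => local_scheme h f n.+1 x - local_scheme h f n x) /\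
  J (fun x => `|local_scheme h f n.+1 x - local_scheme h f n x|) <= h * T.
Proof.
move=> h0; have [vM0 lVp hb _] := hV.
have fn := local_scheme_field h n ff; set Z := local_scheme h f n in fn *.
have [a1 b1] := local_scheme_translation h n (- h); rewrite -/Z in a1 b1.
have [a2 b2] := local_scheme_translation h n h; rewrite -/Z in a2 b2.
pose B x := lambda * (vM * `|Z (x - h) - Z x| + lV * `|Z (x + h) - Z x|).
have hB : L1 B by apply: L1Z; apply: L1D; apply: L1Z; exact: L1_abs.
have le x : `|local_step h Z x - Z x| <= B x.
  have -> : local_step h Z x - Z x = lambda * (V (Z x) * (Z (x - h) - Z x) -
    Z x * (V (Z (x + h)) - V (Z x))) by rewrite /local_step; ring.
  rewrite normrM (gtr0_norm l0) ler_pM2l//.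
  rewrite (le_trans (ler_normB _ _))// !normrM; apply: lerD.
    by rewrite ler_wpM2r// ger0_norm; have := hb _ (fn.2 x); lra.
  rewrite -[leRHS]mul1r; apply: ler_pM => //.
    by have := fn.2 x; rewrite ler_norml; lra.
  by apply: V_lip; exact: fn.2.
have hd : L1 (fun x => local_step h Z x - Z x).
  apply: (L1_le _ le hB).
  by apply: measurable_funB; [exact: (local_step_field h fn).1|exact: fn.1].
split => //; apply: (le_trans (J_le (L1_abs hd) hB le)).
rewrite J_Z; last by apply: L1D; apply: L1Z; exact: L1_abs.
rewrite J_D; [|exact/L1Z/L1_abs|exact/L1Z/L1_abs].
rewrite !J_Z; [|exact: L1_abs|exact: L1_abs].
rewrite normrN (gtr0_norm h0) in b1; rewrite (gtr0_norm h0) in b2.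
apply: (@le_trans _ _ (lambda * (vM * (h * T) + lV * (h * T)))).
  by rewrite ler_pM2l// lerD// ler_wpM2l.
by rewrite -mulrDl mulrA -[leRHS]mul1r ler_wpM2r// mulr_ge0 ?(ltW h0)// T_ge0.
Qed.

Lemma local_scheme_L1 h n : 0 < h -> L1 (fun x => local_scheme h f n x - f x).
Proof.
move=> h0; elim: n => [|n IH].
  by under eq_fun do rewrite /= subrr; exact: L1_0.
have := L1D (local_scheme_time n h0).1 IH.
by under eq_fun do rewrite addrA subrK.
Qed.

Lemma local_scheme_diff_L1 h h' n m s : 0 < h -> 0 < h' ->
  L1 (fun x => local_scheme h f n (x + s) - local_scheme h' f m x).
Proof.
move=> h0 h0'.
have a := (local_scheme_translation h n s).1.
have := L1B (L1D a (local_scheme_L1 n h0)) (local_scheme_L1 m h0').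
by under eq_fun do rewrite addrA subrK opprB addrA subrK.
Qed.

(** [lflux] detached from a single function: [a] is the state taken as a constant, [b] and [c] are
    the values of the other solution at neighbouring points. *)
Definition cflux (a b c : R) : R := V a * `|a - b| - b * `|V a - V c|.

Lemma cflux_L1 a b c : field a -> field b -> field c -> L1 (fun x => a x - b x) ->
  L1 (fun x => a x - c x) -> L1 (fun x => cflux (a x) (b x) (c x)).
Proof.
move=> fa fb fc dab dac; have [vM0 lVp hb _] := hV.
apply: (@L1_le _ _ (fun x => vM * `|a x - b x| + lV * `|a x - c x|)).
- apply: measurable_funB; apply: measurable_funM.
  + exact: measurable_V.
  + by apply: measurableT_comp => //; apply: measurable_funB; [exact: fa.1|exact: fb.1].
  + exact: fb.1.
  + by apply: measurableT_comp => //; apply: measurable_funB; exact: measurable_V.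
- move=> x; rewrite /cflux (le_trans (ler_normB _ _))// !normrM !normr_id; apply: lerD.
    by rewrite ler_wpM2r// ger0_norm; have := hb _ (fa.2 x); lra.
  rewrite -[leRHS]mul1r; apply: ler_pM => //.
    by have := fb.2 x; rewrite ler_norml; lra.
  by apply: V_lip; [exact: fa.2|exact: fc.2].
- by apply: L1D; apply: L1Z; exact: L1_abs.
Qed.

Section Comparison.
Variables (d : R) (K : nat).
Hypothesis d0 : 0 < d.
Let d20 : 0 < 2 * d. Proof. by rewrite mulr_gt0. Qed.
Let Z n := local_scheme (2 * d) f n.
Let Y m := local_scheme d f m.
Let C := 2 * (vM + lV).
Let fZ n : field (Z n). Proof. exact: local_scheme_field. Qed.
Let fY n : field (Y n). Proof. exact: local_scheme_field. Qed.
Let Zs n (s : R) x := Z n (x + s).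
Let fZs n s : field (Zs n s). Proof. exact: field_shift. Qed.
Let ZY n m s : L1 (fun x => Zs n s x - Y m x).
Proof. exact: local_scheme_diff_L1. Qed.
(* Discrete doubling of variables: in the sum over [K] translates of the coarse solution
   the entropy fluxes telescope, up to errors [O(d T)] per step, to the end terms [B].
   The coarse step has a factor 2, which the two fine steps compensate. *)
Let A n m := \sum_(k < K) J (fun x => `|Zs n (k%:R * d) x - Y m x|).
Let q n m s x := kflux V (Zs n s x) (Y m x).
Let Kd := K%:R * d.
Let C0 : 0 <= C. Proof. by case: hV => h1 h2 _ _; rewrite /C; lra. Qed.
Let lC : lambda * C <= 2. Proof. by rewrite /C mulrCA; have := cfl; lra. Qed.
Let llV : lambda * lV <= 1.
Proof. by case: hV => h1 h2 _ _; have := mulr_ge0 (ltW l0) h1; move: cfl; rewrite mulrDr; lra. Qed.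
Let dT : 0 <= d * T. Proof. by rewrite mulr_ge0 ?(ltW d0)// T_ge0. Qed.

Let q_L1 n m s : L1 (q n m s).
Proof.
apply: (@L1_le _ _ (fun x => C * `|Zs n s x - Y m x|)).
- have a := fZs n s; have b := fY m.
  apply: measurable_funB; apply: measurable_funM.
  + exact: measurable_V.
  + by apply: measurableT_comp => //; apply: measurable_funB; [exact: a.1|exact: b.1].
  + exact: a.1.
  + by apply: measurableT_comp => //; apply: measurable_funB; exact: measurable_V.
- by move=> x; apply: (kflux_le hV); [exact: (fZs n s).2|exact: (fY m).2].
- exact/L1Z/L1_abs.
Qed.

Let B n m := J (q n m Kd) - J (q n m 0).

Let absL n s s' : L1 (fun x => `|Zs n s x - Zs n s' x|) /\
  J (fun x => `|Zs n s x - Zs n s' x|) <= `|s - s'| * T.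
Proof.
have [a b] := local_scheme_translation (2 * d) n (s - s').
have e x : Zs n s x - Zs n s' x =
  (fun y => local_scheme (2 * d) f n (y + (s - s')) - local_scheme (2 * d) f n y) (x + s').
  by rewrite /Zs /Z /= (_ : x + s' + (s - s') = x + s)//; ring.
split; first by apply: L1_abs; apply: L1_eq (L1_shift s' a) => x; rewrite e.
under eq_Rintegral do rewrite e.
by rewrite (J_shift s' (L1_abs a)).
Qed.

Let a_ n m x (i : nat) : R := cflux (Y m x) (Z n (x + (i%:R - 2) * d)) (Z n (x + i%:R * d)).

(** A coarse step spans two fine cells, so the translates telescope with stride two and leave two
    terms at each end; this is the origin of the factor 2 in front of [B] in [Zstep]. *)
Let sum_skip2 (u : nat -> R) : \sum_(k < K) (u k - u k.+2) = u 0%N + u 1%N - u K - u K.+1.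
Proof.
elim: (K) => [|k IH]; first by rewrite big_ord0; lra.
by rewrite big_ord_recr/= IH; lra.
Qed.

Let a_err n m x i s : `|a_ n m x i - q n m s x| <=
  lV * `|Zs n (i%:R * d) x - Zs n ((i%:R - 2) * d) x| +
  C * `|Zs n ((i%:R - 2) * d) x - Zs n s x|.
Proof.
have z01 s' := (fZs n s').2 x; have y01 := (fY m).2 x.
rewrite -(subrK (kflux V (Zs n ((i%:R - 2) * d) x) (Y m x)) (a_ n m x i)) -addrA.
rewrite (le_trans (ler_normD _ _))// lerD//.
  have := @lflux_consistent (2 * d) (Z n) (Y m x) (x + (i%:R - 2) * d) (fZ n).2 y01.
  by rewrite /lflux (_ : x + (i%:R - 2) * d + 2 * d = x + i%:R * d)//; ring.
exact: (kflux_lip hV).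
Qed.

(** Each of the four end fluxes is replaced by the flux [q] at shift 0 or [Kd], with an error
    [(lV + C) * (2 * d * T)]. With [lambda * lV <= 1] and [lambda * C <= 2] the four errors make up
    [24 * (d * T)]. *)
Let Zstep n m : A n.+1 m + 2 * (lambda * B n m) <= A n m + 24 * (d * T).
Proof.
pose er i s x := lV * `|Zs n (i%:R * d) x - Zs n ((i%:R - 2) * d) x| +
  C * `|Zs n ((i%:R - 2) * d) x - Zs n s x|.
pose E x := er 0%N 0 x + er 1%N 0 x + er K Kd x + er K.+1 Kd x.
have d0' := d0; have lVp : 0 <= lV by case: hV.
have her i s : `|(i%:R - 2) * d - s| <= 2 * d ->
    L1 (er i s) /\ J (er i s) <= lV * (2 * d * T) + C * (2 * d * T).
  move=> hs; have [a1 b1] := absL n (i%:R * d) ((i%:R - 2) * d).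
  have [a2 b2] := absL n ((i%:R - 2) * d) s.
  split; first by apply: L1D; exact: L1Z.
  rewrite J_D; [|exact: L1Z|exact: L1Z]; rewrite !J_Z//.
  apply: lerD; rewrite ler_wpM2l//.
    apply: (le_trans b1); rewrite (_ : i%:R * d - (i%:R - 2) * d = 2 * d); last by ring.
    by rewrite gtr0_norm.
  by apply: (le_trans b2); rewrite ler_wpM2r// T_ge0.
have e0 : `|(0%:R - 2) * d - 0| <= 2 * d by rewrite subr0 sub0r mulNr normrN gtr0_norm.
have e1 : `|(1%:R - 2) * d - 0| <= 2 * d.
  by rewrite subr0 (_ : (1%:R - 2) * d = - d); [rewrite normrN gtr0_norm//; lra|ring].
have eK : `|(K%:R - 2) * d - Kd| <= 2 * d.
  by rewrite /Kd (_ : (K%:R - 2) * d - K%:R * d = - (2 * d)); [rewrite normrN gtr0_norm|ring].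
have eK1 : `|(K.+1%:R - 2) * d - Kd| <= 2 * d.
  rewrite /Kd (_ : (K.+1%:R - 2) * d - K%:R * d = - d).
    by rewrite normrN gtr0_norm//; lra.
  by rewrite -natr1; ring.
have [l0_ j0] := her _ _ e0; have [l1_ j1] := her _ _ e1.
have [lK jK] := her _ _ eK; have [lK1 jK1] := her _ _ eK1.
have LE : L1 E by do 3 apply: L1D => //.
have LS n' : L1 (fun x => \sum_(k < K) `|Zs n' (k%:R * d) x - Y m x|).
  have h := @L1_sum _ K (fun k x => `|Zs n' (k%:R * d) x - Y m x|) (fun k => L1_abs (ZY n' m (k%:R * d))).
  exact: h.
have pw x : \sum_(k < K) `|Zs n.+1 (k%:R * d) x - Y m x| <=
    \sum_(k < K) `|Zs n (k%:R * d) x - Y m x| +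
    lambda * (2 * (q n m 0 x - q n m Kd x)) + lambda * E x.
  have y01 := (fY m).2 x.
  apply: (@le_trans _ _ (\sum_(k < K) `|Zs n (k%:R * d) x - Y m x| +
      lambda * \sum_(k < K) (a_ n m x k - a_ n m x k.+2))).
    rewrite mulr_sumr -big_split/=; apply: ler_sum => k _.
    have := @local_entropy (2 * d) (Z n) (Y m x) (x + k%:R * d) (fZ n).2 y01.
    move/le_trans; apply; rewrite lerD2l ler_pM2l// /a_ /lflux.
    rewrite subrK -(natr1 k.+1) -(natr1 k).
    rewrite (_ : x + k%:R * d - 2 * d = x + (k%:R - 2) * d); last by ring.
    rewrite (_ : x + (k%:R + 1 + 1 - 2) * d = x + k%:R * d); last by ring.
    by rewrite (_ : x + (k%:R + 1 + 1) * d = x + k%:R * d + 2 * d)//; ring.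
  rewrite sum_skip2 -[leRHS]addrA lerD2l -mulrDr ler_pM2l//.
  have h0 := a_err n m x 0 0; have h1 := a_err n m x 1 0.
  have hK := a_err n m x K Kd; have hK1 := a_err n m x K.+1 Kd.
  rewrite -!/(er _ _ x) in h0 h1 hK hK1.
  rewrite /E; move: h0 h1 hK hK1; rewrite !ler_norml; lra.
have LQ : L1 (fun x => lambda * (2 * (q n m 0 x - q n m Kd x))).
  by apply/L1Z/L1Z/L1B; exact: q_L1.
have LlE : L1 (fun x => lambda * E x) by exact: L1Z.
have := J_le (LS n.+1) (L1D (L1D (LS n) LQ) LlE) pw.
rewrite !J_D//; [|exact: L1D].
rewrite (J_sum K (F := fun k x => `|Zs n.+1 (k%:R * d) x - Y m x|)); last by move=> k; exact: L1_abs.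
rewrite (J_sum K (F := fun k x => `|Zs n (k%:R * d) x - Y m x|)); last by move=> k; exact: L1_abs.
rewrite -/(A n.+1 m) -/(A n m) J_Z; last by apply/L1Z/L1B; exact: q_L1.
rewrite J_Z; last by apply: L1B; exact: q_L1.
rewrite J_B; [|exact: q_L1|exact: q_L1].
rewrite (J_Z _ LE) /B.
have JE : J E <= 4 * (lV * (2 * d * T) + C * (2 * d * T)).
  rewrite /E (J_D (L1D (L1D l0_ l1_) lK) lK1) (J_D (L1D l0_ l1_) lK) (J_D l0_ l1_); lra.
have : lambda * J E <= 24 * (d * T).
  apply: (@le_trans _ _ (lambda * (4 * (lV * (2 * d * T) + C * (2 * d * T))))).
    by rewrite ler_pM2l.
  have -> : lambda * (4 * (lV * (2 * d * T) + C * (2 * d * T))) =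
    8 * ((lambda * lV + lambda * C) * (d * T)) by ring.
  have : (lambda * lV + lambda * C) * (d * T) <= 3 * (d * T).
    by rewrite ler_wpM2r//; move: llV lC; lra.
  lra.
lra.
Qed.

(** Under the integral, moving the fine solution by one cell amounts to moving the index of the
    coarse translate: [r k.+1 x = P k (x + d)]. The flux difference in [x] thus becomes a
    telescoping sum in [k], with the sign opposite to that in [Zstep]. *)
Let Ystep n m : A n m.+1 <= A n m + lambda * B n m + 2 * (d * T).
Proof.
have lVp : 0 <= lV by case: hV.
pose P (k : nat) x := cflux (Zs n (k%:R * d) x) (Y m (x - d)) (Y m x).
have LP k : L1 (P k).
  have fYd : field (fun x => Y m (x - d)) by exact: field_shift.
  apply: cflux_L1 => //.
  have := L1_shift (- d) (ZY n m (k.+1%:R * d)).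
  apply: L1_eq => x; congr (_ - _); rewrite /Zs.
  by rewrite -natr1; congr (Z n _); ring.
pose r (k : nat) x := cflux (Zs n (k%:R * d) x) (Y m x) (Y m (x + d)).
have Pr k x : r k.+1 x = P k (x + d).
  rewrite /P addrK /r /Zs -natr1; congr (cflux (Z n _) _ _); ring.
pose er x := lV * `|Y m (x + d) - Y m x|.
have [a b] := local_scheme_translation d m d; rewrite -/(Y m) (gtr0_norm d0) in a b.
have Ler : L1 er by exact/L1Z/L1_abs.
have con x k : `|r k x - q n m (k%:R * d) x| <= er x.
  rewrite /q (kfluxC hV); [|exact: (fZs n _).2|exact: (fY m).2].
  exact: (@lflux_consistent d (Y m) (Zs n (k%:R * d) x) x (fY m).2 ((fZs n _).2 x)).
have pw x : \sum_(k < K) `|Zs n (k%:R * d) x - Y m.+1 x| <=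
    \sum_(k < K) `|Zs n (k%:R * d) x - Y m x| +
    lambda * \sum_(k < K) (P k x - P k (x + d)) +
    lambda * (q n m Kd x - q n m 0 x) + 2 * (lambda * er x).
  apply: (@le_trans _ _ (\sum_(k < K) `|Zs n (k%:R * d) x - Y m x| +
      lambda * \sum_(k < K) ((P k x - P k (x + d)) + (r k.+1 x - r k x)))).
    rewrite mulr_sumr -big_split/=; apply: ler_sum => k _.
    have := @local_entropy d (Y m) (Zs n (k%:R * d) x) x (fY m).2 ((fZs n _).2 x).
    rewrite distrC (distrC (Y m x)) => /le_trans; apply; rewrite lerD2l ler_pM2l//.
    by rewrite Pr addrA subrK /lflux /P /cflux subrK /r /cflux.
  rewrite big_split/= mulrDr.
  have tel : \sum_(k < K) (r k.+1 x - r k x) = r K x - r 0%N x.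
    rewrite -(big_mkord xpredT (fun k => r k.+1 x - r k x)).
    by rewrite (telescope_sumr (fun k => r k x)).
  rewrite tel.
  suff : lambda * (r K x - r 0%N x) <=
    lambda * (q n m Kd x - q n m 0 x) + 2 * (lambda * er x) by lra.
  rewrite [2 * _]mulrCA -mulrDr ler_pM2l//.
  have := con x K; have := con x 0%N; rewrite mul0r -/Kd !ler_norml; lra.
have LS m' : L1 (fun x => \sum_(k < K) `|Zs n (k%:R * d) x - Y m' x|).
  by apply: (L1_sum K (F := fun k x => `|Zs n (k%:R * d) x - Y m' x|)) => k; exact: L1_abs.
have LPd k : L1 (fun x => P k x - P k (x + d)).
  by apply: L1B => //; exact: (L1_shift d (LP k)).
have L2 : L1 (fun x => lambda * \sum_(k < K) (P k x - P k (x + d))).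
  by apply: L1Z; apply: (L1_sum K (F := fun k x => P k x - P k (x + d))).
have L3 : L1 (fun x => lambda * (q n m Kd x - q n m 0 x)).
  by apply/L1Z/L1B; exact: q_L1.
have L4 : L1 (fun x => 2 * (lambda * er x)) by exact/L1Z/L1Z.
have L12 : L1 (fun x => \sum_(k < K) `|Zs n (k%:R * d) x - Y m x| +
  lambda * \sum_(k < K) (P k x - P k (x + d))) by exact: (L1D (LS m) L2).
have := J_le (LS m.+1) (L1D (L1D L12 L3) L4) pw.
rewrite J_D//; last exact: L1D.
rewrite J_D// J_D//.
rewrite (J_sum K (F := fun k x => `|Zs n (k%:R * d) x - Y m.+1 x|)); last by move=> k; exact: L1_abs.
rewrite (J_sum K (F := fun k x => `|Zs n (k%:R * d) x - Y m x|)); last by move=> k; exact: L1_abs.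
rewrite -/(A n m.+1) -/(A n m).
rewrite J_Z; last by apply: (L1_sum K (F := fun k x => P k x - P k (x + d))).
rewrite (J_sum K (F := fun k x => P k x - P k (x + d)))//.
rewrite big1; last first.
  by move=> k _; rewrite J_B//; [rewrite (J_shift d (LP k)) subrr|exact: (L1_shift d (LP k))].
rewrite J_Z; last by apply: L1B; exact: q_L1.
rewrite J_B; [|exact: q_L1|exact: q_L1].
rewrite J_Z; last exact: L1Z.
rewrite J_Z// -/(B n m) mulr0 addr0 => h.
apply: (le_trans h); rewrite lerD2l ler_pM2l// /er J_Z; last exact: L1_abs.
rewrite mulrA -[leRHS]mul1r; apply: ler_pM => //.
by apply: J_ge0.
Qed.

Let Bstep n m : `|lambda * B n m.+1 - lambda * B n m| <= 4 * (d * T).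
Proof.
have [a b] := local_scheme_time m d0; rewrite -/(Y m) -/(Y m.+1) in a b.
have bs s : `|J (q n m.+1 s) - J (q n m s)| <= C * (d * T).
  rewrite -J_B; [|exact: q_L1|exact: q_L1].
  have lq : L1 (fun x => q n m.+1 s x - q n m s x) by apply: L1B; exact: q_L1.
  apply: (le_trans (J_abs lq)).
  apply: (@le_trans _ _ (J (fun x => C * `|Y m.+1 x - Y m x|))).
    apply: J_le; [exact: L1_abs|exact/L1Z/L1_abs|move=> x].
    have z := (fZs n s).2 x; have y1 := (fY m.+1).2 x; have y0 := (fY m).2 x.
    by rewrite /q !(kfluxC hV z)//; exact: (kflux_lip hV).
  by rewrite J_Z; [rewrite ler_wpM2l|exact: L1_abs].
have h1 := bs Kd; have h2 := bs 0.
rewrite -mulrBr normrM (gtr0_norm l0).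
apply: (@le_trans _ _ (lambda * (2 * (C * (d * T))))).
  rewrite ler_pM2l// /B; move: h1 h2; rewrite !ler_norml; lra.
rewrite (_ : lambda * _ = 2 * ((lambda * C) * (d * T))); last by ring.
by have := ler_wpM2r dT lC; lra.
Qed.

(** One coarse step against two fine ones: 40 is 24 from [Zstep], twice 2 from [Ystep], and 8 + 4
    for replacing [B n m] and [B n m.+1] by [B n m.+2]. *)
Let macro n m : A n.+1 m.+2 <= A n m + 40 * (d * T).
Proof.
have := Zstep n m.+2; have := Ystep n m.+1; have := Ystep n m.
have := Bstep n m; have := Bstep n m.+1; rewrite !ler_norml; lra.
Qed.

(** Undoing the translations costs at most [K * d * T] for each of the [K] terms, once at the
    initial time, where both solutions equal [f], and once at the final time. *)
Lemma local_scheme_refine n :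
  K%:R * J (fun x => `|local_scheme (2 * d) f n x - local_scheme d f n.*2 x|) <=
  2 * (K%:R * (K%:R * d * T)) + n%:R * (40 * (d * T)).
Proof.
have T0 := T_ge0; have d0' := d0.
have sumK (c : R) : \sum_(k < K) c = K%:R * c by rewrite sumr_const card_ord mulr_natl.
have kd (k : 'I_K) : `|k%:R * d| * T <= K%:R * d * T.
  rewrite ler_wpM2r// ger0_norm ?mulr_ge0 ?(ltW d0)// ler_wpM2r ?(ltW d0)//.
  by rewrite ler_nat ltnW.
have A0 : A 0 0 <= K%:R * (K%:R * d * T).
  rewrite -[leRHS]sumK; apply: ler_sum => k _.
  apply: le_trans (kd k); exact: (local_scheme_translation d 0 (k%:R * d)).2.
have An : A n n.*2 <= A 0%N 0%N + n%:R * (40 * (d * T)).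
  elim: n => [|n IH]; first by rewrite mul0r addr0.
  by rewrite doubleS; have := macro n n.*2; rewrite -natr1 mulrDl; lra.
have L1n : L1 (fun x => local_scheme (2 * d) f n x - local_scheme d f n.*2 x).
  have := local_scheme_diff_L1 n n.*2 0 d20 d0; by under eq_fun do rewrite addr0.
suff : K%:R * J (fun x => `|local_scheme (2 * d) f n x - local_scheme d f n.*2 x|) <=
    A n n.*2 + K%:R * (K%:R * d * T) by lra.
rewrite -[X in _ + X]sumK -[leLHS]sumK -big_split/=.
apply: ler_sum => k _; apply: le_trans (lerD (lexx _) (kd k)).
have [a b] := local_scheme_translation (2 * d) n (k%:R * d).
apply: le_trans (lerD (lexx _) b); rewrite -J_D; [|exact: L1_abs|exact: L1_abs].
apply: J_le; [exact: L1_abs|apply: L1D; exact: L1_abs|move=> x].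
by rewrite [leRHS]addrC [X in _ <= X + _]distrC; exact: ler_distD.
Qed.

End Comparison.
End LocalScheme.

(** * The limit of the local scheme *)

Section LimitSup.
Context {R : realType}.

Lemma half_pow_small (C e : R) : 0 < e -> exists m : nat, C * 2^-1 ^+ m <= e.
Proof.
move=> e0.
have : C * 2^-1 ^+ m @[m --> \oo] --> C * (0 : R).
  apply: cvgM; first exact: cvg_cst.
  by apply: cvg_expr; rewrite ger0_norm; lra.
rewrite mulr0 => /cvgrPdist_lt /(_ _ e0) [m _ /(_ m (leqnn m))] /=.
rewrite sub0r normrN => h; exists m; apply: le_trans (ltW h); exact: ler_norm.
Qed.

Lemma limn_sup_itv (u : nat -> R) (a b : R) (m : nat) :
  (forall j, 0 <= u j <= 1) ->
  (forall j, (m <= j)%N -> a <= u j <= b) -> a <= limn_sup u <= b.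
Proof.
move=> u01 uab.
have ub : has_ubound (range u) by exists 1 => _ [j _ <-]; case/andP: (u01 j).
have lb : has_lbound (range u) by exists 0 => _ [j _ <-]; case/andP: (u01 j).
have c : cvgn (sups u) by apply/cvg_ex; eexists; exact: cvg_sups_inf.
have sab n : (m <= n)%N -> a <= sups u n <= b.
  move=> mn; have hs : has_sup (sdrop u n).
    split; first by exists (u n); exists n => /=.
    by exists 1 => _ [j _ <-]; case/andP: (u01 j).
  apply/andP; split.
    apply: (@le_trans _ _ (u n)); first by case/andP: (uab n mn).
    by apply: ub_le_sup; [case: hs|exists n => /=].
  apply: ge_sup; first by case: hs.
  by move=> _ [j /= nj <-]; case/andP: (uab j (leq_trans mn nj)).
apply/andP; split.
  by apply: limr_ge => //; exists m => // n /= /sab /andP[].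
by apply: limr_le => //; exists m => // n /= /sab /andP[].
Qed.

End LimitSup.

Section LimitSolution.
Context {R : realType}.
Notation mu := (@lebesgue_measure R).
Notation J f := (\int[@lebesgue_measure R]_x f x).
Variables (V : R -> R) (vM lV lambda : R).
Hypotheses (hV : velocity V vM lV) (l0 : 0 < lambda) (cfl : lambda * (vM + lV) <= 1).
Variables (f : R -> R) (T : R).
Hypotheses (ff : field f) (fT : forall s,
  (\int[@lebesgue_measure R]_x `|f (x + s) - f x|%:E <= (`|s| * T)%:E)%E).
Implicit Types (s t x : R) (m n : nat).

Definition step_index (tau t : R) : nat := Num.truncn (t / tau).

Lemma step_indexP tau t : 0 < tau -> 0 <= t ->
  (step_index tau t)%:R * tau <= t < (step_index tau t).+1%:R * tau.
Proof.
move=> tau0 t0; rewrite -ler_pdivlMr// -ltr_pdivrMr//.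
by apply: truncn_itv; rewrite divr_ge0// ltW.
Qed.

Lemma step_index_unique tau t n : 0 < tau ->
  n%:R * tau <= t < n.+1%:R * tau -> step_index tau t = n.
Proof.
move=> tau0 /andP[t1 t2].
have t0 : 0 <= t by apply: le_trans t1; rewrite mulr_ge0// ltW.
have /andP[u1 u2] := step_indexP tau0 t0.
apply/eqP; rewrite eqn_leq -!(ltnS _ n) -!(ltnS n) -!(ltr_nat R).
rewrite -(ltr_pM2r tau0) -[X in _ && X](ltr_pM2r tau0).
by rewrite (le_lt_trans u1 t2) (le_lt_trans t1 u2).
Qed.

Lemma measurable_step_index tau n : 0 < tau ->
  measurable [set t | step_index tau t = n].
Proof.
move=> tau0; pose g t : R := (step_index tau t)%:R.
have mg : measurable_fun [set: R] g.
  apply: nondecreasing_measurable => // s t st; rewrite ler_nat.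
  by apply: le_truncn; rewrite ler_wpM2r// invr_ge0 ltW.
have -> : [set t | step_index tau t = n] = g @^-1` [set n%:R].
  apply/seteqP; split => t /=; rewrite /g; first by move=> ->.
  by move=> /eqP; rewrite eqr_nat => /eqP.
by rewrite -[X in measurable X]setTI; apply: mg.
Qed.

Lemma measurable_steps tau (u : nat -> R -> R) : 0 < tau ->
  (forall n, measurable_fun [set: R] (u n)) ->
  measurable_fun [set: R * R] (fun z => u (step_index tau z.1) z.2).
Proof.
move=> tau0 mu_ _ Y mY; rewrite setTI.
have -> : (fun z : R * R => u (step_index tau z.1) z.2) @^-1` Y =
  \bigcup_n ([set t | step_index tau t = n] `*` (u n @^-1` Y)).
  apply/seteqP; split => [[t x] /= Yt|[t x] [n _ [/= <-]]//].
  by exists (step_index tau t).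
apply: bigcupT_measurable => n; apply: measurableX.
  exact: measurable_step_index.
by rewrite -[X in measurable X]setTI; exact: mu_.
Qed.

(* The refinement error is of the order of the square root of the mesh size; the ratio 4
   makes it geometric with ratio 1/2. *)
Definition mesh m : R := 4^-1 ^+ m.

Lemma mesh_gt0 m : 0 < mesh m. Proof. by rewrite exprn_gt0. Qed.

Lemma tau_gt0 m : 0 < lambda * mesh m. Proof. by rewrite mulr_gt0// mesh_gt0. Qed.

Definition refsol m t : R -> R :=
  local_scheme V lambda (mesh m) f (step_index (lambda * mesh m) t).

(* The pointwise limsup is a representative of the L1 limit, measurable in [(t, x)] and
   with values in [0, 1] everywhere. *)
Definition limsol t x : R := limn_sup (fun m => refsol m t x).

Lemma refsol_field m t : field (refsol m t).
Proof. exact: (local_scheme_field hV l0 cfl). Qed.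

Lemma limsol_itv t x : 0 <= limsol t x <= 1.
Proof. by apply: (limn_sup_itv (m := 0)) => [j|j _]; exact: (refsol_field j t).2. Qed.

Lemma measurable_refsol m : measurable_fun [set: R * R] (fun z => refsol m z.1 z.2).
Proof.
apply: (measurable_steps (u := local_scheme V lambda (mesh m) f)).
  exact: tau_gt0.
by move=> n; exact: (local_scheme_field hV l0 cfl _ _ ff).1.
Qed.

Lemma measurable_limsol : measurable_fun [set: R * R] (fun z => limsol z.1 z.2).
Proof.
apply: (measurable_fun_limn_sup (h := fun m z => refsol m z.1 z.2)).
- by move=> z _; exists 1 => _ [j _ <-]; case/andP: ((refsol_field j z.1).2 z.2).
- by move=> z _; exists 0 => _ [j _ <-]; case/andP: ((refsol_field j z.1).2 z.2).
- exact: measurable_refsol.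
Qed.

Lemma limsol_field t : field (limsol t).
Proof.
split; last exact: limsol_itv.
have : measurable_fun [set: R] ((fun z => limsol z.1 z.2) \o (fun x : R => (t, x))).
  by apply: measurableT_comp; [exact: measurable_limsol|exact: measurable_pair1].
by [].
Qed.

Let T0 : 0 <= T. Proof. exact: (T_ge0 fT). Qed.

Lemma local_scheme_steps h n p : 0 < h ->
  L1 (fun x => local_scheme V lambda h f (n + p) x - local_scheme V lambda h f n x) /\
  J (fun x => `|local_scheme V lambda h f (n + p) x - local_scheme V lambda h f n x|) <=
    p%:R * (h * T).
Proof.
move=> h0; elim: p => [|p [a b]].
  rewrite addn0; split; first by apply: L1_eq L1_0 => x; rewrite subrr.
  under eq_Rintegral do rewrite subrr normr0.
  by rewrite Rintegral_cst// !mul0r.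
have [c e] := local_scheme_time hV l0 cfl ff fT (n + p) h0; rewrite addnS.
split; first by apply: L1_eq (L1D c a) => x; rewrite addrA subrK.
apply: (@le_trans _ _ (J (fun x => `|local_scheme V lambda h f (n + p).+1 x - local_scheme V lambda h f (n + p) x| +
  `|local_scheme V lambda h f (n + p) x - local_scheme V lambda h f n x|))).
  apply: J_le.
  - by apply: L1_abs; apply: L1_eq (L1D c a) => x; rewrite addrA subrK.
  - by apply: L1D; exact: L1_abs.
  - by move=> x; exact: ler_distD.
rewrite J_D; [|exact: L1_abs|exact: L1_abs].
by rewrite -natr1 mulrDl mul1r addrC lerD.
Qed.

Lemma refsol_step m t : 0 <= t ->
  L1 (fun x => refsol m.+1 t x - refsol m t x) /\
  J (fun x => `|refsol m.+1 t x - refsol m t x|) <=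
    (5 + 40 * (t / lambda)) * T * 2^-1 ^+ m.
Proof.
move=> t0.
set h := mesh m.+1; have h0 : 0 < h by exact: mesh_gt0.
have hm : mesh m = 2 * (2 * h) by rewrite /h /mesh exprS; field.
have ip1 := step_indexP (tau_gt0 m) t0; have ip2 := step_indexP (tau_gt0 m.+1) t0.
rewrite /refsol -/h hm in ip1 ip2 *.
set n := step_index _ t in ip1 *; set n' := step_index _ t in ip2 *.
(* One time step at level [m] is four at level [m.+1]; rounding of [t] leaves at most three more. *)
have [p [np p3]] : exists p, n' = (n.*2.*2 + p)%N /\ (p <= 3)%N.
  have lh : 0 < lambda * h by rewrite mulr_gt0.
  have a1 : (n.*2.*2 <= n')%N.
    rewrite -ltnS -(ltr_nat R) -(ltr_pM2r lh); apply: le_lt_trans (proj2 (andP ip2)).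
    by rewrite -!mul2n !natrM; case/andP: ip1 => + _; lra.
  have a2 : (n' < n.*2.*2 + 4)%N.
    rewrite -(ltr_nat R) -(ltr_pM2r lh); apply: le_lt_trans (proj1 (andP ip2)) _.
    rewrite natrD -!mul2n !natrM; case/andP: ip1 => _; rewrite -natr1; lra.
  by exists (n' - n.*2.*2)%N; clear - a1 a2; split; lia.
have [Ka Kb] := local_scheme_steps (n.*2.*2) p h0.
have K0 : 0 < (2 ^ m)%:R :> R by rewrite ltr0n expn_gt0.
(* With [K * K * h = 1 / 4], the translation cost [K * h] and the accumulated error [n * h / K] are
   both of order [2 ^ -m]. *)
pose K := (2 ^ m)%N.
have KE : K%:R = 2 ^+ m :> R by rewrite /K natrX.
have hK2 : h * (K%:R * K%:R) = 4^-1.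
  rewrite /h /mesh KE -exprMn exprS mulrAC -mulrA -exprMn.
  by rewrite (_ : 2 * 2 / 4 = 1 :> R) ?expr1n ?mulr1//; field.
have nt : n%:R * h <= t / lambda / 4.
  have : n%:R * (lambda * (2 * (2 * h))) <= t by case/andP: ip1.
  by rewrite !ler_pdivlMr//; lra.
have h20 : 0 < 2 * h by rewrite mulr_gt0.
have r1 := local_scheme_refine hV l0 cfl ff fT K h20 n.
have r2 := local_scheme_refine hV l0 cfl ff fT K h0 n.*2.
pose U0 := local_scheme V lambda (2 * (2 * h)) f n.
pose U1 := local_scheme V lambda (2 * h) f n.*2.
pose U2 := local_scheme V lambda h f n.*2.*2.
pose U3 := local_scheme V lambda h f (n.*2.*2 + p)%N.
rewrite -/U0 -/U1 -/U2 -/U3 in r1 r2 Ka Kb *.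
have h40 : 0 < 2 * (2 * h) by rewrite mulr_gt0.
have L01 : L1 (fun x => U0 x - U1 x).
  apply: L1_eq (local_scheme_diff_L1 hV l0 cfl ff fT n n.*2 0 h40 h20) => x.
  by rewrite addr0.
have L12 : L1 (fun x => U1 x - U2 x).
  apply: L1_eq (local_scheme_diff_L1 hV l0 cfl ff fT n.*2 n.*2.*2 0 h20 h0) => x.
  by rewrite addr0.
rewrite np -/U3; have L03 : L1 (fun x => U3 x - U0 x).
  apply: L1_eq (L1B (L1B Ka L12) L01) => x; ring.
split => //.
have J3 : J (fun x => `|U3 x - U0 x|) <= J (fun x => `|U3 x - U2 x|) +
   J (fun x => `|U1 x - U2 x|) + J (fun x => `|U0 x - U1 x|).
  rewrite -J_D; [|exact: L1_abs|exact: L1_abs].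
  rewrite -J_D; [|by apply: L1D; exact: L1_abs|exact: L1_abs].
  apply: J_le; [exact: L1_abs|by apply: L1D; [apply: L1D|]; exact: L1_abs|move=> x].
  rewrite (distrC (U1 x)) (distrC (U0 x)).
  by rewrite (le_trans (ler_distD (U1 x) _ _))// lerD2r ler_distD.
have KJ : K%:R * J (fun x => `|U3 x - U0 x|) <= (5 + 40 * (t / lambda)) * T.
  apply: (le_trans (ler_wpM2l (ltW K0) J3)); rewrite !mulrDr.
  have Tp := T0.
  (* The contributions free of [t] are [T], [T / 2] and [3 * T], together below [5 * T]; each of the
     two refinements adds [20 * (t / lambda) * T]. *)
  have b1 : 2 * (K%:R * (K%:R * (2 * h) * T)) = T.
    rewrite (_ : 2 * _ = 4 * (h * (K%:R * K%:R)) * T); last by ring.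
    by rewrite hK2 divff ?mul1r.
  have b2 : 2 * (K%:R * (K%:R * h * T)) = T / 2.
    rewrite (_ : 2 * _ = 2 * (h * (K%:R * K%:R)) * T); last by ring.
    by rewrite hK2; field.
  have ntT : n%:R * h * T <= t / lambda / 4 * T by rewrite ler_wpM2r.
  have b3 : n%:R * (40 * (2 * h * T)) <= 20 * (t / lambda) * T by lra.
  have b4 : n.*2%:R * (40 * (h * T)) <= 20 * (t / lambda) * T.
    by rewrite -mul2n natrM; lra.
  have b5 : K%:R * J (fun x => `|U3 x - U2 x|) <= 3 * T.
    apply: (@le_trans _ _ (K%:R * (3 * (h * T)))).
      rewrite ler_wpM2l ?(ltW K0)//; apply: (le_trans Kb).
      by rewrite ler_wpM2r ?ler_nat// mulr_ge0// ltW.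
    have : K%:R * h * (3 * T) <= 1 * (3 * T).
      rewrite ler_wpM2r ?mulr_ge0//.
      have K1 : 1 <= K%:R :> R by rewrite ler1n expn_gt0.
      have Kh : 0 <= K%:R * h by rewrite mulr_ge0 ?(ltW h0)// ltW.
      have : K%:R * h * 1 <= K%:R * h * K%:R by rewrite ler_wpM2l.
      lra.
    lra.
  lra.
by rewrite exprVn -KE ler_pdivlMr// mulrC.
Qed.

(** At every point the upper limit differs from [refsol m] by at most the sum of all later
    increments, trivially so where this sum is infinite. Termwise integration of the series leaves a
    geometric sum. *)
Lemma limsol_refsol m t : 0 <= t ->
  L1 (fun x => limsol t x - refsol m t x) /\
  J (fun x => `|limsol t x - refsol m t x|) <=
    2 * ((5 + 40 * (t / lambda)) * T) * 2^-1 ^+ m.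
Proof.
move=> t0; set C := (5 + 40 * (t / lambda)) * T.
have C0 : 0 <= C.
  by rewrite mulr_ge0 ?T0// addr_ge0// mulr_ge0// divr_ge0// ltW.
pose d k x := `|refsol (m + k).+1 t x - refsol (m + k) t x|.
have md k : measurable_fun [set: R] (d k).
  by apply: measurableT_comp => //; apply: measurable_funB;
    [exact: (refsol_field _ _).1|exact: (refsol_field _ _).1].
have d0 k x : 0 <= d k x by exact: normr_ge0.
have pw x : (`|limsol t x - refsol m t x|%:E <= \sum_(k <oo) (d k x)%:E)%E.
  set S := (\sum_(k <oo) (d k x)%:E)%E.
  have part k : ((\sum_(i < k) d i x)%:E <= S)%E.
    rewrite -sumEFin -(big_mkord xpredT (fun i => (d i x)%:E)).
    by apply: nneseries_lim_ge => i _; rewrite lee_fin.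
  have S0 : (0 <= S)%E by have := part 0%N; rewrite big_ord0.
  case: S part S0 => [s| |] part S0 //; last by rewrite leey.
  rewrite lee_fin.
  have step k : `|refsol (m + k) t x - refsol m t x| <= \sum_(i < k) d i x.
    elim: k => [|k IH]; first by rewrite addn0 subrr normr0 big_ord0.
    rewrite big_ord_recr/= addnS addrC.
    by apply: le_trans (lerD (lexx _) IH); exact: ler_distD.
  rewrite ler_distl; apply: (limn_sup_itv (m := m)) => [j|j mj].
    exact: (refsol_field j t).2.
  rewrite -ler_distl -(subnKC mj); apply: (le_trans (step _)).
  by rewrite -lee_fin.
have Id k : (\int[mu]_x (d k x)%:E <= (C * 2^-1 ^+ (m + k))%:E)%E.
  have [a b] := refsol_step (m + k) t0.
  by rewrite (J_E (L1_abs a)) lee_fin.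
have tot : (\int[mu]_x `|limsol t x - refsol m t x|%:E <= (2 * C * 2^-1 ^+ m)%:E)%E.
  apply: (@le_trans _ _ (\int[mu]_x (\sum_(k <oo) (d k x)%:E))%E).
    apply: ge0_le_integral => //.
    - apply/measurable_EFinP; apply: measurableT_comp => //; apply: measurable_funB.
        exact: (limsol_field t).1.
      exact: (refsol_field m t).1.
    - apply: ge0_emeasurable_sum => [k x _ _|k _]; first by rewrite lee_fin.
      by apply/measurable_EFinP; exact: md.
  rewrite integral_nneseries//; last 2 first.
  - by move=> k; apply/measurable_EFinP; exact: md.
  - by move=> k x _; rewrite lee_fin.
  apply: (@le_trans _ _ (\sum_(k <oo) (C * 2^-1 ^+ (m + k))%:E)%E).
    by apply: lee_nneseries => [k _ _|k _]; [apply: integral_ge0 => x _; rewrite lee_fin|exact: Id].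
  apply: lime_le.
    by apply: is_cvg_nneseries => k _ _; rewrite lee_fin mulr_ge0// exprn_ge0.
  apply: nearW => n; rewrite sumEFin lee_fin.
  suff -> : \sum_(0 <= i < n) C * 2^-1 ^+ (m + i) = 2 * C * 2^-1 ^+ m * (1 - 2^-1 ^+ n).
    apply: ler_piMr; first by rewrite mulr_ge0 ?exprn_ge0// mulr_ge0.
    by rewrite gerBl exprn_ge0.
  elim: n => [|n IH]; first by rewrite big_geq// expr0 subrr mulr0.
  by rewrite big_nat_recr//= IH exprD exprS; field.
have mm : measurable_fun [set: R] (fun x => limsol t x - refsol m t x).
  by apply: measurable_funB; [exact: (limsol_field t).1|exact: (refsol_field m t).1].
have [a b] := J_ge0_le (measurableT_comp (@normr_measurable R setT) mm) (fun x => normr_ge0 _) tot.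
by split => //; apply: (L1_le mm _ a) => x /=.
Qed.

(** Between [s] and [t] the scheme makes [(t - s) / (lambda * mesh m)] steps up to rounding, each
    costing [mesh m * T]; the rounding and the distance to the limit vanish with [m]. *)
Lemma limsol_time s t : 0 <= s <= t ->
  L1 (fun x => limsol t x - limsol s x) /\
  J (fun x => `|limsol t x - limsol s x|) <= (t - s) / lambda * T.
Proof.
move=> /andP[s0 st]; have t0 : 0 <= t by exact: le_trans st.
pose Cc r := 2 * ((5 + 40 * (r / lambda)) * T).
have step m : L1 (fun x => refsol m t x - refsol m s x) /\
    J (fun x => `|refsol m t x - refsol m s x|) <= ((t - s) / lambda + mesh m) * T.
  have h0 := mesh_gt0 m.
  have /andP[a1 a2] := step_indexP (tau_gt0 m) s0.
  have /andP[b1 b2] := step_indexP (tau_gt0 m) t0.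
  rewrite /refsol; set n := step_index _ s in a1 a2 *; set n' := step_index _ t in b1 b2 *.
  have nn' : (n <= n')%N.
    rewrite /n /n' /step_index; apply: le_truncn; rewrite ler_wpM2r// invr_ge0.
    by rewrite ltW// tau_gt0.
  have [a b] := local_scheme_steps n (n' - n) h0; rewrite subnKC// in a b.
  split => //; apply: (le_trans b); rewrite mulrA ler_wpM2r ?T0//.
  rewrite -lerBlDr ler_pdivlMr// natrB//.
  by move: a2; rewrite -natr1; lra.
have L m : L1 (fun x => limsol t x - limsol s x) /\
    J (fun x => `|limsol t x - limsol s x|) <=
    (t - s) / lambda * T + (Cc t + Cc s + T) * 2^-1 ^+ m.
  have [a b] := limsol_refsol m t0; have [c e] := limsol_refsol m s0.
  have [g i] := step m.
  have hL : L1 (fun x => limsol t x - limsol s x).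
    by apply: L1_eq (L1B (L1D a g) c) => x; ring.
  split => //.
  have : J (fun x => `|limsol t x - limsol s x|) <=
      J (fun x => `|limsol t x - refsol m t x|) + J (fun x => `|refsol m t x - refsol m s x|) +
      J (fun x => `|limsol s x - refsol m s x|).
    rewrite -J_D; [|exact: L1_abs|exact: L1_abs].
    rewrite -J_D; [|by apply: L1D; exact: L1_abs|exact: L1_abs].
    apply: J_le; [exact: L1_abs|by apply: L1D; [apply: L1D|]; exact: L1_abs|move=> x].
    rewrite (distrC (limsol s x)).
    by rewrite (le_trans (ler_distD (refsol m s x) _ _))// lerD2r ler_distD.
  have hm : mesh m * T <= T * 2^-1 ^+ m.
    rewrite mulrC ler_wpM2l ?T0// /mesh lerXn2r ?nnegrE//; lra.
  rewrite -/(Cc t) in b; rewrite -/(Cc s) in e; lra.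
split; first exact: (L 0%N).1.
apply/ler_addgt0Pr => e e0; have [m hm] := half_pow_small (Cc t + Cc s + T) e0.
by apply: (le_trans (L m).2); rewrite lerD2l.
Qed.

End LimitSolution.

(** * Space-time integrals and test functions *)

Section BoxFunctions.
Context {R : realType}.
Notation mu := (@lebesgue_measure R).
Notation J f := (\int[@lebesgue_measure R]_x f x).

Lemma measurable_cells2 (h : R) (u : int -> R -> R) : 0 < h ->
  (forall j, measurable_fun [set: R] (u j)) ->
  measurable_fun [set: R * R] (fun z => u (cell_index h z.1) z.2).
Proof.
move=> h0 mu_ _ Y mY; rewrite setTI.
have -> : (fun z : R * R => u (cell_index h z.1) z.2) @^-1` Y =
  \bigcup_(j in [set: int]) (`[(j%:~R - 2^-1) * h, (j%:~R + 2^-1) * h[%classic `*` (u j @^-1` Y)).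
  apply/seteqP; split => [[t x] /= Yt|[t x] [j _ [/=]]].
    exists (cell_index h t) => //=; split => //=.
    by rewrite in_itv/=; exact: cell_indexP.
  by rewrite in_itv/= => /(cell_index_unique h0) ->.
apply: countable_bigcupT_measurable => // j; apply: measurableX => //.
by rewrite -[X in measurable X]setTI; exact: mu_.
Qed.

Lemma continuous_pairr (t : R) : continuous (fun x : R => (t, x)).
Proof. by move=> x; exact: (@cvg_pair _ _ _ (nbhs x) (nbhs t) (nbhs x) _ _ _ _ _ (cvg_cst t) cvg_id). Qed.

Lemma continuous_pairl (x : R) : continuous (fun t : R => (t, x)).
Proof. by move=> t; exact: (@cvg_pair _ _ _ (nbhs t) (nbhs t) (nbhs x) _ _ _ _ _ cvg_id (cvg_cst x)). Qed.

(** Freezing the first variable on a grid of mesh [2 ^ -m] leaves countably many measurable pieces,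
    and these approximations converge pointwise. *)
Lemma continuous_measurable2 (f : R * R -> R) : continuous f ->
  measurable_fun [set: R * R] f.
Proof.
move=> cf; pose h m : R := 2^-1 ^+ m.
have h0 m : 0 < h m by rewrite exprn_gt0.
apply: (measurable_fun_cvg
  (h := fun m (z : R * R) => f ((cell_index (h m) z.1)%:~R * h m, z.2))).
  move=> m; apply: (measurable_cells2 (u := fun j x => f (j%:~R * h m, x))) => // j.
  apply: continuous_measurable_fun => x.
  apply: (continuous_comp (f := fun x : R => (j%:~R * h m, x))); last exact: cf.
  exact: continuous_pairr.
move=> [t x] _ /=.
apply: (@cvg_comp _ _ _ (fun m => ((cell_index (h m) t)%:~R * h m, x)) f _ (nbhs (t, x))); last exact: cf.
apply: (@cvg_pair _ _ _ \oo (nbhs t) (nbhs x) _ _ _ (fun m => (cell_index (h m) t)%:~R * h m) (fun=> x));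
  last exact: cvg_cst.
apply/cvgrPdist_le => e e0; have [m0 hm0] := half_pow_small 1 e0.
exists m0 => // m /= m0m; have /andP[a b] := cell_indexP t (h0 m).
have hm : h m <= e.
  apply: le_trans hm0; rewrite mul1r /h; apply: ler_wiXn2l => //; lra.
have := h0 m; rewrite ler_norml => h0m; apply/andP; split; lra.
Qed.

(** The integrands for which iterated integrals are finite and additive; a single [M] bounds both
    the values and the support. *)
Definition box (G : R -> R -> R) : Prop :=
  measurable_fun [set z : R * R | 0 <= z.1] (fun z : R * R => G z.1 z.2) /\
  exists M, forall t x, 0 <= t ->
    `|G t x| <= M /\ (M < t \/ M < `|x| -> G t x = 0).

(* Cuts off negative times, where space-time functions are arbitrary. *)
Definition halfline (t : R) : R := (0 <= t)%R%:R.

Lemma measurable_halfplane : measurable [set z : R * R | 0 <= z.1].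
Proof.
rewrite [X in measurable X](_ : _ = (`[0, +oo[%classic : set R) `*` [set: R]).
  by apply: measurableX.
by apply/seteqP; split => [[t x]|[t x] []] /=; rewrite in_itv/= andbT.
Qed.

Lemma measurable_halfline (G : R -> R -> R) :
  measurable_fun [set z : R * R | 0 <= z.1] (fun z : R * R => G z.1 z.2) ->
  measurable_fun [set: R * R] (fun z : R * R => halfline z.1 * G z.1 z.2).
Proof.
move=> mG; have := (measurable_restrictT (fun z : R * R => G z.1 z.2) measurable_halfplane).1 mG.
apply: eq_measurable_fun => -[t x] _; rewrite patchE /halfline /=.
case: ifPn; rewrite ?inE ?notin_setE /=; first by move=> ->; rewrite mul1r.
by move=> /negP/negbTE ->; rewrite mul0r.
Qed.

Lemma integral_indic_itv (a b : R) (b0 b1 : bool) : a <= b ->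
  (\int[mu]_x (\1_[set` Interval (BSide b0 a) (BSide b1 b)] x)%:E = (b - a)%:E)%E.
Proof.
move=> ab; rewrite integral_indic; last exact: measurable_itv.
  by rewrite setIT; exact: lebesgue_itv.
exact: measurableT.
Qed.

Lemma box_nonneg (P : R * R -> R) M : measurable_fun [set: R * R] P ->
  (forall z, 0 <= P z <= M) ->
  (forall z, M < `|z.1| \/ M < `|z.2| -> P z = 0) ->
  (forall t, L1 (fun x => P (t, x))) /\ L1 (fun t => J (fun x => P (t, x))).
Proof.
move=> mP P0 PM.
have M0 : 0 <= M by have /andP[a b] := P0 (0, 0); exact: le_trans b.
have I1 (c : R) : 0 <= c -> L1 (fun x => c * \1_(`[- M, M]) x).
  move=> c0; apply: L1Z; apply: (@L1_ge0 _ _ (M - - M)%:E) => //.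
    rewrite integral_indic_itv//; lra.
  exact: ltry.
have ind (x : R) : M < `|x| \/ \1_(`[- M, M]) x = 1 :> R.
  rewrite indicE; have [h|h] := ltP M `|x|; [by left|right].
  by rewrite mem_set//= in_itv/= -ler_norml.
have ind0 (x : R) : 0 <= \1_(`[- M, M]) x :> R by rewrite indicE.
have slice t : L1 (fun x => P (t, x)).
  apply: (L1_le _ _ (I1 M M0)).
    by apply: (measurableT_comp mP); exact: measurable_pair1.
  move=> x; have /andP[a b] := P0 (t, x); rewrite ger0_norm//.
  have [h|->] := ind x; last by rewrite mulr1.
  by rewrite PM ?mulr_ge0//=; right.
split=> //.
have mJ : measurable_fun [set: R] (fun t => J (fun x => P (t, x))).
  apply/measurable_EFinP.
  have := @measurable_fun_fubini_tonelli_F _ _ _ _ R mu (EFin \o P).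
  rewrite /fubini_F /= => m.
  apply: (eq_measurable_fun (fun t => \int[mu]_x (P (t, x))%:E)%E).
    by move=> t _; rewrite /= J_E.
  apply: m => [|z]; first by apply/measurable_EFinP.
  by rewrite lee_fin; case/andP: (P0 z).
apply: (L1_le mJ _ (I1 (M * (M - - M)) _)) => [t|]; last by rewrite mulr_ge0//; lra.
rewrite ger0_norm; last by apply: J_ge0 => x; case/andP: (P0 (t, x)).
have [h|->] := ind t.
  have -> : (fun x => P (t, x)) = (fun=> 0).
    by apply/funext => x; apply: PM; left.
  by rewrite Rintegral_cst// mul0r mulr_ge0// mulr_ge0//; lra.
rewrite mulr1; apply: (@le_trans _ _ (J (fun x => M * \1_(`[- M, M]) x))).
  apply: J_le => //; first exact: I1.
  move=> x; have /andP[a b] := P0 (t, x).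
  have [h|->] := ind x; last by rewrite mulr1.
  by rewrite PM ?mulr_ge0//=; right.
rewrite J_Z; last by have := I1 1 ler01; apply: L1_eq => x; rewrite mul1r.
rewrite ler_wpM2l// -lee_fin -J_E; last by have := I1 1 ler01; apply: L1_eq => x; rewrite mul1r.
rewrite integral_indic_itv//; lra.
Qed.

(** Measurability of the inner integral comes from Tonelli, which is applied to the positive and
    negative parts. *)
Lemma box_L1 G : box G ->
  (forall t, 0 <= t -> L1 (G t)) /\ L1 (fun t => halfline t * J (G t)).
Proof.
move=> [mG [M hM]].
pose Gp (z : R * R) := halfline z.1 * G z.1 z.2.
have mGp : measurable_fun [set: R * R] Gp by exact: measurable_halfline.
have Gpb z : `|Gp z| <= `|M| /\ (`|M| < `|z.1| \/ `|M| < `|z.2| -> Gp z = 0).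
  case: z => t x; rewrite /Gp /halfline /=; have [t0|t0] := leP 0 t; last first.
    by rewrite !mul0r normr0.
  have [a b] := hM t x t0; rewrite !mul1r; split.
    exact: le_trans (ler_norm M).
  rewrite (ger0_norm t0) => h; apply: b; have := ler_norm M.
  by case: h => h; [left|right]; apply: le_lt_trans h.
have [p1 p2] : (forall t, L1 (fun x => Num.max (Gp (t, x)) 0)) /\
    L1 (fun t => J (fun x => Num.max (Gp (t, x)) 0)).
  apply: (@box_nonneg (fun z => Num.max (Gp z) 0) `|M|).
  - by apply: measurable_maxr => //; exact: measurable_cst.
  - move=> z; rewrite le_max lexx orbT ge_max normr_ge0 andbT.
    by rewrite (le_trans (ler_norm _) (Gpb z).1).
  - by move=> z h; rewrite (Gpb z).2// maxxx.
have [m1 m2] : (forall t, L1 (fun x => Num.max (- Gp (t, x)) 0)) /\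
    L1 (fun t => J (fun x => Num.max (- Gp (t, x)) 0)).
  apply: (@box_nonneg (fun z => Num.max (- Gp z) 0) `|M|).
  - by apply: measurable_maxr; [exact: measurable_funN|exact: measurable_cst].
  - move=> z; rewrite le_max lexx orbT ge_max normr_ge0 andbT.
    by rewrite (le_trans _ (Gpb z).1)// -normrN ler_norm.
  - by move=> z h; rewrite (Gpb z).2// oppr0 maxxx.
have pm z : Num.max (Gp z) 0 - Num.max (- Gp z) 0 = Gp z.
  have [h|h] := leP (Gp z) 0.
    by rewrite max_l ?oppr_ge0// sub0r opprK.
  by rewrite max_r ?subr0// oppr_le0 ltW.
split=> [t t0|].
  apply: L1_eq (L1B (p1 t) (m1 t)) => x /=; rewrite pm /Gp /halfline /= t0 mul1r//.
apply: L1_eq (L1B p2 m2) => t; rewrite -J_B//.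
under eq_Rintegral => x _ do rewrite pm.
rewrite /Gp /halfline /=; have [t0|t0] := leP 0 t.
  by rewrite mul1r; apply: eq_Rintegral => x _; rewrite mul1r.
by under eq_Rintegral do rewrite mul0r; rewrite Rintegral_cst// !mul0r.
Qed.

Lemma box_integral G : box G ->
  (\int[mu]_(t in `[0%R, +oo[) \int[mu]_x (G t x)%:E =
   (J (fun t => halfline t * J (G t)))%:E)%E.
Proof.
move=> bG; have [a b] := box_L1 bG; rewrite -(J_E b).
rewrite [LHS]integral_mkcond; apply: eq_integral => t _; rewrite patchE /halfline.
rewrite mem_setE in_itv/= andbT; case: ifPn => t0.
  by rewrite mul1r (J_E (a t t0)).
by rewrite mul0r.
Qed.

End BoxFunctions.

(** * Test functions and the weak entropy inequality *)

Section TestFunctions.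
Context {R : realType}.
Notation mu := (@lebesgue_measure R).
Implicit Types phi : R -> R -> R.

Definition supported (f : R -> R -> R) M : Prop :=
  forall t x, M < `|t| \/ M < `|x| -> f t x = 0.

Lemma test_function_support phi : test_function phi -> exists M,
  [/\ supported phi M, supported (dt phi) M & supported (dx phi) M].
Proof.
move=> [_ cphi _]; have [M [_ hM]] := compact_bounded cphi.
pose N := `|M| + 1.
have out (z : R * R) : N < `|z.1| \/ N < `|z.2| -> \forall w \near z, phi w.1 w.2 = 0.
  move=> hz; have ncl : ~ closure [set z : R * R | phi z.1 z.2 != 0] z.
    have MN : M < N by rewrite /N (le_lt_trans (ler_norm M))// ltrDl.
    move=> /(hM N MN) /=; rewrite prod_normE ge_max => /andP[h1 h2].
    by case: hz; rewrite ltNge ?h1 ?h2.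
  have : nbhs z (~` closure [set z : R * R | phi z.1 z.2 != 0]).
    by apply: open_nbhs_nbhs; split => //; apply: closed_openC; exact: closed_closure.
  apply: filterS => w hw; apply/eqP/negPn/negP => h; apply: hw.
  exact: subset_closure.
exists N; split => t x h.
- by have /nbhs_singleton := out (t, x) h.
- rewrite /dt derive1E -(derive_cst (0 : R) (t : R) (1 : R)).
  apply: near_eq_derive.
  by have /(_ _ (out (t, x) h)) := @continuous_pairl R x t.
- rewrite /dx derive1E -(derive_cst (0 : R) (x : R) (1 : R)).
  apply: near_eq_derive.
  by have /(_ _ (out (t, x) h)) := @continuous_pairr R t x.
Qed.

Lemma supported_uniform (f : R -> R -> R) M e : continuous (fun z : R * R => f z.1 z.2) ->
  supported f M -> 0 < e -> exists2 d, 0 < d & forall t x s y,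
    `|t - s| < d -> `|x - y| < d -> `|f t x - f s y| < e.
Proof.
move=> cf sf e0.
pose K := (`[- M, M]%classic : set R) `*` (`[- M, M]%classic : set R).
have cK : compact K by apply: compact_setX; exact: segment_compact.
pose P (d : R) (z : R * R) := forall w, ball z d w -> `|f z.1 z.2 - f w.1 w.2| < e.
have /(_ R (0^'+) P) := (compact_near_coveringP K).1 cK.
case.
  move=> z _.
  have /cvgrPdist_lt /(_ _ (divr_gt0 e0 (ltr0n R 2))) := cf z.
  move=> /nbhs_ballP [r /= r0 hr].
  exists (ball z (r / 2), [set d | 0 < d < r / 2]).
    split; first by apply: nbhsx_ballx; rewrite divr_gt0.
    near=> d => /=; apply/andP; split; near: d; first exact: nbhs_right_gt.
    by apply: nbhs_right_lt; rewrite divr_gt0.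
  move=> [z' d] /= [bz /andP[d0 dr]] w bw.
  have h1 : `|f z.1 z.2 - f z'.1 z'.2| < e / 2.
    by apply: hr; apply: le_ball bz; lra.
  have h2 : `|f z.1 z.2 - f w.1 w.2| < e / 2.
    apply: hr; rewrite (_ : r = r / 2 + r / 2); last by lra.
    apply: ball_triangle bz _; apply: le_ball bw; exact: ltW.
  by move: h1 h2; rewrite !ltr_norml => /andP[? ?] /andP[? ?]; apply/andP; split; lra.
move=> d /= d0 hd; have dd : 0 < d / 2 by rewrite divr_gt0.
have {}hd : K `<=` P (d / 2).
  apply: hd => //=; rewrite sub0r normrN gtr0_norm//; lra.
exists (d / 2) => // t x s y ts xy.
have inK a b : `|a| <= M -> `|b| <= M -> K (a, b).
  by move=> ha hb; split; rewrite /= in_itv/= -ler_norml.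
have [ht|ht] := leP `|t| M; have [hx|hx] := leP `|x| M.
- by have := hd (t, x) (inK _ _ ht hx) (s, y) (conj ts xy).
all: have -> : f t x = 0 by apply: sf; tauto.
all: have [hs|hs] := leP `|s| M; have [hy|hy] := leP `|y| M.
all: try by rewrite [f s y]sf ?subrr ?normr0//; tauto.
all: rewrite distrC in ts; rewrite distrC in xy.
all: have := hd (s, y) (inK _ _ hs hy) (t, x) (conj ts xy).
all: by rewrite /= (sf t x) ?subr0 ?sub0r ?normrN//; tauto.
Unshelve. all: by end_near.
Qed.

Lemma supported_bounded (f : R -> R -> R) M : continuous (fun z : R * R => f z.1 z.2) ->
  supported f M -> exists C, 0 <= C /\ forall t x, `|f t x| <= C.
Proof.
move=> cf sf.
pose K := (`[- M, M]%classic : set R) `*` (`[- M, M]%classic : set R).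
have cK : compact K by apply: compact_setX; exact: segment_compact.
have : compact ((fun z : R * R => f z.1 z.2) @` K).
  by apply: continuous_compact => //; apply: continuous_subspaceT.
move=> /compact_bounded [C [_ hC]]; exists (`|C| + 1); split; first exact: addr_ge0.
move=> t x; have [ht|ht] := leP `|t| M; have [hx|hx] := leP `|x| M.
- apply: (hC (`|C| + 1)); first by rewrite (le_lt_trans (ler_norm C))// ltrDl.
  by exists (t, x) => //; split; rewrite /= in_itv/= -ler_norml.
all: by rewrite sf ?normr0 ?addr_ge0//; tauto.
Qed.

Lemma entropy_box (u : R -> R -> R) (V : R -> R) (vM lV k : R) phi : velocity V vM lV ->
  measurable_fun [set z : R * R | 0 <= z.1] (fun z : R * R => u z.1 z.2) ->
  (forall t x, 0 <= t -> 0 <= u t x <= 1) -> 0 <= k <= 1 -> test_function phi ->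
  box (fun t x => `|u t x - k| * dt phi t x + kflux V (u t x) k * dx phi t x).
Proof.
move=> hV mu_ u01 k01 tphi; have [M [s1 s2 s3]] := test_function_support tphi.
have [[_ _ c2 c3] _ _] := tphi.
have [A [A0 hA]] := supported_bounded c2 s2; have [B [B0 hB]] := supported_bounded c3 s3.
have mdt := continuous_measurable2 c2; have mdx := continuous_measurable2 c3.
split.
  have mV : measurable_fun [set z : R * R | 0 <= z.1] (fun z : R * R => V (u z.1 z.2)).
    apply: (measurable_velocity hV measurable_halfplane mu_) => z /= z0; exact: u01.
  apply: measurable_funD; apply: measurable_funM.
  - by apply: measurableT_comp => //; apply: measurable_funB.
  - exact: measurable_funTS.
  - rewrite /kflux; apply: measurable_funB; apply: measurable_funM => //.
      by apply: measurableT_comp => //; apply: measurable_funB.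
    by apply: measurableT_comp => //; apply: measurable_funB.
  - exact: measurable_funTS.
exists (Num.max M (A + 2 * (vM + lV) * B)) => t x t0; split; last first.
  move=> h; rewrite s2 ?s3 ?mulr0 ?addr0//; rewrite (ger0_norm t0).
    by move: h; rewrite !gt_max => -[/andP[]|/andP[]]; tauto.
  by move: h; rewrite !gt_max => -[/andP[]|/andP[]]; tauto.
rewrite le_max; apply/orP; right; apply: (le_trans (ler_normD _ _)); rewrite !normrM normr_id.
have /andP[a b] := u01 t x t0.
have uk : `|u t x - k| <= 1 by rewrite ler_norml; lra.
have q : `|kflux V (u t x) k| <= 2 * (vM + lV).
  have hV' := hV; have [? ? _ _] := hV'.
  have := kflux_lip hV (u01 t x t0) k01 k01; rewrite [kflux V k k]/kflux !subrr !normr0 !mulr0 !subr0.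
  by move=> /le_trans; apply; rewrite -[leRHS]mulr1 ler_wpM2l// mulr_ge0// addr_ge0.
apply: lerD; first by rewrite -[leRHS]mul1r ler_pM.
by rewrite ler_pM.
Qed.

(** Brings the extended real expression of the definition to real integrals with [kflux], so that
    finitely many entropy inequalities can be added linearly. *)
Lemma entropy_solutionE (u : R -> R -> R) (V u0 : R -> R) (vM lV : R) : velocity V vM lV ->
  measurable_fun [set: R] u0 -> (forall x, 0 <= u0 x <= 1) ->
  measurable_fun [set z : R * R | 0 <= z.1] (fun z : R * R => u z.1 z.2) ->
  (forall t x, 0 <= t -> 0 <= u t x <= 1) ->
  forall k phi, 0 <= k <= 1 -> test_function phi ->
  L1 (fun x => `|u0 x - k| * phi 0 x) /\
  (\int[mu]_(t in `[0%R, +oo[) \int[mu]_x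
     (`|u t x - k| * dt phi t x
      + Num.sg (u t x - k) * (u t x * V (u t x) - k * V k) * dx phi t x)%:E
   + \int[mu]_x (`|u0 x - k| * phi 0 x)%:E =
   (\int[mu]_t (halfline t * \int[mu]_x
       (`|u t x - k| * dt phi t x + kflux V (u t x) k * dx phi t x))
    + \int[mu]_x (`|u0 x - k| * phi 0 x))%:E)%E.
Proof.
move=> hV mu0 u0b mu_ u01 k phi k01 tphi.
have bx := entropy_box hV mu_ u01 k01 tphi.
have [M [s1 _ _]] := test_function_support tphi; have [[_ c1 _ _] _ _] := tphi.
have hL : L1 (fun x => `|u0 x - k| * phi 0 x).
  have [A [A0 hA]] := supported_bounded c1 s1.
  apply: (@L1_le _ _ (fun x => A * \1_(`[- `|M|, `|M|]) x)).
  - apply: measurable_funM; first by apply: measurableT_comp => //; apply: measurable_funB.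
    apply: continuous_measurable_fun => x.
    apply: (continuous_comp (f := fun x : R => (0 : R, x)) (g := fun z : R * R => phi z.1 z.2)); last exact: c1.
    exact: continuous_pairr.
  - move=> x; rewrite normrM normr_id indicE.
    have [h|h] := leP `|x| `|M|; last first.
      by rewrite s1 ?normr0 ?mulr0 ?mulr_ge0//; right; apply: le_lt_trans h; exact: ler_norm.
    rewrite mem_set ?mulr1/= ?in_itv/= -?ler_norml//.
    have /andP[a b] := u0b x; rewrite -[leRHS]mul1r ler_pM// ler_norml; lra.
  apply: L1Z; apply: (@L1_ge0 _ _ (`|M| - - `|M|)%:E) => //; last exact: ltry.
  by rewrite integral_indic_itv//; have := normr_ge0 M; lra.
split => //; rewrite EFinD -(J_E hL); congr (_ + _)%E.
rewrite -(box_integral bx); apply: eq_integral => t; rewrite inE/= in_itv/= andbT => t0.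
by apply: eq_integral => x _; rewrite (kfluxE hV)//; exact: u01.
Qed.

End TestFunctions.

(** * The limit is an entropy solution *)

Section StepIntegral.
Context {R : realType}.
Notation J f := (\int[@lebesgue_measure R]_x f x).

Lemma L1_indic_itv (a b : R) (b0 b1 : bool) : a <= b ->
  L1 (\1_[set` Interval (BSide b0 a) (BSide b1 b)] : R -> R).
Proof.
move=> ab; apply: (@L1_ge0 _ _ (b - a)%:E) => //; last exact: ltry.
by rewrite integral_indic_itv.
Qed.

Lemma J_indic_itv (a b : R) (b0 b1 : bool) : a <= b ->
  J (fun x => \1_[set` Interval (BSide b0 a) (BSide b1 b)] x) = b - a.
Proof.
by move=> ab; apply: EFin_inj; rewrite -J_E ?integral_indic_itv//; exact: L1_indic_itv.
Qed.

Lemma L1_bounded (g : R -> R) (A M : R) : measurable_fun [set: R] g ->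
  (forall x, `|g x| <= A) -> (forall x, M < `|x| -> g x = 0) -> L1 g.
Proof.
move=> mg gA gM.
apply: (L1_le mg (g := fun x => A * \1_(`[- `|M|, `|M|]) x)).
  move=> x; rewrite indicE; have [h|h] := leP `|x| `|M|.
    by rewrite mem_set ?mulr1//= in_itv/= -ler_norml.
  rewrite gM ?normr0 ?mulr_ge0 ?(le_trans _ (gA 0))//.
  by apply: le_lt_trans h; exact: ler_norm.
apply/L1Z/L1_indic_itv; have := normr_ge0 M; lra.
Qed.

(** Bridge from sums over time steps to a time integral: the bound on [a n] must hold at every time
    of step [n] and is averaged over that step, so [g] is never evaluated at particular times. *)
Lemma steps_le_integral (g : R -> R) (tau : R) (N : nat) (a : nat -> R) : 0 < tau -> L1 g ->
  (forall n t, (n < N)%N -> n%:R * tau <= t < n.+1%:R * tau -> a n <= tau * g t) ->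
  (forall t, t < 0 \/ N%:R * tau <= t -> 0 <= g t) ->
  \sum_(n < N) a n <= J g.
Proof.
move=> tau0 Lg ag g0.
pose I n := `[n%:R * tau, n.+1%:R * tau[%classic : set R.
have In n : n%:R * tau <= n.+1%:R * tau by rewrite ler_pM2r// ler_nat.
have -> : \sum_(n < N) a n = J (fun t => \sum_(n < N) (a n / tau) * \1_(I n) t).
  rewrite (J_sum _ (F := fun n t => a n / tau * \1_(I n) t)); last first.
    by move=> n; exact/L1Z/L1_indic_itv.
  apply: eq_bigr => n _; rewrite J_Z; last exact: L1_indic_itv.
  by rewrite J_indic_itv// -mulrBl -natrB// subSnn mul1r divfK ?gt_eqF.
apply: J_le => //.
  by apply: (@L1_sum R N (fun n t => a n / tau * \1_(I n) t)) => n; exact/L1Z/L1_indic_itv.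
move=> t; have [t0|t0] := ltP t 0.
  rewrite big1 ?g0//; first by left.
  move=> n _; rewrite indicE memNset ?mulr0//= /I/= in_itv/= => /andP[h _].
  have : 0 <= n%:R * tau by rewrite mulr_ge0// ltW.
  lra.
have st := step_indexP tau0 t0; set n := step_index tau t in st.
have uniq i : i != n -> \1_(I i) t = 0 :> R.
  move=> /eqP ni; rewrite indicE memNset//= /I/= in_itv/= => /andP[h1 h2].
  case/andP: st => s1 s2; apply: ni.
  have : i%:R * tau < n.+1%:R * tau by exact: le_lt_trans s2.
  have : n%:R * tau < i.+1%:R * tau by exact: le_lt_trans h2.
  by rewrite !ltr_pM2r// !ltr_nat => ? ?; lia.
have [nN|nN] := ltnP n N.
  rewrite (bigD1 (Ordinal nN))//= big1 => [|i]; last first.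
    by rewrite -val_eqE => /= ni; rewrite uniq ?mulr0.
  rewrite indicE mem_set/= /I/= ?in_itv//= mulr1 addr0 ler_pdivrMr// mulrC.
  exact: ag.
rewrite big1 => [|i _]; last by rewrite uniq ?mulr0// neq_ltn (leq_trans _ nN).
apply: g0; right; case/andP: st => s1 _; apply: le_trans s1.
by rewrite ler_pM2r// ler_nat.
Qed.

End StepIntegral.

Section TestIncrements.
Context {R : realType}.
Variable phi : R -> R -> R.
Hypothesis tphi : test_function phi.

Lemma test_incr_t (s t x : R) : s <= t ->
  exists2 r, s <= r <= t & phi t x - phi s x = dt phi r x * (t - s).
Proof.
move=> st; have [[d _ _ _] _ _] := tphi.
have [r|r|r rst e] := @MVT_segment R (fun s => phi s x) (fun s => dt phi s x) s t st.
- by move=> _; rewrite /dt derive1E; apply/derivableP; exact: (d r x).1.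
- by apply: derivable_within_continuous => y _; exact: (d y x).1.
- by exists r => //; move: rst; rewrite in_itv.
Qed.

Lemma test_incr_x (t x y : R) : x <= y ->
  exists2 r, x <= r <= y & phi t y - phi t x = dx phi t r * (y - x).
Proof.
move=> st; have [[d _ _ _] _ _] := tphi.
have [r|r|r rst e] := @MVT_segment R (phi t) (dx phi t) x y st.
- by move=> _; rewrite /dx derive1E; apply/derivableP; exact: (d t r).2.
- by apply: derivable_within_continuous => z _; exact: (d t z).2.
- by exists r => //; move: rst; rewrite in_itv.
Qed.

Lemma measurable_test (t s : R) : measurable_fun [set: R] (fun x => phi t (x + s)).
Proof.
have [[_ c _ _] _ _] := tphi.
have m : measurable_fun [set: R] (phi t).
  apply: continuous_measurable_fun => x.
  apply: (continuous_comp (f := fun x : R => (t, x)) (g := fun z : R * R => phi z.1 z.2)).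
    exact: continuous_pairr.
  exact: c.
by apply: (measurableT_comp m); exact: measurable_shift.
Qed.

Lemma L1_mul_test (a : R -> R) (A t s : R) : measurable_fun [set: R] a ->
  (forall x, `|a x| <= A) -> L1 (fun x => a x * phi t (x + s)).
Proof.
move=> ma aA; have [M [s1 _ _]] := test_function_support tphi.
have [[_ c _ _] _ _] := tphi; have [B [B0 hB]] := supported_bounded c s1.
apply: (@L1_bounded _ _ (A * B) (M + `|s|)).
- by apply: measurable_funM => //; exact: measurable_test.
- by move=> x; rewrite normrM ler_pM.
- move=> x h; rewrite s1 ?mulr0//; right; rewrite -ltrBrDr in h.
  by apply: (lt_le_trans h); rewrite lerBlDr; have := ler_normD (x + s) (- s); rewrite addrK normrN.
Qed.

End TestIncrements.

Lemma dist_lt_itv (R : realDomainType) (a b s t d : R) :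
  a <= s <= b -> a <= t <= b -> b - a < d -> `|s - t| < d.
Proof. by move=> ? ? ?; rewrite ltr_norml; apply/andP; split; lra. Qed.

Lemma far_of_far (R : realDomainType) (M x y h : R) :
  `|M| + 1 < `|x| -> `|x - y| <= h -> h < 1 -> M < `|y|.
Proof.
by move=> ? ? ?; have := ler_normD (x - y) y; rewrite subrK; have := ler_norm M; lra.
Qed.

Section LimitEntropy.
Context {R : realType}.
Notation J f := (\int[@lebesgue_measure R]_x f x).
Variables (V : R -> R) (vM lV lambda : R).
Hypotheses (hV : velocity V vM lV) (l0 : 0 < lambda) (cfl : lambda * (vM + lV) <= 1).
Variables (f : R -> R) (T : R).
Hypotheses (ff : field f) (fT : forall s,
  (\int[@lebesgue_measure R]_x `|f (x + s) - f x|%:E <= (`|s| * T)%:E)%E).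
Variables (k : R) (phi : R -> R -> R).
Hypotheses (k01 : 0 <= k <= 1) (tphi : test_function phi).

Let C := 2 * (vM + lV).
Let C0 : 0 <= C. Proof. by case: hV => *; rewrite /C; lra. Qed.
Let lV0 : 0 <= lV. Proof. by case: hV. Qed.

Lemma kflux_bound u w : 0 <= u <= 1 -> 0 <= w <= 1 -> `|kflux V u w| <= C.
Proof.
move=> u01 w01; have := kflux_lip hV u01 w01 w01.
rewrite [kflux V w w]/kflux !subrr !normr0 !mulr0 !subr0 => /le_trans; apply.
rewrite -[leRHS]mulr1 ler_wpM2l// ler_norml; lra.
Qed.

Definition entropy_slice (Z : R -> R) (t x : R) : R :=
  `|Z x - k| * dt phi t x + kflux V (Z x) k * dx phi t x.

Lemma entropy_slice_L1 Z t : field Z -> 0 <= t -> L1 (entropy_slice Z t).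
Proof.
move=> fZ t0; apply: (box_L1 (entropy_box (u := fun=> Z) hV _ _ k01 tphi)).1 => //.
  apply: measurable_funTS.
  by apply: (measurableT_comp (f := Z)) => //; exact: fZ.1.
by move=> *; exact: fZ.2.
Qed.

Lemma entropy_slice_diff : exists2 D, 0 <= D & forall Z Z' t, field Z -> field Z' -> 0 <= t ->
  L1 (fun x => Z x - Z' x) ->
  `|J (entropy_slice Z t) - J (entropy_slice Z' t)| <= D * J (fun x => `|Z x - Z' x|).
Proof.
have [M [s1 s2 s3]] := test_function_support tphi; have [[_ c1 c2 c3] _ _] := tphi.
have [A [A0 hA]] := supported_bounded c2 s2; have [B [B0 hB]] := supported_bounded c3 s3.
exists (A + C * B); first by rewrite addr_ge0// mulr_ge0.
move=> Z Z' t fZ fZ' t0 LZ; rewrite -J_B; [|exact: entropy_slice_L1|exact: entropy_slice_L1].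
have Ld : L1 (fun x => entropy_slice Z t x - entropy_slice Z' t x).
  by apply: L1B; exact: entropy_slice_L1.
apply: (le_trans (J_abs Ld)); rewrite -J_Z; last exact: L1_abs.
apply: J_le; [exact: L1_abs|exact/L1Z/L1_abs|move=> x].
rewrite (_ : _ - _ = (`|Z x - k| - `|Z' x - k|) * dt phi t x +
  (kflux V (Z x) k - kflux V (Z' x) k) * dx phi t x); last by rewrite /entropy_slice; ring.
apply: (le_trans (ler_normD _ _)); rewrite !normrM [leRHS]mulrDl; apply: lerD.
  rewrite mulrC ler_pM// (le_trans (ler_dist_dist _ _))//.
  by rewrite (_ : Z x - k - (Z' x - k) = Z x - Z' x)//; ring.
rewrite mulrAC ler_pM//; apply: kflux_lip => //; [exact: fZ.2|exact: fZ'.2].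
Qed.

(** The entropy inequality is tested with [phi] at the new time level. A translation moves the flux
    difference onto [phi], mean values turn increments of [phi] into derivatives at nearby points,
    and uniform continuity moves these to [(t, x)]. *)
Lemma discrete_test_step (e : R) : 0 < e -> exists2 d, 0 < d &
  forall h n t, 0 < h < d -> lambda * h < d ->
    n%:R * (lambda * h) <= t <= n.+1%:R * (lambda * h) ->
  let Z := local_scheme V lambda h f in
  L1 (fun x => `|Z n x - k| * phi (n%:R * (lambda * h)) x) /\
  J (fun x => `|Z n.+1 x - k| * phi (n.+1%:R * (lambda * h)) x) -
  J (fun x => `|Z n x - k| * phi (n%:R * (lambda * h)) x) <=
  lambda * h * (J (entropy_slice (Z n) t) + e).
Proof.
move=> e0; have [M [s1 s2 s3]] := test_function_support tphi.
have [[_ c1 c2 c3] _ phi0] := tphi.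
have [A [A0 hA]] := supported_bounded c2 s2; have [B [B0 hB]] := supported_bounded c3 s3.
have T0 : 0 <= T by exact: T_ge0 fT.
have M1 : 0 < `|M| + 1 by rewrite ltr_wpDl.
(* On an interval of length twice the modulus of [M] plus one, the oscillation errors then sum to
   [e / 2]; the extra one allows for the shift by [h < 1]. The last entry of [d] keeps the
   consistency error [lV * B * h * T] within the other half. *)
pose e' := e / (4 * (1 + C) * (`|M| + 1)).
have e'0 : 0 < e' by rewrite divr_gt0// mulr_gt0// mulr_gt0// ltr_wpDr.
have [d2 d20 hd2] := supported_uniform c2 s2 e'0.
have [d3 d30 hd3] := supported_uniform c3 s3 e'0.
pose d := Num.min (Num.min d2 d3) (Num.min 1 (e / (2 * (lV * B * T + 1)))).
have lBT : 0 <= lV * B * T by rewrite mulr_ge0// mulr_ge0.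
exists d; first by rewrite !lt_min d20 d30 ltr01/= divr_gt0// mulr_gt0// ltr_wpDl.
move=> h n t /andP[h0]; rewrite !lt_min => /andP[/andP[hh2 hh3] /andP[hh1 hhe]].
move=> /andP[/andP[th2 th3] /andP[th1 the]] /andP[tn1 tn2] Z.
set tau := lambda * h in th2 th3 th1 the tn1 tn2 *.
have tau0 : 0 < tau by rewrite mulr_gt0.
have fZ i : field (Z i) by exact: (local_scheme_field hV l0 cfl).
have tn0 : 0 <= n%:R * tau by rewrite mulr_ge0// ltW.
have t0 : 0 <= t by exact: le_trans tn1.
set p := phi (n%:R * tau); set p' := phi (n.+1%:R * tau).
have E : n.+1%:R * tau = n%:R * tau + tau by rewrite -natr1 mulrDl mul1r.
pose Phi := lflux V h (fun=> k) (Z n).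
have fk : field (fun=> k : R) by split => // x; exact: measurable_cst.
have mPhi : measurable_fun [set: R] Phi by exact: (measurable_lflux hV).
have Phib x : `|Phi x - kflux V (Z n x) k| <= lV * `|Z n (x + h) - Z n x|.
  by apply: (lflux_consistent hV) => // y; exact: (fZ n).2.
have PhiC x : `|Phi x| <= C + lV.
  rewrite -(subrK (kflux V (Z n x) k) (Phi x)) (le_trans (ler_normD _ _))// addrC lerD//.
    by apply: kflux_bound => //; exact: (fZ n).2.
  apply: (le_trans (Phib x)); rewrite -[leRHS]mulr1 ler_wpM2l//.
  by have := (fZ n).2 (x + h); have := (fZ n).2 x; rewrite ler_norml; lra.
have mabs i : measurable_fun [set: R] (fun x => `|Z i x - k|).
  by apply: measurableT_comp => //; apply: measurable_funB => //; exact: (fZ i).1.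
have abs1 i x : `| `|Z i x - k| | <= 1.
  by rewrite normr_id ler_norml; have := (fZ i).2 x; have k01' := k01; lra.
have L1p i r : L1 (fun x => `|Z i x - k| * phi r x).
  by apply: L1_eq (L1_mul_test tphi r 0 (mabs i) (abs1 i)) => x; rewrite addr0.
split; first exact: L1p.
have LPp s : L1 (fun x => Phi x * p' (x + s)) by exact: (L1_mul_test tphi _ _ mPhi PhiC).
have LP0 : L1 (fun x => Phi x * p' x) by apply: L1_eq (LPp 0) => x; rewrite addr0.
have LPm : L1 (fun x => Phi (x - h) * p' x).
  by apply: L1_eq (L1_shift (- h) (LPp h)) => x; rewrite subrK.
have step1 : J (fun x => `|Z n.+1 x - k| * p' x) <=
    J (fun x => `|Z n x - k| * p' x + lambda * (Phi (x - h) * p' x - Phi x * p' x)).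
  apply: J_le; [exact: L1p|by apply: L1D; [exact: L1p|apply: L1Z; exact: L1B]|move=> x].
  rewrite (_ : _ + _ = (`|Z n x - k| + lambda * (Phi (x - h) - Phi x)) * p' x); last by ring.
  rewrite ler_wpM2r//; first by rewrite phi0// mulr_ge0// ltW.
  by apply: (local_entropy hV l0 cfl) => // y; exact: (fZ n).2.
have step2 : J (fun x => `|Z n.+1 x - k| * p' x) - J (fun x => `|Z n x - k| * p x) <=
    J (fun x => `|Z n x - k| * (p' x - p x) + lambda * (Phi x * (p' (x + h) - p' x))).
  have -> : J (fun x => `|Z n x - k| * (p' x - p x) + lambda * (Phi x * (p' (x + h) - p' x))) =
    J (fun x => `|Z n x - k| * p' x) - J (fun x => `|Z n x - k| * p x) +
    lambda * (J (fun x => Phi x * p' (x + h)) - J (fun x => Phi x * p' x)).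
    have La : L1 (fun x => `|Z n x - k| * (p' x - p x)).
      by apply: L1_eq (L1B (L1p n (n.+1%:R * tau)) (L1p n (n%:R * tau))) => x; rewrite mulrBr.
    have Lb : L1 (fun x => Phi x * (p' (x + h) - p' x)).
      by apply: L1_eq (L1B (LPp h) LP0) => x; rewrite mulrBr.
    rewrite J_D//; last exact: L1Z.
    rewrite J_Z//; congr (_ + lambda * _).
      transitivity (J (fun x => `|Z n x - k| * p' x - `|Z n x - k| * p x)).
        by apply: eq_Rintegral => x _; rewrite mulrBr.
      by rewrite J_B; [|exact: L1p|exact: L1p].
    transitivity (J (fun x => Phi x * p' (x + h) - Phi x * p' x)).
      by apply: eq_Rintegral => x _; rewrite mulrBr.
    by rewrite J_B; [|exact: LPp|exact: LP0].
  have -> : J (fun x => Phi x * p' (x + h)) = J (fun x => Phi (x - h) * p' x).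
    rewrite -(J_shift (- h) (LPp h)); apply: eq_Rintegral => x _; by rewrite subrK.
  move: step1; rewrite J_D; [|exact: L1p|apply: L1Z; exact: L1B].
  rewrite J_Z; last exact: L1B.
  by rewrite J_B//; lra.
apply: (le_trans step2).
have [Ltr Jtr] := local_scheme_translation hV l0 cfl ff fT h n h; rewrite -/(Z n) in Ltr Jtr.
pose I := `[- (`|M| + 1), `|M| + 1]%classic : set R.
have MI : - (`|M| + 1) <= `|M| + 1 by rewrite ge0_cp// addr_ge0.
have LI : L1 (\1_I : R -> R) by exact: L1_indic_itv.
apply: (@le_trans _ _ (J (fun x => tau * (entropy_slice (Z n) t x +
  (e' * (1 + C) * \1_I x + lV * B * `|Z n (x + h) - Z n x|))))); last first.
  rewrite J_Z; last first.
    apply: L1D; first exact: entropy_slice_L1.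
    by apply: L1D; apply: L1Z => //; exact: L1_abs.
  rewrite ler_pM2l// J_D; [|exact: entropy_slice_L1|by apply: L1D; apply: L1Z => //; exact: L1_abs].
  rewrite lerD2l J_D; [|exact: L1Z|apply: L1Z; exact: L1_abs].
  rewrite !J_Z//; last exact: L1_abs.
  rewrite J_indic_itv//.
  have -> : e' * (1 + C) * (`|M| + 1 - - (`|M| + 1)) = e / 2.
    by rewrite /e'; field; rewrite !gt_eqF// ltr_wpDr.
  suff : lV * B * J (fun x => `|Z n (x + h) - Z n x|) <= e / 2 by lra.
  apply: (@le_trans _ _ (lV * B * (h * T))).
    by rewrite ler_wpM2l ?mulr_ge0//; rewrite (gtr0_norm h0) in Jtr.
  have : h * (2 * (lV * B * T + 1)) < e by rewrite -ltr_pdivlMr// mulr_gt0// ltr_wpDl.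
  by rewrite mulrDr; lra.
apply: J_le.
- apply: L1D; last apply: L1Z.
    by apply: L1_eq (L1B (L1p n (n.+1%:R * tau)) (L1p n (n%:R * tau))) => x; rewrite mulrBr.
  by apply: L1_eq (L1B (LPp h) LP0) => x; rewrite mulrBr.
- apply: L1Z; apply: L1D; first exact: entropy_slice_L1.
  by apply: L1D; apply: L1Z => //; exact: L1_abs.
move=> x.
have nn : n%:R * tau <= n.+1%:R * tau by rewrite E lerDl ltW.
have [r rn e1] := test_incr_t tphi x nn.
have xh : x <= x + h by rewrite lerDl ltW.
have [y yx e2] := test_incr_x tphi (n.+1%:R * tau) xh.
rewrite -/p -/p' in e1; rewrite -/p' in e2; rewrite e1 e2.
have -> : n.+1%:R * tau - n%:R * tau = tau by rewrite E; ring.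
have -> : x + h - x = h by ring.
have tn12 : n%:R * tau <= t <= n.+1%:R * tau by rewrite tn1.
have rt : `|t - r| < d2 by apply: dist_lt_itv tn12 rn _; rewrite E addrC addKr.
have tt : `|t - n.+1%:R * tau| < d3.
  by apply: dist_lt_itv tn12 _ _; rewrite ?nn ?lexx// E addrC addKr.
have xy : `|x - y| < d3 by apply: dist_lt_itv yx _; rewrite ?lexx// addrC addKr.
have xx : `|x - x| < d2 by rewrite subrr normr0.
have b2 := hd2 _ _ _ _ rt xx; have b3 := hd3 _ _ _ _ tt xy.
set D := dt phi r x in b2 *; set Dx := dx phi _ y in b3 *.
have {}b2 : `|dt phi t x - D| <= e' * \1_I x.
  rewrite indicE; have [hx|hx] := leP `|x| (`|M| + 1).
    by rewrite mem_set ?mulr1 ?ltW//= /I/= in_itv/= -ler_norml.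
  have hM : M < `|x| by apply: le_lt_trans hx; rewrite (le_trans (ler_norm M))// lerDl.
  rewrite /D (s2 t x (or_intror hM)) (s2 r x (or_intror hM)) subrr normr0.
  by rewrite mulr_ge0// ltW.
have {}b3 : `|dx phi t x - Dx| <= e' * \1_I x.
  rewrite indicE; have [hx|hx] := leP `|x| (`|M| + 1).
    by rewrite mem_set ?mulr1 ?ltW//= /I/= in_itv/= -ler_norml.
  have hM : M < `|x| by apply: le_lt_trans hx; rewrite (le_trans (ler_norm M))// lerDl.
  have hy : M < `|y|.
    case/andP: yx => xy1 xy2; apply: far_of_far hx _ hh1.
    by rewrite distrC ger0_norm ?subr_ge0// lerBlDl.
  rewrite /Dx (s3 t x (or_intror hM)) (s3 _ y (or_intror hy)) subrr normr0.
  by rewrite mulr_ge0// ltW.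
have Z01 := (fZ n).2 x.
rewrite [leLHS](_ : _ = tau * (`|Z n x - k| * D + Phi x * Dx)); last by rewrite /tau; ring.
rewrite ler_pM2l// /entropy_slice.
rewrite -lerBlDl [leLHS](_ : _ = `|Z n x - k| * (D - dt phi t x) +
  kflux V (Z n x) k * (Dx - dx phi t x) + (Phi x - kflux V (Z n x) k) * Dx); last by ring.
apply: (le_trans (ler_norm _)); apply: (le_trans (ler_normD _ _)); apply: lerD.
  apply: (le_trans (ler_normD _ _)).
  rewrite !normrM (distrC D) (distrC Dx) mulrAC mulrDr mulr1 [e' * _ * C]mulrC.
  apply: lerD; last by apply: ler_pM => //; exact: kflux_bound.
  by rewrite -[leRHS]mul1r; apply: ler_pM => //; exact: abs1.
by rewrite normrM mulrAC; apply: ler_pM => //; rewrite /Dx.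
Qed.

Lemma limsol_entropy_slices :
  0 <= J (fun t => halfline t * J (entropy_slice (limsol V lambda f t) t)) +
       J (fun x => `|f x - k| * phi 0 x).
Proof.
have [M [s1 s2 s3]] := test_function_support tphi.
have [D D0 hD] := entropy_slice_diff.
have T0 : 0 <= T by exact: T_ge0 fT.
set F := fun t : R => J (entropy_slice (limsol V lambda f t) t).
have LF : L1 (fun t => halfline t * F t).
  apply: (box_L1 (entropy_box (u := limsol V lambda f) hV _ _ k01 tphi)).2.
    by apply: measurable_funTS; exact: (measurable_limsol hV l0 cfl ff).
  by move=> t x _; exact: (limsol_itv hV l0 cfl ff).
set b0 := J (fun x => `|f x - k| * phi 0 x).
rewrite -lerBlDr sub0r; apply/ler_addgt0Pr => e e0.
pose M2 := `|M| + 2; have M20 : 0 < M2 by rewrite ltr_wpDl.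
have e1 : 0 < e / (2 * M2) by rewrite divr_gt0// mulr_gt0.
have [d d0 hd] := discrete_test_step e1.
pose Q := D * (2 * ((5 + 40 * (M2 / lambda)) * T)).
have d1 : 0 < Num.min (d / 2) 1 by rewrite lt_min divr_gt0/=.
have [m1 hm1] := half_pow_small (1 + lambda) d1.
have [m2 hm2] := half_pow_small Q e1.
(* [m1] makes mesh and time step small enough for [discrete_test_step], and [m2] makes [refsol m]
   close to [limsol] uniformly for [t <= M2]. *)
pose m := maxn m1 m2; set h := mesh m : R; set tau := lambda * h.
have h0 : 0 < h by exact: mesh_gt0.
have tau0 : 0 < tau by rewrite mulr_gt0.
have hpow : h <= 2^-1 ^+ m1.
  rewrite /h /mesh (@le_trans _ _ (2^-1 ^+ m))//; first by rewrite lerXn2r ?nnegrE//; lra.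
  by apply: ler_wiXn2l; rewrite ?leq_maxl//; lra.
have hbig : (1 + lambda) * h <= Num.min (d / 2) 1.
  by apply: le_trans hm1; rewrite ler_wpM2l// addr_ge0// ltW.
have [hd1 h1] : (1 + lambda) * h <= d / 2 /\ (1 + lambda) * h <= 1.
  by move: hbig; rewrite le_min => /andP[].
have tauE : (1 + lambda) * h = h + tau by rewrite mulrDl mul1r.
(* [N * tau] lies beyond the support of [phi], so that the last term of the telescoping sum
   vanishes, and is at most [M2] because [tau <= 1]. *)
pose N := (step_index tau (`|M| + 1)).+1.
have M1 : 0 <= `|M| + 1 by rewrite addr_ge0.
have /andP[N1 N2] := step_indexP tau0 M1; rewrite -/N in N2.
have MN : M < N%:R * tau by apply: le_lt_trans N2; rewrite ler_wpDr// ler_norm.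
have N3 : N%:R * tau <= M2 by rewrite /N /M2 -natr1 mulrDl mul1r; lra.
pose Z := local_scheme V lambda h f.
pose b n := J (fun x => `|Z n x - k| * phi (n%:R * tau) x).
have bN : b N = 0.
  rewrite /b; under eq_Rintegral => x _.
    rewrite s1 ?mulr0; last by left; apply: lt_le_trans MN (ler_norm _).
    over.
  by rewrite Rintegral_cst// mul0r.
have bb : - b0 = \sum_(n < N) (b n.+1 - b n).
  rewrite -(big_mkord xpredT (fun n => b n.+1 - b n)) telescope_sumr// bN sub0r.
  by rewrite /b mul0r.
pose I := `[0, N%:R * tau]%classic : set R.
have N0 : 0 <= N%:R * tau by rewrite mulr_ge0// ltW.
have LI : L1 (\1_I : R -> R) by exact: L1_indic_itv.
apply: (@le_trans _ _ (J (fun t => halfline t * F t + 2 * (e / (2 * M2)) * \1_I t))); last first.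
  rewrite J_D//; last exact: L1Z.
  rewrite lerD2l J_Z// J_indic_itv// subr0.
  apply: (@le_trans _ _ (2 * (e / (2 * M2)) * M2)).
    by rewrite ler_wpM2l// mulr_ge0// ltW.
  by rewrite le_eqVlt; apply/orP; left; apply/eqP; field; rewrite gt_eqF.
rewrite bb; apply: (steps_le_integral (a := fun n => b n.+1 - b n) tau0).
- by apply: L1D => //; exact: L1Z.
- move=> n t nN /andP[t1 t2].
  have hd' : 0 < h < d by apply/andP; split; lra.
  have td : lambda * h < d by rewrite -/tau; lra.
  have tt : n%:R * (lambda * h) <= t <= n.+1%:R * (lambda * h) by rewrite -/tau t1 ltW.
  have [_] := hd h n t hd' td tt.
  move=> /le_trans; apply; rewrite -/tau ler_pM2l//.
  have t0 : 0 <= t by apply: le_trans t1; rewrite mulr_ge0// ltW.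
  have tM : t <= M2.
    by apply: le_trans N3; apply: (le_trans (ltW t2)); rewrite ler_pM2r// ler_nat.
  rewrite /halfline t0 mul1r indicE mem_set/= /I/= ?in_itv/= ?t0 ?mulr1//; last first.
    by apply: (le_trans (ltW t2)); rewrite ler_pM2r// ler_nat.
  rewrite (_ : F t + _ = (F t + e / (2 * M2)) + e / (2 * M2)); last by ring.
  rewrite lerD2r.
  have [Ll Jl] := limsol_refsol hV l0 cfl ff fT m t0.
  have stn : step_index tau t = n by apply: step_index_unique => //; rewrite t1.
  have eZ : Z n = refsol V lambda f m t by rewrite /refsol -/h -/tau stn.
  rewrite -/(Z n) eZ.
  have := hD _ _ t (limsol_field hV l0 cfl ff t) (refsol_field hV l0 cfl ff m t) t0 Ll.
  rewrite -/(F t) => hF.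
  have : D * J (fun x => `|limsol V lambda f t x - refsol V lambda f m t x|) <= e / (2 * M2).
    apply: (@le_trans _ _ (D * (2 * ((5 + 40 * (t / lambda)) * T) * 2^-1 ^+ m))).
      exact: ler_wpM2l.
    apply: le_trans hm2; rewrite /Q -[leRHS]mulrA; apply: ler_wpM2l => //.
    have tl0 : 0 <= t / lambda by rewrite divr_ge0// ltW.
    apply: ler_pM.
    - by rewrite mulr_ge0// mulr_ge0// addr_ge0// mulr_ge0.
    - by rewrite exprn_ge0.
    - by rewrite ler_wpM2l// ler_wpM2r// lerD2l ler_wpM2l// ler_pM2r// invr_gt0.
    - by apply: ler_wiXn2l; rewrite ?leq_maxr ?invr_ge0 ?invf_le1// ler1n.
  move=> hDJ; rewrite -lerBlDl; apply: le_trans hDJ; apply: le_trans hF.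
  by rewrite distrC; exact: ler_norm.
- move=> t [tn|tn].
    rewrite /halfline (lt_geF tn) mul0r add0r mulr_ge0 ?indicE//.
    by rewrite mulr_ge0// ltW.
  have -> : F t = 0.
    have out x : entropy_slice (limsol V lambda f t) t x = 0.
      rewrite /entropy_slice s2 ?s3 ?mulr0 ?addr0//; left; apply: lt_le_trans (ler_norm _); exact: lt_le_trans MN tn.
    by rewrite /F (_ : entropy_slice _ _ = fun=> 0) ?Rintegral_cst ?mul0r//; exact/funext.
  rewrite mulr0 add0r mulr_ge0 ?indicE//.
  by rewrite mulr_ge0// ltW.
Qed.

End LimitEntropy.

Lemma limsol_entropy_solution (R : realType) (V : R -> R) (vM lV lambda : R)
  (f : R -> R) (T : R) : velocity V vM lV -> 0 < lambda -> lambda * (vM + lV) <= 1 ->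
  field f -> (forall s,
    (\int[@lebesgue_measure R]_x `|f (x + s) - f x|%:E <= (`|s| * T)%:E)%E) ->
  entropy_solution V f (limsol V lambda f).
Proof.
move=> hV l0 cfl ff fT.
have ml : measurable_fun [set z : R * R | 0 <= z.1] (fun z : R * R => limsol V lambda f z.1 z.2).
  by apply: measurable_funTS; exact: (measurable_limsol hV l0 cfl ff).
have l01 (t x : R) : 0 <= t -> 0 <= limsol V lambda f t x <= 1.
  by move=> _; exact: (limsol_itv hV l0 cfl ff).
split => // k phi k01 tphi.
rewrite (entropy_solutionE hV ff.1 ff.2 ml l01 k01 tphi).2 lee_fin.
exact: (limsol_entropy_slices hV l0 cfl ff fT k01 tphi).
Qed.

(** * Discrete comparison and spline test functions *)

Section DiscreteComparison.
Context {R : realType}.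

Lemma sum_by_parts (e q : int -> R) (a : int) (m : nat) : e a = 0 -> e (a + m%:Z) = 0 ->
  \sum_(i < m) q (a + i%:Z) * (e (a + i%:Z) - e (a + i%:Z + 1)) =
  \sum_(i < m) e (a + i%:Z) * (q (a + i%:Z) - q (a + i%:Z - 1)).
Proof.
move=> ea em; apply/eqP; rewrite -subr_eq0 -sumrB.
pose G (i : nat) : R := e (a + i%:Z) * q (a + i%:Z - 1).
rewrite (eq_bigr (fun i : 'I_m => - (G i.+1 - G i))); last first.
  move=> i _; rewrite /G (_ : a + i.+1%:Z = a + i%:Z + 1); last by rewrite -addn1 PoszD addrA.
  by rewrite addrK; ring.
rewrite sumrN -(big_mkord xpredT (fun i => G i.+1 - G i)) telescope_sumr// /G addr0 em ea.
by rewrite !mul0r subrr oppr0.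
Qed.

Lemma sum_by_parts_time (d b : nat -> R) (N : nat) :
  \sum_(n < N.+1) (d n - d n.+1) * b n + d N.+1 * b N =
  d 0%N * b 0%N + \sum_(n < N) d n.+1 * (b n.+1 - b n).
Proof.
elim: N => [|N IH]; first by rewrite big_ord_recr !big_ord0/=; ring.
by rewrite big_ord_recr [in RHS]big_ord_recr/= addrA -IH; ring.
Qed.

Variables (lambda C : R) (N m : nat) (a : int).
Variables (A q Phi E : nat -> int -> R) (W : nat -> int -> R) (phi psi : int -> R).
Variables (eta theta d : nat -> R).
Hypothesis l0 : 0 <= lambda.
Hypotheses (phi0 : forall j, 0 <= phi j).
Hypotheses (phia : phi a = 0) (phim : phi (a + m%:Z) = 0).
Hypotheses (psia : psi a = 0) (psim : psi (a + m%:Z) = 0).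
Hypothesis entropyA : forall n j, A n.+1 j <= A n j + lambda * (Phi n (j - 1) - Phi n j).
Hypothesis consistent : forall n j, `|Phi n j - q n j| <= E n j.
Hypothesis q_lip : forall n n' j j', `|q n j - q n' j'| <= C * `|W n j - W n' j'|.
Hypotheses (eta0 : eta 0%N = 0) (eta_ge0 : forall n, 0 <= eta n) (theta_ge0 : forall n, 0 <= theta n).
Hypothesis etaE : forall n, eta n.+1 - theta n = d n - d n.+1.

Let jj (i : nat) : int := a + i%:Z.
Notation "'\S_' i F" := (\sum_(i < m) F) (at level 41, i at level 0, F at level 41).

Let dphi j := phi (j + 1) - phi j.
Let B n := \sum_(i < m) q n (jj i) * dphi (jj i).

Let Bbound n : `|B n| <= \sum_(i < m) C * `|W n (jj i) - W n (jj i - 1)| * phi (jj i).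
Proof.
have -> : B n = - \sum_(i < m) phi (jj i) * (q n (jj i) - q n (jj i - 1)).
  by rewrite -sum_by_parts// -sumrN; apply: eq_bigr => i _; rewrite /dphi -mulrN opprB.
rewrite normrN (le_trans (ler_norm_sum _ _ _))//; apply: ler_sum => i _.
by rewrite normrM (ger0_norm (phi0 _)) mulrC ler_wpM2r.
Qed.

Let Bdiff n : `|B n.+1 - B n| <=
  \sum_(i < m) C * `|W n.+1 (jj i) - W n (jj i)| * `|dphi (jj i)|.
Proof.
rewrite -sumrB (le_trans (ler_norm_sum _ _ _))//; apply: ler_sum => i _.
by rewrite -mulrBl normrM ler_wpM2r.
Qed.

Let astep n : \sum_(i < m) A n.+1 (jj i) * phi (jj i) - \sum_(i < m) A n (jj i) * phi (jj i) <=
  lambda * (B n + \sum_(i < m) E n (jj i) * `|dphi (jj i)|).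
Proof.
apply: (@le_trans _ _ (lambda * \sum_(i < m) Phi n (jj i) * dphi (jj i))).
  have -> : \sum_(i < m) Phi n (jj i) * dphi (jj i) =
      \sum_(i < m) phi (jj i) * (Phi n (jj i - 1) - Phi n (jj i)).
    transitivity (- \sum_(i < m) phi (jj i) * (Phi n (jj i) - Phi n (jj i - 1))).
      by rewrite -sum_by_parts// -sumrN; apply: eq_bigr => i _; rewrite /dphi -mulrN opprB.
    by rewrite -sumrN; apply: eq_bigr => i _; rewrite -mulrN opprB.
  rewrite -sumrB mulr_sumr; apply: ler_sum => i _.
  by rewrite -mulrBl mulrCA mulrC ler_wpM2l// lerBlDl.
rewrite ler_wpM2l// /B -big_split/=; apply: ler_sum => i _.
rewrite -lerBlDl -mulrBl (le_trans (ler_norm _))// normrM ler_wpM2r//.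
Qed.

Let Dbound n : \sum_(i < m) q n (jj i) * (psi (jj i) - psi (jj i + 1)) <=
  - B n + \sum_(i < m) C * `|W n (jj i) - W n (jj i - 1)| * `|psi (jj i) - phi (jj i)|.
Proof.
pose f j := psi j - phi j.
have -> : \sum_(i < m) q n (jj i) * (psi (jj i) - psi (jj i + 1)) =
    - B n + \sum_(i < m) q n (jj i) * (f (jj i) - f (jj i + 1)).
  by rewrite -sumrN -big_split/=; apply: eq_bigr => i _; rewrite /f /dphi; ring.
rewrite lerD2l sum_by_parts ?/f ?phia ?psia ?phim ?psim ?subrr//.
apply: ler_sum => i _; rewrite (le_trans (ler_norm _))// normrM mulrC ler_wpM2r//.
Qed.

(** Two mismatches prevent cancellation: the discrete inequality carries the weights [eta n.+1] and
    [phi], the flux term [theta n] and [psi]. In time, [eta n.+1 - theta n] is a difference of [d],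
    and summation by parts puts it on the increments of [B]. In space, [psi - phi] is put on the
    variation of [q]. Every error so obtained carries a difference of [W] or a consistency error
    [E]. *)
Lemma discrete_comparison :
  \sum_(n < N.+1) \sum_(i < m)
     ((eta n - eta n.+1) * (A n (jj i) * phi (jj i)) +
      lambda * (theta n * (q n (jj i) * (psi (jj i) - psi (jj i + 1))))) +
  eta N.+1 * (\sum_(i < m) A N (jj i) * phi (jj i)) <=
  lambda * (\sum_(n < N) eta n.+1 * (\sum_(i < m) E n (jj i) * `|dphi (jj i)|) +
   \sum_(n < N.+1) theta n *
      (\sum_(i < m) C * `|W n (jj i) - W n (jj i - 1)| * `|psi (jj i) - phi (jj i)|) +
   \sum_(n < N) `|d n.+1| * (\sum_(i < m) C * `|W n.+1 (jj i) - W n (jj i)| * `|dphi (jj i)|) +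
   `|d 0%N| * (\sum_(i < m) C * `|W 0%N (jj i) - W 0%N (jj i - 1)| * phi (jj i)) +
   (`|d N.+1| + eta N.+1) * (\sum_(i < m) C * `|W N (jj i) - W N (jj i - 1)| * phi (jj i))).
Proof.
pose aa n := \sum_(i < m) A n (jj i) * phi (jj i).
pose D n := \sum_(i < m) q n (jj i) * (psi (jj i) - psi (jj i + 1)).
set P := fun n => \sum_(i < m) E n (jj i) * `|dphi (jj i)|.
set F := fun n => \sum_(i < m) C * `|W n (jj i) - W n (jj i - 1)| * `|psi (jj i) - phi (jj i)|.
set Q := fun n => \sum_(i < m) C * `|W n (jj i) - W n (jj i - 1)| * phi (jj i).
set G := fun n => \sum_(i < m) C * `|W n.+1 (jj i) - W n (jj i)| * `|dphi (jj i)|.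
rewrite -/(aa N) -/(Q 0%N) -/(Q N).
have -> : \sum_(n < N.+1) \sum_(i < m)
     ((eta n - eta n.+1) * (A n (jj i) * phi (jj i)) +
      lambda * (theta n * (q n (jj i) * (psi (jj i) - psi (jj i + 1))))) =
  \sum_(n < N.+1) (eta n - eta n.+1) * aa n + lambda * \sum_(n < N.+1) theta n * D n.
  rewrite mulr_sumr -big_split/=; apply: eq_bigr => n _.
  by rewrite big_split/= !mulr_sumr.
rewrite addrAC sum_by_parts_time eta0 mul0r add0r.
have h1 : \sum_(n < N) eta n.+1 * (aa n.+1 - aa n) <=
    lambda * (\sum_(n < N) eta n.+1 * B n + \sum_(n < N) eta n.+1 * P n).
  rewrite -big_split mulr_sumr/=; apply: ler_sum => n _.
  by rewrite -mulrDr mulrCA ler_wpM2l// astep.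
have h2 : \sum_(n < N.+1) theta n * D n <=
    - \sum_(n < N.+1) theta n * B n + \sum_(n < N.+1) theta n * F n.
  rewrite -sumrN -big_split/=; apply: ler_sum => n _.
  by rewrite -mulrN -mulrDr ler_wpM2l// Dbound.
have h3 : \sum_(n < N) eta n.+1 * B n - \sum_(n < N.+1) theta n * B n =
   d 0%N * B 0%N + \sum_(n < N) d n.+1 * (B n.+1 - B n) - (d N.+1 + eta N.+1) * B N.
  rewrite -sum_by_parts_time.
  under [X in _ = X + _ - _]eq_bigr => n _ do rewrite -etaE mulrBl.
  by rewrite sumrB [X in _ = X - _ + _ - _]big_ord_recr/=; ring.
have h4 : d 0%N * B 0%N <= `|d 0%N| * Q 0%N.
  by rewrite (le_trans (ler_norm _))// normrM ler_wpM2l// Bbound.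
have h5 : - ((d N.+1 + eta N.+1) * B N) <= (`|d N.+1| + eta N.+1) * Q N.
  rewrite (le_trans (ler_norm _))// normrN normrM ler_pM// ?Bbound//.
  by rewrite (le_trans (ler_normD _ _))// (ger0_norm (eta_ge0 _)).
have h6 : \sum_(n < N) d n.+1 * (B n.+1 - B n) <= \sum_(n < N) `|d n.+1| * G n.
  apply: ler_sum => n _; apply: (le_trans (ler_norm _)); rewrite normrM.
  by apply: ler_wpM2l => //; apply: Bdiff.
apply: (le_trans (lerD h1 (ler_wpM2l l0 h2))).
rewrite -mulrDr ler_wpM2l//; lra.
Qed.

End DiscreteComparison.

(** * Quadratic splines *)

Section Spline.
Context {R : realType}.
Implicit Types z e : R.

Definition posp z : R := Num.max z 0.
Definition ramp z : R := posp z - posp (z - 1).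
Definition hat z : R := ramp (z + 1) - ramp z.
(** A C1 step rising from 0 at -1 to 1 at 1. Its derivative is [hat], itself a difference of the
    piecewise linear steps [ramp]. *)
Definition spline z : R := (posp (z + 1) ^+ 2 - 2 * posp z ^+ 2 + posp (z - 1) ^+ 2) / 2.

Lemma posp_sq_taylor z e : `|posp (z + e) ^+ 2 - posp z ^+ 2 - 2 * posp z * e| <= e ^+ 2.
Proof.
rewrite /posp /Num.max; case: ifPn => h1; case: ifPn => h2; rewrite ?ltNge ?negbK -?ltNge in h1 h2;
  rewrite ler_norml; apply/andP; split; nra.
Qed.

Lemma spline_taylor z e : `|spline (z + e) - spline z - hat z * e| <= 2 * e ^+ 2.
Proof.
have h1 := posp_sq_taylor (z + 1) e; have h2 := posp_sq_taylor z e.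
have h3 := posp_sq_taylor (z - 1) e.
have -> : spline (z + e) - spline z - hat z * e =
  ((posp (z + 1 + e) ^+ 2 - posp (z + 1) ^+ 2 - 2 * posp (z + 1) * e) -
   2 * (posp (z + e) ^+ 2 - posp z ^+ 2 - 2 * posp z * e) +
   (posp (z - 1 + e) ^+ 2 - posp (z - 1) ^+ 2 - 2 * posp (z - 1) * e)) / 2.
  by rewrite /spline /hat /ramp addrK (addrAC z e 1) (addrAC z e (-1)); field.
move: h1 h2 h3; rewrite !ler_norml => /andP[? ?] /andP[? ?] /andP[? ?].
apply/andP; split; lra.
Qed.

Lemma posp_lip z w : `|posp z - posp w| <= `|z - w|.
Proof.
rewrite /posp /Num.max; case: ifPn => h1; case: ifPn => h2; rewrite ?ltNge ?negbK -?ltNge in h1 h2;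
  have := ler_norm (z - w); have := ler_norm (- (z - w)); rewrite normrN => ? ?;
  rewrite ler_norml; apply/andP; split; lra.
Qed.

Lemma continuous_posp : continuous posp.
Proof.
move=> z; apply/cvgrPdist_lt => e e0; near=> w; apply: (le_lt_trans (posp_lip _ _)).
by near: w; exact: cvgr_dist_lt.
Unshelve. all: by end_near.
Qed.

Lemma continuous_hat : continuous hat.
Proof.
have cs c : continuous (fun z => posp (z + c)).
  move=> z; apply: (continuous_comp (f := fun z => z + c)); last exact: continuous_posp.
  by apply: cvgD; [exact: cvg_id|exact: cvg_cst].
have e : hat = fun z => posp (z + 1) - posp (z + 0) - (posp (z + 0) - posp (z + (-1))).
  by apply/funext => z; rewrite /hat /ramp addrK addr0.
by rewrite e => z; do ! apply: cvgB; exact: cs.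
Qed.

Lemma continuous_spline : continuous spline.
Proof.
have cs c : continuous (fun z => posp (z + c) ^+ 2).
  suff cp : continuous (fun z => posp (z + c)).
    by move=> z; under eq_fun do rewrite expr2; apply: cvgM; exact: cp.
  move=> z; apply: (continuous_comp (f := fun z => z + c)); last exact: continuous_posp.
  by apply: cvgD; [exact: cvg_id|exact: cvg_cst].
have e : spline = fun z => (posp (z + 1) ^+ 2 - 2 * posp (z + 0) ^+ 2 + posp (z + (-1)) ^+ 2) * 2^-1.
  by apply/funext => z; rewrite /spline addr0.
rewrite e => z; apply: cvgM; last exact: cvg_cst.
apply: cvgD; last exact: cs.
apply: cvgB; first exact: cs.
by apply: cvgM; [exact: cvg_cst|exact: cs].
Qed.

Lemma posp_ge z : 0 <= z -> posp z = z. Proof. by move=> h; rewrite /posp max_l. Qed.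
Lemma posp_le z : z <= 0 -> posp z = 0. Proof. by move=> h; rewrite /posp max_r. Qed.

Lemma ramp_itv z : 0 <= ramp z <= 1.
Proof.
have [h|h] := leP z 0; first by rewrite /ramp !posp_le; lra.
have [h'|h'] := leP z 1; first by rewrite /ramp posp_ge ?posp_le; lra.
rewrite /ramp !posp_ge; lra.
Qed.

Lemma ramp0 z : z <= 0 -> ramp z = 0.
Proof. by move=> h; rewrite /ramp !posp_le ?subrr; lra. Qed.

Lemma ramp1 z : 1 <= z -> ramp z = 1.
Proof. by move=> h; rewrite /ramp !posp_ge; lra. Qed.

Lemma hat_ge0 z : 0 <= hat z.
Proof.
rewrite /hat; have [h|h] := leP z 0; first by rewrite (ramp0 h) subr0; case/andP: (ramp_itv (z + 1)).
rewrite (@ramp1 (z + 1)); last lra.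
by have := ramp_itv z; lra.
Qed.

Lemma hat0 z : z <= -1 \/ 1 <= z -> hat z = 0.
Proof.
move=> h; rewrite /hat; case: h => h; first by rewrite !ramp0; lra.
rewrite !ramp1; lra.
Qed.

Lemma hat_le1 z : hat z <= 1.
Proof. by have := ramp_itv z; have := ramp_itv (z + 1); rewrite /hat; lra. Qed.

Lemma spline0 z : z <= -1 -> spline z = 0.
Proof. by move=> h; rewrite /spline !posp_le; lra. Qed.

Lemma spline1 z : 1 <= z -> spline z = 1.
Proof. by move=> h; rewrite /spline !posp_ge; try lra; field. Qed.

(** A quadratic remainder valid for all increments yields the derivative, so the knots of the spline
    need no separate treatment. *)
Lemma is_derive_taylor (f : R -> R) (x d C : R) :
  (forall e, `|f (x + e) - f x - d * e| <= C * e ^+ 2) -> is_derive x 1 f d.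
Proof.
move=> fd.
suff h : h^-1 *: ((f \o shift x) (h *: 1) - f x) @[h --> 0^'] --> d.
  split; first by apply/cvg_ex; exists d.
  by apply: cvg_lim h; exact: Rhausdorff.
have C0 : 0 <= C.
  by have := fd 1; rewrite expr1n [leRHS]mulr1 => h; apply: le_trans h; exact: normr_ge0.
apply/cvgrPdist_le => e e0.
near=> h; have h0 : h != 0 by near: h; exact: nbhs_dnbhs_neq.
have hC : `|h| <= e / (C + 1).
  near: h; apply: nbhs_dnbhs; apply/nbhs_ballP; exists (e / (C + 1)) => /=.
    by rewrite divr_gt0// ltr_wpDl.
  by move=> y; rewrite /ball/= sub0r normrN => /ltW.
rewrite /= scaler1 [h + x]addrC /GRing.scale/=.
have -> : d - h^-1 * (f (x + h) - f x) = - (h^-1 * (f (x + h) - f x - d * h)) by field.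
rewrite normrN normrM normfV ler_pdivrMl ?normr_gt0//.
apply: (le_trans (fd h)).
have : C * `|h| <= e.
  apply: (@le_trans _ _ ((C + 1) * `|h|)); first by rewrite ler_wpM2r// lerDl.
  by rewrite mulrC -ler_pdivlMr// ltr_wpDl.
move=> /(ler_wpM2l (normr_ge0 h)); apply: le_trans.
by rewrite -real_normK ?num_real// expr2 mulrCA.
Unshelve. all: by end_near.
Qed.

Lemma is_derive_spline_affine (a c x : R) :
  is_derive x 1 (fun s => spline (a * s + c)) (a * hat (a * x + c)).
Proof.
apply: (@is_derive_taylor _ _ _ (2 * a ^+ 2)) => e.
have := spline_taylor (a * x + c) (a * e).
rewrite mulrDr (addrAC (a * x)) exprMn !mulrA.
by rewrite [hat _ * a]mulrC.
Qed.

Lemma le_spline : {homo spline : z w / z <= w}.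
Proof.
move=> z w zw.
have d (x : R) : is_derive x 1 spline (hat x).
  by apply: (@is_derive_taylor _ _ _ 2) => e; exact: spline_taylor.
have cS : {within `[z, w], continuous spline}.
  by apply: continuous_subspaceT; exact: continuous_spline.
have [r _ e] := MVT_segment zw (fun x _ => d x) cS.
by rewrite -subr_ge0 e mulr_ge0 ?hat_ge0// subr_ge0.
Qed.

Lemma spline_itv z : 0 <= spline z <= 1.
Proof.
apply/andP; split.
  have [h|h] := leP z (-1); first by rewrite spline0.
  by rewrite -(spline0 (lexx (-1))) le_spline// ltW.
have [h|h] := leP 1 z; first by rewrite spline1.
by rewrite -(spline1 (lexx 1)) le_spline// ltW.
Qed.

End Spline.

(** * Functions of two variables with explicit derivatives *)

Section ExplicitC1.
Context {R : realType}.
Implicit Types phi pt px : R -> R -> R.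

(** The partial derivatives are carried along, so that differences and products of ridge functions
    are differentiated by rule. *)
Definition C1_with phi pt px : Prop :=
  [/\ forall t x : R, is_derive t 1 (fun s => phi s x) (pt t x) /\
                  is_derive x 1 (phi t) (px t x),
      continuous (fun z : R * R => phi z.1 z.2),
      continuous (fun z : R * R => pt z.1 z.2) &
      continuous (fun z : R * R => px z.1 z.2)].

Lemma C1_withE phi pt px : C1_with phi pt px ->
  [/\ C1 phi, dt phi = pt & dx phi = px].
Proof.
move=> [d c1 c2 c3].
have et : dt phi = pt.
  apply/funext => t; apply/funext => x; rewrite /dt derive1E.
  by have [a _] := d t x; exact: derive_val.
have ex : dx phi = px.
  apply/funext => t; apply/funext => x; rewrite /dx derive1E.
  by have [_ a] := d t x; exact: derive_val.
split=> //; split; rewrite ?et ?ex// => t x.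
by have [a b] := d t x; split; [case: a|case: b].
Qed.

Lemma continuous_affine2 (a b c : R) : continuous (fun z : R * R => a * z.1 + b * z.2 + c).
Proof.
move=> z; apply: cvgD; last exact: cvg_cst.
apply: cvgD; apply: cvgM; try exact: cvg_cst; [exact: cvg_fst|exact: cvg_snd].
Qed.

Lemma C1_ridge (a b c : R) : C1_with (fun t x => spline (a * t + b * x + c))
  (fun t x => a * hat (a * t + b * x + c)) (fun t x => b * hat (a * t + b * x + c)).
Proof.
have ch : continuous (fun z : R * R => hat (a * z.1 + b * z.2 + c)).
  move=> z; apply: (continuous_comp (f := fun z : R * R => a * z.1 + b * z.2 + c)).
    exact: continuous_affine2.
  exact: continuous_hat.
split.
- move=> t x; split.
    have := is_derive_spline_affine a (b * x + c) t.
    by under eq_fun do rewrite addrA; rewrite addrA.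
  have := is_derive_spline_affine b (a * t + c) x.
  have e s : b * s + (a * t + c) = a * t + b * s + c by rewrite addrCA addrA.
  by under eq_fun do rewrite e; rewrite e.
- move=> z; apply: (continuous_comp (f := fun z : R * R => a * z.1 + b * z.2 + c)).
    exact: continuous_affine2.
  exact: continuous_spline.
- by move=> z; apply: cvgM; [exact: cvg_cst|exact: ch].
- by move=> z; apply: cvgM; [exact: cvg_cst|exact: ch].
Qed.

Lemma C1_withM phi pt px psi qt qx : C1_with phi pt px -> C1_with psi qt qx ->
  C1_with (fun t x => phi t x * psi t x)
    (fun t x => phi t x * qt t x + psi t x * pt t x)
    (fun t x => phi t x * qx t x + psi t x * px t x).
Proof.
move=> [d c1 c2 c3] [d' c1' c2' c3']; split.
- move=> t x; have [a b] := d t x; have [a' b'] := d' t x; split.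
    exact: (is_deriveM (f := fun s => phi s x) (g := fun s => psi s x)).
  exact: (is_deriveM (f := phi t) (g := psi t)).
- by move=> z; apply: cvgM; [exact: c1|exact: c1'].
- by move=> z; apply: cvgD; apply: cvgM; [exact: c1|exact: c2'|exact: c1'|exact: c2].
- by move=> z; apply: cvgD; apply: cvgM; [exact: c1|exact: c3'|exact: c1'|exact: c3].
Qed.

Lemma C1_withB phi pt px psi qt qx : C1_with phi pt px -> C1_with psi qt qx ->
  C1_with (fun t x => phi t x - psi t x)
    (fun t x => pt t x - qt t x) (fun t x => px t x - qx t x).
Proof.
move=> [d c1 c2 c3] [d' c1' c2' c3']; split.
- move=> t x; have [a b] := d t x; have [a' b'] := d' t x; split.
    exact: (is_deriveB (f := fun s => phi s x) (g := fun s => psi s x)).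
  exact: (is_deriveB (f := phi t) (g := psi t)).
- by move=> z; apply: cvgB; [exact: c1|exact: c1'].
- by move=> z; apply: cvgB; [exact: c2|exact: c2'].
- by move=> z; apply: cvgB; [exact: c3|exact: c3'].
Qed.

Lemma compact_support_box phi (M : R) :
  (forall t x, phi t x != 0 -> `|t| <= M /\ `|x| <= M) ->
  compact (closure [set z : R * R | phi z.1 z.2 != 0]).
Proof.
move=> h; pose K := (`[- M, M]%classic : set R) `*` (`[- M, M]%classic : set R).
have cK : compact K by apply: compact_setX; exact: segment_compact.
apply: (subclosed_compact _ cK); first exact: closed_closure.
have clK : closed K by apply: compact_closed => //; exact: norm_hausdorff.
rewrite ((closure_id K).1 clK).
by apply: closure_subset => -[t x] /= /h [a b]; split; rewrite /= in_itv/= -ler_norml.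
Qed.

End ExplicitC1.

(** * Windows of cells and spatial test functions *)

Section Windows.
Context {R : realType}.
Notation J f := (\int[@lebesgue_measure R]_x f x).
Variables (h : R) (K : nat).
Hypothesis h0 : 0 < h.
Implicit Types (x p q v z : R) (j a : int) (m : nat).

Definition win p q j : R -> R := \1_(`[(j%:~R + p) * h, (j%:~R + q) * h]).

Lemma win_ge0 p q j x : 0 <= win p q j x.
Proof. by rewrite /win indicE. Qed.

Lemma winE p q j x : win p q j x = (p <= x / h - j%:~R <= q)%R%:R.
Proof.
rewrite /win indicE mem_setE in_itv/=; congr (nat_of_bool _)%:R.
rewrite -(ler_pdivlMr _ _ h0) -(ler_pdivrMr _ _ h0).
by apply/idP/idP => /andP[? ?]; apply/andP; split; lra.
Qed.

Lemma win1 p q j x : p <= x / h - j%:~R <= q -> win p q j x = 1.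
Proof. by rewrite winE => ->. Qed.

Lemma le_win v p q j x : v <= 1 ->
  (x / h - j%:~R < p \/ q < x / h - j%:~R -> v <= 0) -> v <= win p q j x.
Proof.
move=> v1 v0; rewrite winE; have [h1|h1] := leP p (x / h - j%:~R); last first.
  by apply: (le_trans (v0 _)); [left|].
by have [h2|h2] := leP (x / h - j%:~R) q => //=; apply: v0; right.
Qed.

Lemma win_itv p q j : p <= q -> (j%:~R + p) * h <= (j%:~R + q) * h.
Proof. by move=> pq; rewrite ler_pM2r// lerD2l. Qed.

Lemma win_L1 p q j : p <= q -> L1 (win p q j).
Proof. by move=> /win_itv h1; exact: L1_indic_itv. Qed.

Lemma J_win p q j : p <= q -> J (win p q j) = (q - p) * h.
Proof.
by move=> pq; rewrite /win J_indic_itv; [rewrite -mulrBl; congr (_ * _); ring|exact: win_itv].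
Qed.

Lemma wsum_win (c : int -> R) (T p q : R) a m : p <= q -> (forall j, 0 <= c j) ->
  wsum_le c T ->
  L1 (fun x => \sum_(i < m) c (a + i%:Z) * win p q (a + i%:Z) x) /\
  J (fun x => \sum_(i < m) c (a + i%:Z) * win p q (a + i%:Z) x) <= (q - p) * h * T.
Proof.
move=> pq c0 cT.
have L i : L1 (fun x => c (a + i%:Z) * win p q (a + i%:Z) x) by exact/L1Z/win_L1.
split; first exact: (@L1_sum R m (fun i x => c (a + i%:Z) * win p q (a + i%:Z) x)).
rewrite (@J_sum R m (fun i x => c (a + i%:Z) * win p q (a + i%:Z) x))//.
rewrite (eq_bigr (fun i : 'I_m => c (a + i%:Z) * ((q - p) * h))); last first.
  by move=> i _; rewrite J_Z ?J_win//; exact: win_L1.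
rewrite -mulr_suml mulrC ler_wpM2l//.
  by rewrite mulr_ge0 ?(ltW h0)// subr_ge0.
exact: cT.
Qed.

(* The sum of [phi j] over [j] is [K], see [sum_phi], while its derivative in [x] is
   [(psi j - psi (j + 1)) / h], and [phi] and [psi] differ only near the two ends of a
   window of [K] cells: this is what makes the flux terms a factor [K] smaller. *)
Definition phi j x : R := spline (x / h - j%:~R) - spline (x / h - (j + K%:Z)%:~R).
Definition psi j x : R := ramp (x / h - j%:~R + 1) - ramp (x / h - (j + K%:Z)%:~R + 1).

Let castK j : (j + K%:Z)%:~R = j%:~R + K%:R :> R.
Proof. by rewrite intrD -pmulrn. Qed.

Lemma phi_itv j x : 0 <= phi j x <= 1.
Proof.
have := spline_itv (x / h - j%:~R); have := spline_itv (x / h - (j + K%:Z)%:~R).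
have : spline (x / h - (j + K%:Z)%:~R) <= spline (x / h - j%:~R).
  by apply: le_spline; rewrite lerD2l lerN2 castK lerDl.
rewrite /phi; lra.
Qed.

Lemma phi_out j x : x / h - j%:~R <= -1 \/ K%:R + 1 <= x / h - j%:~R -> phi j x = 0.
Proof.
have K0 : 0 <= K%:R :> R by [].
rewrite /phi castK => -[d|d].
  by rewrite !spline0 ?subrr//; lra.
by rewrite !spline1 ?subrr//; lra.
Qed.

Lemma psi_out j x : x / h - j%:~R <= -1 \/ K%:R + 1 <= x / h - j%:~R -> psi j x = 0.
Proof.
have K0 : 0 <= K%:R :> R by [].
rewrite /psi castK => -[d|d].
  by rewrite !ramp0 ?subrr//; lra.
by rewrite !ramp1 ?subrr//; lra.
Qed.

Lemma phi_win j x : phi j x <= win (-1) (K%:R + 1) j x.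
Proof.
have /andP[_ b] := phi_itv j x; apply: le_win => // d.
by rewrite phi_out//; case: d => d; [left|right]; exact: ltW.
Qed.

Lemma spline_step z : 0 <= spline z - spline (z - 1) <= 1 /\
  (z <= -1 \/ 2 <= z -> spline z - spline (z - 1) = 0).
Proof.
split.
  have : spline (z - 1) <= spline z by apply: le_spline; rewrite gerBl.
  by have := spline_itv z; have := spline_itv (z - 1); lra.
by case=> d; [rewrite !spline0 ?subrr//; lra|rewrite !spline1 ?subrr//; lra].
Qed.

Lemma ramp_spline z : `|ramp (z + 1) - spline z| <= 1 /\
  (z <= -1 \/ 1 <= z -> ramp (z + 1) - spline z = 0).
Proof.
split.
  by have := spline_itv z; have := ramp_itv (z + 1); rewrite ler_norml; lra.
case=> d; first by rewrite spline0// ramp0 ?subrr//; lra.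
by rewrite spline1// ramp1 ?subrr//; lra.
Qed.

Lemma win_shift p q j x : win p q (j + K%:Z) x = win (K%:R + p) (K%:R + q) j x.
Proof. by rewrite !winE castK opprD addrA lerBrDl lerBlDl. Qed.

Lemma dphi_win j x : `|phi (j + 1) x - phi j x| <=
  win (-2) 2 j x + win (K%:R - 2) (K%:R + 2) j x.
Proof.
have st i : spline (x / h - i%:~R) - spline (x / h - i%:~R - 1) <= win (-2) 2 i x.
  have [/andP[_ b] c] := spline_step (x / h - i%:~R).
  by apply: le_win => // d; rewrite c//; case: d => d; [left|right]; lra.
have -> : phi (j + 1) x - phi j x =
   (spline (x / h - (j + K%:Z)%:~R) - spline (x / h - (j + K%:Z)%:~R - 1)) -
   (spline (x / h - j%:~R) - spline (x / h - j%:~R - 1)).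
  rewrite /phi (addrAC j) !(intrD _ _ 1) !opprD !addrA; ring.
have [/andP[a1 _] _] := spline_step (x / h - (j + K%:Z)%:~R).
have [/andP[a2 _] _] := spline_step (x / h - j%:~R).
apply: (le_trans (ler_normB _ _)); rewrite !ger0_norm// addrC lerD// -win_shift.
exact: st.
Qed.

Lemma psi_phi_win j x : `|psi j x - phi j x| <=
  win (-2) 2 j x + win (K%:R - 2) (K%:R + 2) j x.
Proof.
have st i : `|ramp (x / h - i%:~R + 1) - spline (x / h - i%:~R)| <= win (-2) 2 i x.
  have [b c] := ramp_spline (x / h - i%:~R).
  by apply: le_win => // d; rewrite c ?normr0//; case: d => d; [left|right]; lra.
have -> : psi j x - phi j x =
   (ramp (x / h - j%:~R + 1) - spline (x / h - j%:~R)) -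
   (ramp (x / h - (j + K%:Z)%:~R + 1) - spline (x / h - (j + K%:Z)%:~R)).
  by rewrite /phi /psi; ring.
by apply: (le_trans (ler_normB _ _)); rewrite lerD// -win_shift.
Qed.

Definition inside a m x : Prop := K%:R + 2 <= x / h - a%:~R /\ x / h + 2 <= a%:~R + m%:R.

(** [phi] is a sum of [K] bumps of unit shift, and the sum of each over [i] telescopes; [inside]
    puts the two end values of the spline at 1 and 0. *)
Lemma sum_phi a m x : inside a m x -> \sum_(i < m) phi (a + i%:Z) x = K%:R.
Proof.
move=> [i1 i2]; have -> : K%:R = \sum_(l < K) (1 : R) by rewrite sumr_const card_ord.
pose s j := spline (x / h - j%:~R).
have phiE i : phi (a + i%:Z) x = \sum_(l < K) (s (a + l%:Z + i%:Z) - s (a + l%:Z + i.+1%:Z)).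
  rewrite -(big_mkord xpredT (fun l => s (a + l%:Z + i%:Z) - s (a + l%:Z + i.+1%:Z))).
  rewrite (eq_bigr (fun l => - (s (a + l.+1%:Z + i%:Z) - s (a + l%:Z + i%:Z)))); last first.
    move=> l _; rewrite opprB; congr (s _ - s _); lia.
  rewrite sumrN telescope_sumr// opprB /phi; congr (s _ - s _); lia.
under eq_bigr => i _ do rewrite phiE.
rewrite exchange_big; apply: eq_bigr => l _.
rewrite -(big_mkord xpredT (fun i => s (a + l%:Z + i%:Z) - s (a + l%:Z + i.+1%:Z))).
rewrite (eq_bigr (fun i => - (s (a + l%:Z + i.+1%:Z) - s (a + l%:Z + i%:Z)))); last first.
  by move=> i _; rewrite opprB.
have lK : l.+1%:R <= K%:R :> R by rewrite ler_nat.
have l0 : 0 <= l%:R :> R by [].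
rewrite -natr1 in lK.
rewrite sumrN telescope_sumr// opprB addr0 /s !intrD -!pmulrn.
rewrite spline1; last lra.
rewrite spline0 ?subr0//; lra.
Qed.

Lemma dist_le_variation (w : int -> R) a (i1 i2 : nat) : (i1 <= i2)%N ->
  `|w (a + i2%:Z) - w (a + i1%:Z)| <=
  \sum_(i1.+1 <= i < i2.+1) `|w (a + i%:Z) - w (a + i%:Z - 1)|.
Proof.
elim: i2 => [|i2 IH]; first by rewrite leqn0 => /eqP ->; rewrite subrr normr0 big_geq.
rewrite leq_eqVlt => /orP[/eqP <-|]; first by rewrite subrr normr0 big_geq.
rewrite ltnS => i12; rewrite big_nat_recr//=.
apply: le_trans (lerD (IH i12) (lexx _)).
rewrite (_ : a + i2.+1%:Z - 1 = a + i2%:Z); last by lia.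
by rewrite [leRHS]addrC; exact: ler_distD.
Qed.

Lemma variation_window (w D : int -> R) a m (i1 i2 : nat) : (i1 <= i2)%N -> (i2 < m)%N ->
  (forall j, 0 <= D j) ->
  (forall i, (i1 < i <= i2)%N -> 1 <= D (a + i%:Z)) ->
  `|w (a + i2%:Z) - w (a + i1%:Z)| <=
  \sum_(i < m) `|w (a + i%:Z) - w (a + i%:Z - 1)| * D (a + i%:Z).
Proof.
move=> i12 i2m D0 D1; apply: (le_trans (dist_le_variation _ _ i12)).
pose F i := `|w (a + i%:Z) - w (a + i%:Z - 1)| * D (a + i%:Z).
have F0 i : 0 <= F i by rewrite mulr_ge0.
apply: (@le_trans _ _ (\sum_(i1.+1 <= i < i2.+1) F i)).
  rewrite big_nat_cond [leRHS]big_nat_cond; apply: ler_sum => i; rewrite andbT => hi.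
  by rewrite -[leLHS]mulr1 ler_wpM2l// D1.
have i1m : (i1.+1 <= m)%N by exact: leq_ltn_trans i2m.
rewrite -(big_mkord xpredT F) [leRHS](@big_cat_nat _ _ _ i1.+1)//=.
rewrite [X in _ <= _ + X](@big_cat_nat _ _ _ i2.+1 i1.+1 m)//=.
by rewrite addrA addrAC lerDr addr_ge0// sumr_ge0.
Qed.

(** Where [phi i] does not vanish at [x], the cell of [x] is joined to cell [i] by a chain of cells
    whose windows all contain [x]. This trades the values of [W] weighted by [phi] for the value in
    the cell of [x], at the initial and the final time. *)
Lemma phi_oscillation (w : int -> R) a m x : inside a m x ->
  \sum_(i < m) phi (a + i%:Z) x * `|w (a + i%:Z) - w (cell_index h x)| <=
  K%:R * \sum_(i < m) `|w (a + i%:Z) - w (a + i%:Z - 1)| * win (-2) (K%:R + 2) (a + i%:Z) x.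
Proof.
move=> ins; have [i1 i2] := ins.
set RR := \sum_(i < m) `|w (a + i%:Z) - w (a + i%:Z - 1)| * win (-2) (K%:R + 2) (a + i%:Z) x.
have RR0 : 0 <= RR by apply: sumr_ge0 => i _; rewrite mulr_ge0 ?win_ge0.
have /andP[c1 c2] := cell_indexP x h0; set id := cell_index h x in c1 c2 *.
rewrite -ler_pdivlMr// in c1; rewrite -ltr_pdivrMr// in c2.
have K0 : 0 <= K%:R :> R by [].
have [l lE] : exists l : nat, id = a + l%:Z.
  have : (a < id)%R.
    rewrite -(ltr_int R); lra.
  by move=> al; exists (`|id - a|)%N; lia.
have lm : (l < m)%N.
  rewrite -(ltr_nat R).
  have e : id%:~R = a%:~R + l%:R :> R by rewrite lE intrD -pmulrn.
  by rewrite -(ltrD2l a%:~R) -e; lra.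
have e : id%:~R = a%:~R + l%:R :> R by rewrite lE intrD -pmulrn.
apply: (@le_trans _ _ (\sum_(i < m) phi (a + i%:Z) x * RR)); last first.
  by rewrite -mulr_suml sum_phi.
apply: ler_sum => i _; have [d|d] := lerP (x / h - (a + i%:Z)%:~R) (-1).
  by rewrite phi_out ?mul0r//; left.
have [d'|d'] := lerP (K%:R + 1) (x / h - (a + i%:Z)%:~R).
  by rewrite phi_out ?mul0r//; right.
rewrite ler_wpM2l//; first by case/andP: (phi_itv (a + i%:Z) x).
rewrite intrD -pmulrn in d d'.
have [il|/ltnW li] := leqP i l.
  rewrite lE distrC; apply: (@variation_window w (fun j => win (-2) (K%:R + 2) j x) a m _ _ il lm).
    by move=> j; exact: win_ge0.
  move=> k /andP[k1 k2]; rewrite win1// intrD -pmulrn.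
  have : i%:R <= k%:R :> R by rewrite ler_nat ltnW.
  have : k%:R <= l%:R :> R by rewrite ler_nat.
  lra.
rewrite lE; apply: (@variation_window w (fun j => win (-2) (K%:R + 2) j x) a m _ _ li (ltn_ord i)).
  by move=> j; exact: win_ge0.
move=> k /andP[k1 k2]; rewrite win1// intrD -pmulrn.
have : l%:R <= k%:R :> R by rewrite ler_nat ltnW.
have : k%:R <= i%:R :> R by rewrite ler_nat.
lra.
Qed.

End Windows.

(** * A cutoff for finite speed of propagation *)

Section Cone.
Context {R : realType}.
Variables (L r : R).
Hypothesis L0 : 0 <= L.
Implicit Types t x : R.

Let p t x : R := - L * t + -1 * x + r.
Let q t x : R := - L * t + 1 * x + r.

(* A cutoff decreasing along all speeds up to [L], so that its derivatives contribute to
   the entropy inequality with a sign. *)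
Definition cone t x : R := spline (p t x) * spline (q t x).
Definition cone_t t x : R :=
  spline (p t x) * (- L * hat (q t x)) + spline (q t x) * (- L * hat (p t x)).
Definition cone_x t x : R :=
  spline (p t x) * (1 * hat (q t x)) + spline (q t x) * (-1 * hat (p t x)).

Lemma cone_C1 : C1_with cone cone_t cone_x.
Proof. exact: C1_withM (C1_ridge _ _ _) (C1_ridge _ _ _). Qed.

Lemma cone_itv t x : 0 <= cone t x <= 1.
Proof.
have /andP[a b] := spline_itv (p t x); have /andP[c d] := spline_itv (q t x).
by rewrite /cone mulr_ge0//= mulr_ile1.
Qed.

Lemma cone_transport t x : cone_t t x + L * `|cone_x t x| <= 0.
Proof.
have /andP[a _] := spline_itv (p t x); have /andP[c _] := spline_itv (q t x).
have ha := hat_ge0 (p t x); have hc := hat_ge0 (q t x).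
have : `|cone_x t x| <= spline (p t x) * hat (q t x) + spline (q t x) * hat (p t x).
  apply: (le_trans (ler_normD _ _)); rewrite mul1r mulN1r mulrN normrN.
  by rewrite (ger0_norm (mulr_ge0 a hc)) (ger0_norm (mulr_ge0 c ha)).
move=> /(ler_wpM2l L0); rewrite /cone_t; lra.
Qed.

Lemma cone_out t x : 0 <= t -> r + 1 < `|x| -> cone t x = 0.
Proof.
move=> t0 h; rewrite /cone; have Lt : 0 <= L * t by rewrite mulr_ge0.
have [x0|x0] := leP 0 x.
  by rewrite (ger0_norm x0) in h; rewrite (@spline0 _ (p t x)) ?mul0r// /p; lra.
by rewrite (ltr0_norm x0) in h; rewrite (@spline0 _ (q t x)) ?mulr0// /q; lra.
Qed.

Lemma cone1 t x : `|x| + L * t + 1 <= r -> cone t x = 1.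
Proof.
move=> h; have := ler_norm x; have := ler_norm (- x); rewrite normrN => ? ?.
by rewrite /cone !spline1 ?mulr1// /p /q; lra.
Qed.

End Cone.

(** * The Kuznetsov estimate *)

Section Kuznetsov.
Context {R : realType}.
Notation mu := (@lebesgue_measure R).
Notation J f := (\int[@lebesgue_measure R]_x f x).
Variables (V : R -> R) (vM lV lambda h : R) (K : nat).
Hypotheses (hV : velocity V vM lV) (l0 : 0 < lambda) (h0 : 0 < h).
Let tau := lambda * h.
Let C := 2 * (vM + lV).
Let tau0 : 0 < tau. Proof. exact: mulr_gt0. Qed.
Let C0 : 0 <= C. Proof. by case: hV => *; rewrite /C; lra. Qed.
Let Cn (y : R) : 0 <= C * `|y|. Proof. exact: mulr_ge0. Qed.
Implicit Types (t x : R) (n : nat) (j : int).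

(* The offset at [n = 0] makes [zeta 0 = 1] and [eta 0 = 0] for all [t >= 0]. *)
Definition zoff n : R := if n is 0%N then 1 else - n%:R.
Definition zeta n t : R := spline (t / tau + zoff n).
Definition eta n t : R := hat (t / tau + zoff n).
Definition theta n t : R := zeta n t - zeta n.+1 t.
(** A piecewise linear step minus a quadratic one. It is localised in a few time steps, and its
    differences are the mismatch of the weights [eta n.+1] and [theta n], see [etaE]. *)
Definition dlt n t : R := ramp (t / tau - n%:R) - zeta n t.
Definition tw n : R -> R := win tau (-1) 2 n%:Z.
Notation phi := (phi h K).
Notation psi := (psi h K).

Let phi01 j x : 0 <= phi j x <= 1. Proof. exact: phi_itv. Qed.

Lemma eta_ge0 n t : 0 <= eta n t. Proof. exact: hat_ge0. Qed.

Lemma zeta_le n t : zeta n.+1 t <= zeta n t.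
Proof.
apply: le_spline; rewrite lerD2l; case: n => [|n] /=; first lra.
by rewrite lerN2 ler_nat.
Qed.

Lemma theta_ge0 n t : 0 <= theta n t. Proof. by rewrite subr_ge0 zeta_le. Qed.

Lemma eta0 t : 0 <= t -> eta 0 t = 0.
Proof.
move=> t0; apply: hat0; right => /=; rewrite lerDr divr_ge0// ltW//.
Qed.

Lemma etaE n t : eta n.+1 t - theta n t = dlt n t - dlt n.+1 t.
Proof.
rewrite /theta /dlt /eta /hat /=.
rewrite (_ : t / tau - n.+1%:R + 1 = t / tau - n%:R); last by rewrite -natr1; ring.
by ring.
Qed.

Lemma eta_tw n t : eta n.+1 t <= tw n t.
Proof.
apply: le_win => //; first exact: hat_le1.
rewrite -pmulrn => d; rewrite /eta hat0//= -natr1.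
by case: d => d; [left|right]; lra.
Qed.

Lemma theta_tw n t : 0 <= t -> theta n t <= tw n t.
Proof.
move=> t0; have z0 : 0 <= t / tau by rewrite divr_ge0// ltW.
apply: le_win => //.
  have := spline_itv (t / tau + zoff n); have := spline_itv (t / tau + zoff n.+1).
  by rewrite /theta /zeta; lra.
rewrite -pmulrn => d; rewrite /theta /zeta.
case: n d => [|n] /= d.
  by rewrite !spline1 ?subrr//; case: d => d; lra.
have e : n.+2%:R = n.+1%:R + 1 :> R by rewrite -natr1.
case: d => d; first by rewrite !spline0 ?subrr// ?e; lra.
by rewrite !spline1 ?subrr// ?e; lra.
Qed.

Lemma dltS_tw n t : `|dlt n.+1 t| <= tw n t.
Proof.
have := spline_itv (t / tau - n.+1%:R); have := ramp_itv (t / tau - n.+1%:R) => a b.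
rewrite /dlt /zeta /=; apply: le_win => //; first by rewrite ler_norml; lra.
rewrite -pmulrn -natr1 => d; case: d => d; first by rewrite ramp0 ?spline0 ?subrr ?normr0//; lra.
by rewrite ramp1 ?spline1 ?subrr ?normr0//; lra.
Qed.

Lemma dlt0_tw t : 0 <= t -> `|dlt 0 t| <= tw 0 t.
Proof.
move=> t0; have z0 : 0 <= t / tau by rewrite divr_ge0// ltW.
have := spline_itv (t / tau + 1); have := ramp_itv (t / tau - 0) => a b.
rewrite /dlt /zeta /=; apply: le_win => //; first by rewrite ler_norml; lra.
rewrite subr0 => d; rewrite (@spline1 _ (t / tau + 1)); last lra.
by rewrite ramp1 ?subrr ?normr0//; case: d => d; lra.
Qed.

Lemma tw_ge0 n t : 0 <= tw n t. Proof. exact: win_ge0. Qed.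

Section Test.
Variable r : R.
Notation eco := (cone C r).

Definition testf n j t x : R := theta n t * phi j x * eco t x.

Lemma psi_step j x : psi j x - psi (j + 1) x = hat (x / h - j%:~R) - hat (x / h - (j + K%:Z)%:~R).
Proof.
rewrite /psi /hat (addrAC j) !(intrD _ _ 1).
rewrite (_ : x / h - (j%:~R + 1) + 1 = x / h - j%:~R); last by ring.
rewrite (_ : x / h - ((j + K%:Z)%:~R + 1) + 1 = x / h - (j + K%:Z)%:~R); last by ring.
by ring.
Qed.

Lemma testf_C1 n j : [/\ C1 (testf n j),
  forall t x, dt (testf n j) t x =
    (eta n t - eta n.+1 t) / tau * phi j x * eco t x + theta n t * phi j x * cone_t C r t x &
  forall t x, dx (testf n j) t x =
    theta n t * ((psi j x - psi (j + 1) x) / h) * eco t x + theta n t * phi j x * cone_x C r t x].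
Proof.
have a := C1_withB (C1_ridge tau^-1 0 (zoff n)) (C1_ridge tau^-1 0 (zoff n.+1)).
have b := C1_withB (C1_ridge 0 h^-1 (- j%:~R)) (C1_ridge 0 h^-1 (- (j + K%:Z)%:~R)).
have [] := C1_withE (C1_withM (C1_withM a b) (cone_C1 C r)).
set f := fun t x : R => _ => c1 c2 c3.
have fE : f = testf n j.
  apply/funext => t; apply/funext => x; rewrite /f /testf /theta /zeta /phi.
  by rewrite !mul0r !addr0 !add0r ![_^-1 * _]mulrC.
rewrite fE in c1 c2 c3; split => // t x.
  rewrite c2 /theta /zeta /eta /phi !mul0r !addr0 !add0r ![tau^-1 * t]mulrC ![h^-1 * x]mulrC.
  by ring.
rewrite c3 psi_step /theta /zeta /eta /phi !mul0r !addr0 !add0r ![tau^-1 * t]mulrC ![h^-1 * x]mulrC.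
by ring.
Qed.

Lemma testf_ge0 n j t x : 0 <= testf n j t x.
Proof.
have /andP[a _] := phi01 j x; have /andP[b _] := cone_itv C r t x.
by rewrite mulr_ge0// mulr_ge0// theta_ge0.
Qed.

Lemma testf_test n j : test_function (testf n j).
Proof.
have [c _ _] := testf_C1 n j; split => //; last by move=> t x _; exact: testf_ge0.
apply: (@compact_support_box _ _ ((n%:R + 2) * tau + (`|j%:~R| + K%:R + 1) * h)) => t x.
have n0 : 0 <= (n%:R + 2) * tau by rewrite mulr_ge0// ltW.
have x0 : 0 <= (`|j%:~R| + K%:R + 1) * h by rewrite mulr_ge0 ?addr_ge0// ltW.
rewrite /testf !mulf_eq0 !negb_or => /andP[/andP[th ph] _]; split.
  apply: (@le_trans _ _ ((n%:R + 2) * tau)); last by rewrite lerDl.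
  rewrite -ler_pdivrMr// -[X in _ / X](gtr0_norm tau0) -normf_div leNgt; apply/negP => ht.
  move: th; rewrite /theta /zeta /= => /eqP; apply.
  have zn' i : -1 <= i%:R + zoff i <= 1 /\ zoff i <= 1.
    case: i => [|i] /=; first by split; lra.
    by have i0 : 0 <= i.+1%:R :> R by []; split; lra.
  have [zn zp] := zn' n.
  move: ht; have [t0|t0] := ger0P (t / tau).
    by rewrite -natr1 => ht; rewrite !spline1 ?subrr//; lra.
  have n1 : 0 <= n%:R :> R by [].
  by rewrite -natr1 => ht; rewrite !spline0 ?subrr//; lra.
apply: (@le_trans _ _ ((`|j%:~R| + K%:R + 1) * h)); last by rewrite lerDr.
rewrite -ler_pdivrMr// -[X in _ / X](gtr0_norm h0) -normf_div leNgt; apply/negP => hx.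
move: ph => /eqP; apply; apply: phi_out.
have K0 : 0 <= K%:R :> R by [].
have j1 := ler_norm (j%:~R : R); have := ler_norm (- j%:~R : R); rewrite normrN => j2.
move: hx; have [y0|y0] := ger0P (x / h); [right|left]; lra.
Qed.

Variables (u : R -> R -> R) (W E : nat -> int -> R) (Phi : nat -> R -> int -> R).
Hypothesis u01 : forall t x, 0 <= t -> 0 <= u t x <= 1.
Hypothesis W01 : forall n j, 0 <= W n j <= 1.
Hypothesis Went : forall n k j, 0 <= k <= 1 ->
  `|W n.+1 j - k| <= `|W n j - k| + lambda * (Phi n k (j - 1) - Phi n k j) /\
  `|Phi n k j - kflux V (W n j) k| <= E n j.
Variables (N m : nat) (a : int).

Definition eslice n j t x : R :=
  `|u t x - W n j| * dt (testf n j) t x + kflux V (u t x) (W n j) * dx (testf n j) t x.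

(** The terms with derivatives of the cutoff are discarded: the entropy flux is at most [C] times
    the distance of the states, and the cutoff decreases along all speeds up to [C]. *)
Lemma eslice_le n j t x : 0 <= t -> tau * eslice n j t x <=
  eco t x * ((eta n t - eta n.+1 t) * (`|W n j - u t x| * phi j x) +
    lambda * (theta n t * (kflux V (W n j) (u t x) * (psi j x - psi (j + 1) x)))).
Proof.
move=> t0; have [_ e1 e2] := testf_C1 n j; rewrite /eslice e1 e2.
have U := u01 x t0; have Wn := W01 n j.
rewrite (kfluxC hV)// distrC.
set A := `|W n j - u t x|; set Q := kflux _ _ _.
have hh := gt_eqF h0; have ht := gt_eqF tau0; have hl := gt_eqF l0.
have -> : tau * (A * ((eta n t - eta n.+1 t) / tau * phi j x * eco t x + theta n t * phi j x * cone_t C r t x) +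
    Q * (theta n t * ((psi j x - psi (j + 1) x) / h) * eco t x + theta n t * phi j x * cone_x C r t x)) =
  eco t x * ((eta n t - eta n.+1 t) * (A * phi j x) +
    lambda * (theta n t * (Q * (psi j x - psi (j + 1) x)))) +
  tau * (theta n t * phi j x) * (A * cone_t C r t x + Q * cone_x C r t x).
  by rewrite /tau; field; rewrite hh hl.
rewrite gerDl; apply: mulr_ge0_le0.
  apply: mulr_ge0; first exact: ltW tau0.
  by apply: mulr_ge0; [exact: theta_ge0|case/andP: (phi01 j x)].
have QA : `|Q| <= C * A.
  have := kflux_lip hV Wn U U; rewrite -/Q [kflux V (u t x) (u t x)]/kflux.
  by rewrite !subrr !normr0 !mulr0 !subr0.
have A0 : 0 <= A by exact: normr_ge0.
apply: (@le_trans _ _ (A * (cone_t C r t x + C * `|cone_x C r t x|))).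
  rewrite [leRHS]mulrDr lerD2l (le_trans (ler_norm _))// normrM mulrCA mulrA.
  exact: ler_wpM2r.
by rewrite mulr_ge0_le0// cone_transport.
Qed.

Definition coef n j : R :=
  E n j + C * `|W n.+1 j - W n j| + C * `|W n j - W n (j - 1)|.
(** Errors of a single time step live in two windows of four cells, so their integral is free of
    [K]; those of the initial and final times, in [Yerr], extend over about [K] cells. *)
Definition Xerr n x : R :=
  \sum_(i < m) coef n (a + i%:Z) * win h (-2) 2 (a + i%:Z) x +
  \sum_(i < m) coef n (a + i%:Z) * win h (K%:R - 2) (K%:R + 2) (a + i%:Z) x.
Definition Yerr (p q : R) n x : R :=
  \sum_(i < m) `|W n (a + i%:Z) - W n (a + i%:Z - 1)| * win h p q (a + i%:Z) x.
Definition total_err t x : R :=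
  lambda * (\sum_(n < N.+1) tw n t * Xerr n x +
    tw 0 t * (C * Yerr (-1) (K%:R + 1) 0 x) + 2 * tw N t * (C * Yerr (-1) (K%:R + 1) N x)) +
  tw N t * (K%:R * Yerr (-2) (K%:R + 2) N x).

Lemma E_ge0 n j : 0 <= E n j.
Proof.
have k01 : 0 <= (0 : R) <= 1 by rewrite lexx ler01.
have [_ h1] := Went n j k01; exact: le_trans h1.
Qed.

Lemma coef_ge0 n j : 0 <= coef n j.
Proof. by rewrite /coef !addr_ge0 ?E_ge0// mulr_ge0. Qed.

Lemma Xerr_ge0 n x : 0 <= Xerr n x.
Proof.
by rewrite addr_ge0// sumr_ge0// => i _; rewrite mulr_ge0 ?coef_ge0 ?win_ge0.
Qed.

Lemma Yerr_ge0 p q n x : 0 <= Yerr p q n x.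
Proof. by rewrite sumr_ge0// => i _; rewrite mulr_ge0 ?win_ge0. Qed.

Lemma total_err_ge0 t x : 0 <= total_err t x.
Proof.
rewrite addr_ge0//.
  rewrite mulr_ge0 ?(ltW l0)// !addr_ge0//.
  - by rewrite sumr_ge0// => n _; rewrite mulr_ge0 ?tw_ge0 ?Xerr_ge0.
  - by rewrite mulr_ge0 ?tw_ge0// mulr_ge0 ?Yerr_ge0.
  - apply: mulr_ge0; first by rewrite mulr_ge0 ?tw_ge0.
    by apply: mulr_ge0 => //; exact: Yerr_ge0.
by rewrite mulr_ge0 ?tw_ge0// mulr_ge0 ?Yerr_ge0.
Qed.

(** [inside] is what makes [phi] and [psi] vanish at both ends of the index range, as the summation
    by parts requires, and makes the values of [phi] sum to [K] in the final term. *)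
Lemma comparison_inside t x : 0 <= t -> inside h K a m x ->
  \sum_(n < N.+1) \sum_(i < m)
    ((eta n t - eta n.+1 t) * (`|W n (a + i%:Z) - u t x| * phi (a + i%:Z) x) +
     lambda * (theta n t * (kflux V (W n (a + i%:Z)) (u t x) *
       (psi (a + i%:Z) x - psi (a + i%:Z + 1) x)))) +
  eta N.+1 t * (K%:R * `|u t x - W N (cell_index h x)|) <= total_err t x.
Proof.
move=> t0 ins; have [i1 i2] := ins; have U := u01 x t0.
have am : (a + m%:Z)%:~R = a%:~R + m%:R :> R by rewrite intrD -pmulrn.
have oa : x / h - a%:~R <= -1 \/ K%:R + 1 <= x / h - a%:~R by right; lra.
have om : x / h - (a + m%:Z)%:~R <= -1 \/ K%:R + 1 <= x / h - (a + m%:Z)%:~R.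
  by left; rewrite am; lra.
have ql n n' j j' : `|kflux V (W n j) (u t x) - kflux V (W n' j') (u t x)| <=
    C * `|W n j - W n' j'| by exact: (kflux_lip hV).
have ent n j : `|W n.+1 j - u t x| <= `|W n j - u t x| +
    lambda * (Phi n (u t x) (j - 1) - Phi n (u t x) j) by exact: (Went n j U).1.
have con n j : `|Phi n (u t x) j - kflux V (W n j) (u t x)| <= E n j by exact: (Went n j U).2.
have := @discrete_comparison R lambda C N m a (fun n j => `|W n j - u t x|)
  (fun n j => kflux V (W n j) (u t x)) (fun n j => Phi n (u t x) j) E W
  (fun j => phi j x) (fun j => psi j x) (eta ^~ t) (theta ^~ t) (dlt ^~ t) (ltW l0)
  (fun j => proj1 (andP (phi01 j x)))
  (phi_out oa) (phi_out om) (psi_out oa) (psi_out om)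
  ent con ql (eta0 t0) (fun n => eta_ge0 n t) (fun n => theta_ge0 n t) (fun n => etaE n t).
set LHS := \sum_(n < N.+1) _; set AN := \sum_(i < m) _ => cmp.
have AN_ge : K%:R * `|u t x - W N (cell_index h x)| <= AN + K%:R * Yerr (-2) (K%:R + 2) N x.
  rewrite -(sum_phi h0 ins) mulr_suml.
  apply: (@le_trans _ _ (\sum_(i < m) (`|W N (a + i%:Z) - u t x| * phi (a + i%:Z) x +
     phi (a + i%:Z) x * `|W N (a + i%:Z) - W N (cell_index h x)|))).
    apply: ler_sum => i _; rewrite [_ * phi _ _]mulrC -mulrDr ler_wpM2l//.
      by case/andP: (phi01 (a + i%:Z) x).
    by rewrite [`|W N _ - u t x|]distrC; exact: ler_distD.
  by rewrite big_split/= lerD2l (sum_phi h0 ins) phi_oscillation.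
have {AN_ge} AN2 : eta N.+1 t * (K%:R * `|u t x - W N (cell_index h x)|) <=
    eta N.+1 t * AN + tw N t * (K%:R * Yerr (-2) (K%:R + 2) N x).
  apply: (le_trans (ler_wpM2l (eta_ge0 N.+1 t) AN_ge)); rewrite mulrDr lerD2l.
  by rewrite ler_wpM2r ?eta_tw// mulr_ge0 ?Yerr_ge0.
apply: (le_trans (lerD (lexx LHS) AN2)); rewrite addrA /total_err lerD2r.
apply: (le_trans cmp); rewrite ler_wpM2l ?(ltW l0)//.
pose om' j := win h (-2) 2 j x + win h (K%:R - 2) (K%:R + 2) j x.
have om0 j : 0 <= om' j by rewrite addr_ge0 ?win_ge0.
pose S1 n := \sum_(i < m) E n (a + i%:Z) * om' (a + i%:Z).
pose S2 n := \sum_(i < m) C * `|W n (a + i%:Z) - W n (a + i%:Z - 1)| * om' (a + i%:Z).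
pose S3 n := \sum_(i < m) C * `|W n.+1 (a + i%:Z) - W n (a + i%:Z)| * om' (a + i%:Z).
have XE n : Xerr n x = S1 n + S3 n + S2 n.
  rewrite /Xerr /S1 /S2 /S3 -!big_split/=; apply: eq_bigr => i _; rewrite /coef /om'; ring.
have S10 n : 0 <= S1 n by rewrite sumr_ge0// => i _; rewrite mulr_ge0 ?E_ge0.
have S30 n : 0 <= S3 n by rewrite sumr_ge0// => i _; rewrite mulr_ge0 ?Cn.
have extend (f g : nat -> R) : (forall n, 0 <= f n <= tw n t) -> (forall n, 0 <= g n) ->
    \sum_(n < N) f n * g n <= \sum_(n < N.+1) tw n t * g n.
  move=> fb g0; rewrite big_ord_recr/= -[leLHS]addr0 lerD ?mulr_ge0 ?tw_ge0//.
  by apply: ler_sum => n _; rewrite ler_wpM2r//; case/andP: (fb n).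
have b1 : \sum_(n < N) eta n.+1 t * (\sum_(i < m) E n (a + i%:Z) *
    `|phi (a + i%:Z + 1) x - phi (a + i%:Z) x|) <= \sum_(n < N.+1) tw n t * S1 n.
  apply: (@le_trans _ _ (\sum_(n < N) eta n.+1 t * S1 n)).
    apply: ler_sum => n _; rewrite ler_wpM2l ?eta_ge0//; apply: ler_sum => i _.
    by rewrite ler_wpM2l ?E_ge0// dphi_win.
  by apply: (extend (fun n => eta n.+1 t)) => // n; rewrite eta_ge0 eta_tw.
have b2 : \sum_(n < N.+1) theta n t * (\sum_(i < m) C *
    `|W n (a + i%:Z) - W n (a + i%:Z - 1)| * `|psi (a + i%:Z) x - phi (a + i%:Z) x|) <=
    \sum_(n < N.+1) tw n t * S2 n.
  apply: ler_sum => n _; apply: ler_pM.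
  - exact: theta_ge0.
  - by rewrite sumr_ge0// => i _; rewrite mulr_ge0 ?Cn.
  - exact: theta_tw.
  - by apply: ler_sum => i _; rewrite ler_wpM2l ?Cn// psi_phi_win.
have b3 : \sum_(n < N) `|dlt n.+1 t| * (\sum_(i < m) C *
    `|W n.+1 (a + i%:Z) - W n (a + i%:Z)| * `|phi (a + i%:Z + 1) x - phi (a + i%:Z) x|) <=
    \sum_(n < N.+1) tw n t * S3 n.
  apply: (@le_trans _ _ (\sum_(n < N) `|dlt n.+1 t| * S3 n)).
    apply: ler_sum => n _; rewrite ler_wpM2l//; apply: ler_sum => i _.
    by rewrite ler_wpM2l ?Cn// dphi_win.
  by apply: (extend (fun n => `|dlt n.+1 t|)) => // n; rewrite normr_ge0 dltS_tw.
have bY n : \sum_(i < m) C * `|W n (a + i%:Z) - W n (a + i%:Z - 1)| * phi (a + i%:Z) x <=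
    C * Yerr (-1) (K%:R + 1) n x.
  rewrite mulr_sumr; apply: ler_sum => i _.
  by rewrite -mulrA ler_wpM2l// ler_wpM2l// phi_win.
have bY0 n : 0 <= \sum_(i < m) C * `|W n (a + i%:Z) - W n (a + i%:Z - 1)| * phi (a + i%:Z) x.
  rewrite sumr_ge0// => i _; rewrite mulr_ge0 ?Cn//.
  by case/andP: (phi01 (a + i%:Z) x).
have b4 := ler_pM (normr_ge0 _) (bY0 0%N) (dlt0_tw t0) (bY 0%N).
have b5 : (`|dlt N.+1 t| + eta N.+1 t) *
   (\sum_(i < m) C * `|W N (a + i%:Z) - W N (a + i%:Z - 1)| * phi (a + i%:Z) x) <=
   2 * tw N t * (C * Yerr (-1) (K%:R + 1) N x).
  apply: ler_pM => //; first by rewrite addr_ge0 ?eta_ge0.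
  by rewrite mulr_natl mulr2n lerD ?dltS_tw ?eta_tw.
have -> : \sum_(n < N.+1) tw n t * Xerr n x = \sum_(n < N.+1) tw n t * S1 n +
    \sum_(n < N.+1) tw n t * S2 n + \sum_(n < N.+1) tw n t * S3 n.
  by rewrite -!big_split/=; apply: eq_bigr => n _; rewrite XE; ring.
by apply: lerD b5; apply: lerD b4; apply: lerD b3; apply: lerD b1 b2.
Qed.

Lemma eslice_sum_le t x : 0 <= t -> (`|x| <= r + 1 -> inside h K a m x) ->
  K%:R * (eta N.+1 t * (eco t x * `|u t x - W N (cell_index h x)|)) +
  tau * (\sum_(n < N.+1) \sum_(i < m) eslice n (a + i%:Z) t x) <= total_err t x.
Proof.
move=> t0 ins; have /andP[co0 co1] := cone_itv C r t x.
set LL := \sum_(n < N.+1) \sum_(i < m)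
    ((eta n t - eta n.+1 t) * (`|W n (a + i%:Z) - u t x| * phi (a + i%:Z) x) +
     lambda * (theta n t * (kflux V (W n (a + i%:Z)) (u t x) *
       (psi (a + i%:Z) x - psi (a + i%:Z + 1) x)))).
have h1 : tau * (\sum_(n < N.+1) \sum_(i < m) eslice n (a + i%:Z) t x) <= eco t x * LL.
  rewrite /LL !mulr_sumr; apply: ler_sum => n _; rewrite !mulr_sumr; apply: ler_sum => i _.
  exact: eslice_le.
have [xr|xr] := leP `|x| (r + 1); last first.
  by move: h1; rewrite (cone_out C0 t0 xr) !mul0r mulr0 mulr0 add0r => /le_trans; apply;
    exact: total_err_ge0.
have h2 := comparison_inside t0 (ins xr); rewrite -/LL in h2.
have h3 : eco t x * (LL + eta N.+1 t * (K%:R * `|u t x - W N (cell_index h x)|)) <= total_err t x.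
  apply: (le_trans (ler_wpM2l co0 h2)); rewrite -[leRHS]mul1r ler_wpM2r//.
  exact: total_err_ge0.
apply: le_trans h3; rewrite mulrDr [leRHS]addrC lerD// le_eqVlt; apply/orP; left; apply/eqP; ring.
Qed.

Hypothesis mu_ : measurable_fun [set z : R * R | 0 <= z.1] (fun z : R * R => u z.1 z.2).
Variables (T S : R).
Hypothesis WT : forall n, wsum_le (fun j => `|W n (j + 1) - W n j|) T.
Hypothesis WtT : forall n, wsum_le (fun j => `|W n.+1 j - W n j|) T.
Hypothesis ES : forall n, wsum_le (E n) S.

Let WT' n : wsum_le (fun j => `|W n j - W n (j - 1)|) T.
Proof.
apply: wsum_le_le (wsum_le_shift (-1) (WT n)) => j /=.
by rewrite subrK.
Qed.

Let TT0 : 0 <= T. Proof. exact: wsum_le_ge0 (WT 0). Qed.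

Lemma coef_wsum n : wsum_le (coef n) (S + C * T + C * T).
Proof.
apply: wsum_leD; last exact: wsum_leM (WT' n).
by apply: wsum_leD; [exact: ES|exact: wsum_leM (WtT n)].
Qed.

Lemma Xerr_int n : L1 (Xerr n) /\ J (Xerr n) <= 8 * h * (S + C * T + C * T).
Proof.
have p1 : -2 <= 2 :> R by lra.
have p2 : K%:R - 2 <= K%:R + 2 :> R by lra.
have [a1 b1] := wsum_win h0 a m p1 (coef_ge0 n) (coef_wsum n).
have [a2 b2] := wsum_win h0 a m p2 (coef_ge0 n) (coef_wsum n).
split; first exact: L1D.
rewrite J_D//; lra.
Qed.

Lemma Yerr_int p q n : p <= q -> L1 (Yerr p q n) /\ J (Yerr p q n) <= (q - p) * h * T.
Proof. by move=> pq; apply: (wsum_win h0 a m pq (fun j => normr_ge0 _) (WT' n)). Qed.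

Definition time_err t : R :=
  \sum_(n < N.+1) (lambda * (8 * h * (S + C * T + C * T))) * tw n t +
  lambda * (C * ((K%:R + 2) * h * T)) * tw 0 t +
  (2 * (lambda * (C * ((K%:R + 2) * h * T))) + K%:R * ((K%:R + 4) * h * T)) * tw N t.

Lemma total_err_int t : L1 (total_err t) /\ J (total_err t) <= time_err t.
Proof.
have K0 : 0 <= K%:R :> R by [].
have p1 : -1 <= K%:R + 1 :> R by lra.
have p2 : -2 <= K%:R + 2 :> R by lra.
have [y0 y0'] := Yerr_int 0 p1; have [yN yN'] := Yerr_int N p1; have [r1 r2] := Yerr_int N p2.
have Lx n : L1 (fun x => tw n t * Xerr n x) by apply: L1Z; case: (Xerr_int n).
have LX := @L1_sum R N.+1 (fun n x => tw n t * Xerr n x) Lx.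
have Ly0 : L1 (fun x => tw 0 t * (C * Yerr (-1) (K%:R + 1) 0 x)) by apply: L1Z; exact: L1Z.
have LyN : L1 (fun x => 2 * tw N t * (C * Yerr (-1) (K%:R + 1) N x)) by apply: L1Z; exact: L1Z.
have Lr : L1 (fun x => tw N t * (K%:R * Yerr (-2) (K%:R + 2) N x)) by apply: L1Z; exact: L1Z.
have L12 := L1D (L1D LX Ly0) LyN.
split; first by apply: L1D => //; exact: L1Z.
rewrite /total_err J_D//; last exact: L1Z.
rewrite J_Z// J_D//; last exact: L1D.
rewrite J_D// (@J_sum R N.+1 (fun n x => tw n t * Xerr n x))//.
rewrite !J_Z//; try exact: L1Z.
rewrite /time_err; set D := S + C * T + C * T.
rewrite [X in X + _ <= _]mulrDr [X in X + _ + _ <= _]mulrDr mulr_sumr -!addrA; apply: lerD.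
  apply: ler_sum => n _; have [xa xb] := Xerr_int n; rewrite -/D in xb.
  by rewrite J_Z// mulrCA [leRHS]mulrC ler_wpM2l ?tw_ge0// ler_wpM2l ?(ltW l0).
have e1 : K%:R + 1 - -1 = K%:R + 2 :> R by ring.
have e2 : K%:R + 2 - -2 = K%:R + 4 :> R by ring.
rewrite e1 in y0' yN'; rewrite e2 in r2.
apply: lerD.
  by rewrite mulrCA [leRHS]mulrC ler_wpM2l ?tw_ge0// ler_wpM2l ?(ltW l0)// ler_wpM2l.
rewrite [leRHS]mulrDl; apply: lerD; last first.
  by rewrite [leRHS]mulrC ler_wpM2l ?tw_ge0// ler_wpM2l.
rewrite (_ : lambda * _ = 2 * (lambda * (C * J (Yerr (-1) (K%:R + 1) N))) * tw N t); last by ring.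
by rewrite ler_wpM2r ?tw_ge0// ler_wpM2l// ler_wpM2l ?(ltW l0)// ler_wpM2l.
Qed.

Lemma tw_int n : L1 (tw n) /\ J (tw n) = 3 * tau.
Proof.
have p1 : -1 <= 2 :> R by lra.
split; first exact: win_L1.
by rewrite /tw J_win//; congr (_ * _); ring.
Qed.

Lemma time_err_int : L1 time_err /\ J time_err = 3 * tau *
  (N.+1%:R * (lambda * (8 * h * (S + C * T + C * T))) +
   3 * (lambda * (C * ((K%:R + 2) * h * T))) + K%:R * ((K%:R + 4) * h * T)).
Proof.
have L0 n c : L1 (fun t => c * tw n t) by apply: L1Z; case: (tw_int n).
have LS := @L1_sum R N.+1 (fun n t => lambda * (8 * h * (S + C * T + C * T)) * tw n t)
  (fun n => L0 n _).
split; first by apply: L1D => //; exact: L1D.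
rewrite /time_err J_D//; last exact: L1D.
rewrite J_D// (@J_sum R N.+1 (fun n t => lambda * (8 * h * (S + C * T + C * T)) * tw n t))//.
have JT n c : J (fun t => c * tw n t) = c * (3 * tau).
  by have [a1 b1] := tw_int n; rewrite J_Z// b1.
rewrite !JT; under eq_bigr => n _ do rewrite JT.
rewrite sumr_const card_ord -mulr_natl; ring.
Qed.

Lemma time_err_ge0 t : 0 <= time_err t.
Proof.
have [_ b] := total_err_int t; apply: le_trans b; apply: J_ge0 => x; exact: total_err_ge0.
Qed.

End Test.

Section Estimate.
Variables (u : R -> R -> R) (W : nat -> int -> R) (u0 : R -> R) (T S I0 : R).
Hypotheses (fu0 : field u0) (eu : entropy_solution V u0 u).
Hypothesis eW : discrete_entropy V lambda W T S.
Hypothesis initial : (\int[mu]_x `|u0 x - W 0%N (cell_index h x)|%:E <= I0%:E)%E.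
Variables (N : nat) (M : R).
Hypothesis M0 : 0 <= M.

Definition weighted_gap t x : R :=
  eta N.+1 t * (\1_(`[- M, M]) x * `|u t x - W N (cell_index h x)|).

Lemma measurable_gap : measurable_fun [set z : R * R | 0 <= z.1]
  (fun z : R * R => u z.1 z.2 - W N (cell_index h z.2)).
Proof.
have [m1 _ _] := eu; apply: measurable_funB => //; apply: measurable_funTS.
exact: (measurableT_comp (measurable_cell_index (W N) h0) measurable_snd).
Qed.

(** With this radius the cutoff still equals 1 on [[-M, M]] at time [(N + 2) * tau], from which on
    [eta N.+1] vanishes. *)
Let r := M + C * ((N%:R + 2) * tau) + 1.

Lemma eta_out t : (N%:R + 2) * tau <= t -> eta N.+1 t = 0.
Proof.
by rewrite -ler_pdivlMr// => ht; apply: hat0; right => /=; rewrite -natr1; lra.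
Qed.

Lemma weighted_gap_box : box weighted_gap.
Proof.
have [_ u01 _] := eu; have [Phi [E [W01 _ _ _ _]]] := eW.
split.
  apply: measurable_funM.
    apply: measurable_funTS; apply: (measurableT_comp (f := eta N.+1)); last exact: measurable_fst.
    apply: (measurableT_comp (f := @hat R)).
      by apply: continuous_measurable_fun; exact: continuous_hat.
    by apply: measurable_funD => //; apply: measurable_funM.
  apply: measurable_funM.
    apply: measurable_funTS.
    by apply: (measurableT_comp (f := \1_(`[- M, M]) : R -> R)); last exact: measurable_snd.
  by apply: measurableT_comp => //; exact: measurable_gap.
exists (Num.max 1 (Num.max M ((N%:R + 2) * tau))) => t x t0.
have U := u01 t x t0; have w01 := W01 N (cell_index h x).
have d1 : `|u t x - W N (cell_index h x)| <= 1 by rewrite ler_norml; lra.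
split.
  rewrite le_max; apply/orP; left; rewrite /weighted_gap indicE !normrM normr_id.
  rewrite (ger0_norm (eta_ge0 _ _)) ger0_norm//.
  have h1 := hat_le1 (t / tau + zoff N.+1).
  rewrite mulr_ile1 ?eta_ge0 ?mulr_ge0// mulr_ile1//.
  by case: (_ \in _).
move=> [] /=; rewrite !gt_max => /andP[_ /andP[h1 h2]]; rewrite /weighted_gap.
  by rewrite eta_out ?mul0r// ltW.
rewrite indicE memNset ?mul0r ?mulr0//= in_itv/= -ler_norml; apply/negP; by rewrite -ltNge.
Qed.

Lemma weighted_gap_cone t x : 0 <= t -> weighted_gap t x <=
  eta N.+1 t * (cone C r t x * `|u t x - W N (cell_index h x)|).
Proof.
move=> t0; rewrite /weighted_gap; have [ht|ht] := leP ((N%:R + 2) * tau) t.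
  by rewrite eta_out// !mul0r.
rewrite ler_wpM2l ?eta_ge0// ler_wpM2r// indicE.
case: (boolP (x \in _)) => [|_]; last by case/andP: (cone_itv C r t x).
rewrite inE/= in_itv/= -ler_norml => xM; rewrite cone1//.
by rewrite /r lerD2r lerD// ler_wpM2l// ltW.
Qed.

Lemma kuznetsov : K%:R * J (fun t => halfline t * J (weighted_gap t)) <=
  tau * (K%:R * I0 + 24 * (lambda * (N.+1%:R * h * (S + C * T + C * T))) +
   9 * (lambda * (C * ((K%:R + 2) * h * T))) + 4 * (K%:R * ((K%:R + 4) * h * T))).
Proof.
have [mu_ u01 ent] := eu; have [Phi [E [W01 WT WtT ES Went]]] := eW.
have TT0 : 0 <= T by exact: wsum_le_ge0 (WT 0%N).
have tau0' := tau0; have C0' := C0.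
have r0 : 0 <= r.
  by rewrite /r addr_ge0// addr_ge0// mulr_ge0// mulr_ge0 ?(ltW tau0)// addr_ge0.
pose P := (Num.truncn ((r + 1) / h)).+1.
have PE : (r + 1) / h <= P%:R.
  by have /andP[_ /ltW] : P.-1%:R <= (r + 1) / h < P%:R by apply: truncn_itv; rewrite divr_ge0 ?(ltW h0)// addr_ge0.
(* For [x / h] in [[-P, P]] these values leave the margins [K + 2] on the left and 2 on the right
   that [inside] demands. *)
pose a : int := - ((P + K + 2)%N)%:Z; pose m := (2 * P + K + 4)%N.
have aE : a%:~R = - (P%:R + K%:R + 2) :> R by rewrite /a mulrNz -pmulrn !natrD.
have mE : m%:R = 2 * P%:R + K%:R + 4 :> R by rewrite /m !natrD natrM.
have ins x : `|x| <= r + 1 -> inside h K a m x.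
  rewrite ler_norml => /andP[x1 x2].
  have y2 : x / h <= P%:R by apply: le_trans PE; rewrite ler_pM2r// invr_gt0.
  have y1 : - P%:R <= x / h.
    by rewrite lerNl -mulNr; apply: le_trans PE; rewrite ler_pM2r ?invr_gt0// lerNl.
  by split; rewrite aE ?mE; lra.
have tst n j := testf_test r n j.
have slice n j := entropy_box hV mu_ u01 (W01 n j) (tst n j).
have L1e n j t : 0 <= t -> L1 (eslice r u W n j t) by move=> t0; exact: (box_L1 (slice n j)).1.
have L1G n j : L1 (fun t => halfline t * J (eslice r u W n j t)) by exact: (box_L1 (slice n j)).2.
have [bH1 bH2] := box_L1 weighted_gap_box.
have entE n j := entropy_solutionE hV fu0.1 fu0.2 mu_ u01 (W01 n j) (tst n j).
pose g n j x := `|u0 x - W n j| * testf r n j 0 x.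
have Lg n j : L1 (g n j) by exact: (entE n j).1.
have G0 n j : 0 <= J (fun t => halfline t * J (eslice r u W n j t)) + J (g n j).
  by have := ent _ _ (W01 n j) (tst n j); rewrite (entE n j).2 lee_fin.
pose te := time_err N T S; have [Lte Jte] := time_err_int N T S.
have main : K%:R * J (fun t => halfline t * J (weighted_gap t)) +
   tau * (\sum_(n < N.+1) \sum_(i < m) J (fun t => halfline t * J (eslice r u W n (a + i%:Z) t))) <=
   J te.
  have LGs n := @L1_sum R m (fun i t => halfline t * J (eslice r u W n (a + i%:Z) t))
    (fun i => L1G n (a + i%:Z)).
  have LGss := @L1_sum R N.+1
    (fun n t => \sum_(i < m) halfline t * J (eslice r u W n (a + i%:Z) t)) LGs.
  have -> : \sum_(n < N.+1) \sum_(i < m) J (fun t => halfline t * J (eslice r u W n (a + i%:Z) t)) =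
      J (fun t => \sum_(n < N.+1) \sum_(i < m) halfline t * J (eslice r u W n (a + i%:Z) t)).
    rewrite (@J_sum R N.+1 (fun n t => \sum_(i < m) halfline t * J (eslice r u W n (a + i%:Z) t)))//.
    apply: eq_bigr => n _.
    by rewrite (@J_sum R m (fun i t => halfline t * J (eslice r u W n (a + i%:Z) t))).
  rewrite -!J_Z// -J_D; [|exact: L1Z|exact: L1Z].
  apply: J_le => //; first by apply: L1D; exact: L1Z.
  move=> t; rewrite /halfline; have [t0|t0] := leP 0 t; last first.
    rewrite !mul0r mulr0 add0r big1 ?mulr0; last by move=> n _; rewrite big1// => i _; rewrite mul0r.
    exact: (time_err_ge0 Went _ m a WT WtT ES).
  have [Lt1 Jt1] := @total_err_int W E Phi Went N m a T S WT WtT ES t.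
  apply: le_trans Jt1; rewrite mul1r.
  have L1s n := @L1_sum R m (fun i x => eslice r u W n (a + i%:Z) t x)
    (fun i => L1e n (a + i%:Z) t t0).
  have L1ss := @L1_sum R N.+1 (fun n x => \sum_(i < m) eslice r u W n (a + i%:Z) t x) L1s.
  have -> : \sum_(n < N.+1) \sum_(i < m) 1%:R * J (eslice r u W n (a + i%:Z) t) =
      J (fun x => \sum_(n < N.+1) \sum_(i < m) eslice r u W n (a + i%:Z) t x).
    rewrite (@J_sum R N.+1 (fun n x => \sum_(i < m) eslice r u W n (a + i%:Z) t x))//.
    apply: eq_bigr => n _; rewrite (@J_sum R m (fun i x => eslice r u W n (a + i%:Z) t x)).
      by apply: eq_bigr => i _; rewrite mul1r.
    by move=> i; exact: L1e.
  rewrite -!J_Z//; last exact: bH1.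
  rewrite -J_D; [|by apply: L1Z; exact: bH1|exact: L1Z].
  apply: J_le => //; first by apply: L1D; apply: L1Z => //; exact: bH1.
  move=> x; apply: le_trans (eslice_sum_le u01 W01 Went N t0 (ins x)).
  by rewrite lerD2r ler_wpM2l// weighted_gap_cone.
have init : \sum_(n < N.+1) \sum_(i < m) J (g n (a + i%:Z)) <=
    K%:R * I0 + K%:R * ((K%:R + 4) * h * T).
  have K0 : 0 <= K%:R :> R by [].
  have p2 : -2 <= K%:R + 2 :> R by lra.
  have [y1 y2] := @Yerr_int W m a T WT (-2) (K%:R + 2) 0 p2.
  rewrite (_ : K%:R + 2 - -2 = K%:R + 4 :> R) in y2; last by ring.
  have mI : measurable_fun [set: R] (fun x => `|u0 x - W 0%N (cell_index h x)|).
    apply: measurableT_comp => //; apply: measurable_funB; first exact: fu0.1.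
    exact: measurable_cell_index.
  have [i1 i2] := J_ge0_le mI (fun x => normr_ge0 _) initial.
  have Lgs n := @L1_sum R m (fun i x => g n (a + i%:Z) x) (fun i => Lg n (a + i%:Z)).
  have -> : \sum_(n < N.+1) \sum_(i < m) J (g n (a + i%:Z)) =
      J (fun x => \sum_(n < N.+1) \sum_(i < m) g n (a + i%:Z) x).
    rewrite (@J_sum R N.+1 (fun n x => \sum_(i < m) g n (a + i%:Z) x))//.
    by apply: eq_bigr => n _; rewrite (@J_sum R m (fun i x => g n (a + i%:Z) x)).
  apply: (@le_trans _ _ (J (fun x => K%:R * `|u0 x - W 0%N (cell_index h x)| +
     K%:R * Yerr W m a (-2) (K%:R + 2) 0 x))); last first.
    rewrite J_D; [|exact: L1Z|exact: L1Z].
    by rewrite !J_Z// lerD// ler_wpM2l.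
  apply: J_le; [exact: (@L1_sum R N.+1 (fun n x => \sum_(i < m) g n (a + i%:Z) x))|
    by apply: L1D; exact: L1Z|move=> x].
  (* At time 0 every [theta n] with [n > 0] vanishes and [theta 0] equals 1, so the initial datum is
     compared with [W 0] alone. *)
  rewrite big_ord_recl/= [X in _ + X]big1 ?addr0; last first.
    move=> n _; rewrite big1// => i _; rewrite /g /testf /theta /zeta /= mul0r !add0r.
    have n0 : 0 <= n%:R :> R by [].
    by rewrite /bump/= add1n -!natr1 !spline0 ?subrr ?mul0r ?mulr0//; lra.
  have th0 : theta 0 0 = 1.
    by rewrite /theta /zeta /= mul0r !add0r spline1// spline0// subr0.
  have [xr|xr] := leP `|x| (r + 1); last first.
    rewrite big1; last by move=> i _; rewrite /g /testf (cone_out C0 (lexx 0) xr) !mulr0.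
    by rewrite addr_ge0// mulr_ge0// Yerr_ge0.
  have ix := ins x xr.
  have osc := @phi_oscillation R h K h0 (W 0%N) a m x ix.
  apply: le_trans (lerD (lexx _) osc); rewrite -(sum_phi h0 ix) mulr_suml -big_split/=.
  apply: ler_sum => i _; rewrite /g /testf th0 mul1r.
  have /andP[c1 c2] := cone_itv C r 0 x; have /andP[f1 f2] := phi01 (a + i%:Z) x.
  apply: (@le_trans _ _ (`|u0 x - W 0%N (a + i%:Z)| * phi (a + i%:Z) x)).
    by rewrite ler_wpM2l// -[leRHS]mulr1 ler_wpM2l.
  rewrite mulrC -mulrDr ler_wpM2l// [X in _ <= _ + X]distrC.
  exact: ler_distD.
have sumG : 0 <= \sum_(n < N.+1) \sum_(i < m) J (fun t => halfline t * J (eslice r u W n (a + i%:Z) t)) +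
    \sum_(n < N.+1) \sum_(i < m) J (g n (a + i%:Z)).
  rewrite -big_split/=; apply: sumr_ge0 => n _; rewrite -big_split/=.
  by apply: sumr_ge0 => i _; have := G0 n (a + i%:Z).
set GG := \sum_(n < N.+1) \sum_(i < m) J (fun t => halfline t * _) in main sumG.
set gg := \sum_(n < N.+1) \sum_(i < m) J (g n _) in init sumG.
have : tau * (- GG) <= tau * (K%:R * I0 + K%:R * ((K%:R + 4) * h * T)).
  by rewrite ler_pM2l//; apply: le_trans init; lra.
move: main; rewrite /te Jte => main hg.
(* Each time window integrates to [3 * tau] and two windows of four cells to [8 * h]. Hence
   [24 = 3 * 8], [9 = 3 * 3] since [C * Yerr] enters once at the start and twice at the end, and
   [4 = 3 + 1], the 1 coming from the initial data. *)
apply: (@le_trans _ _ (3 * tau * (N.+1%:R * (lambda * (8 * h * (S + C * T + C * T))) +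
   3 * (lambda * (C * ((K%:R + 2) * h * T))) + K%:R * ((K%:R + 4) * h * T)) +
   tau * (K%:R * I0 + K%:R * ((K%:R + 4) * h * T)))).
  by apply: le_trans (lerD (lexx _) hg); rewrite mulrN lerBrDr.
rewrite le_eqVlt; apply/orP; left; apply/eqP; ring.
Qed.

End Estimate.
End Kuznetsov.

(** * Error of the scheme *)

Section GapBound.
Context {R : realType}.
Notation mu := (@lebesgue_measure R).
Notation J f := (\int[@lebesgue_measure R]_x f x).
Implicit Types (h x t : R) (n N : nat) (j : int).

Lemma cell_function_integral h (b : int -> R) (A : R) : 0 < h -> (forall j, 0 <= b j) ->
  wsum_le b A -> (\int[mu]_x (b (cell_index h x))%:E <= (h * A)%:E)%E.
Proof.
move=> h0 b0 bA.
have mb : measurable_fun [set: R] (fun x => b (cell_index h x)) by exact: measurable_cell_index.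
apply: ge0_integral_exhaust.
- exact/measurable_EFinP.
- by move=> x; rewrite lee_fin.
move=> n; pose P := (Num.truncn (n%:R / h)).+1.
have PE : n%:R / h < P%:R.
  by have /andP[] : P.-1%:R <= n%:R / h < P%:R by apply: truncn_itv; rewrite divr_ge0 ?(ltW h0).
pose a : int := - (P.+1)%:Z; pose m := (2 * P + 3)%N.
have aE : a%:~R = - (P%:R + 1) :> R by rewrite /a mulrNz -pmulrn -natr1.
have mE : m%:R = 2 * P%:R + 3 :> R by rewrite /m natrD natrM.
have pq : - 2^-1 <= 2^-1 :> R by lra.
have [L1s Js] := wsum_win h0 a m pq b0 bA.
set s := fun x : R => \sum_(i < m) _ in L1s Js.
have s0 x : 0 <= s x by rewrite sumr_ge0// => i _; rewrite mulr_ge0 ?win_ge0.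
have le x : x \in `[1 *- n, n%:R] -> b (cell_index h x) <= s x.
  rewrite in_itv/= => /andP[x1 x2].
  have /andP[c1 c2] := cell_indexP x h0; set id := cell_index h x in c1 c2 *.
  rewrite -ler_pdivlMr// in c1; rewrite -ltr_pdivrMr// in c2.
  have y2 : x / h <= n%:R / h by rewrite ler_pM2r// invr_gt0.
  have y1 : - (n%:R / h) <= x / h by rewrite -mulNr ler_pM2r// invr_gt0.
  have [l lE] : exists l : nat, id = a + l%:Z.
    have : (a < id)%R by rewrite -(ltr_int R) aE; lra.
    by move=> al; clear - al; exists (`|id - a|)%N; lia.
  have e : id%:~R = a%:~R + l%:R :> R by rewrite lE intrD -pmulrn.
  have lm : (l < m)%N by rewrite -(ltr_nat R) mE; rewrite aE in e; lra.
  rewrite /s (bigD1 (Ordinal lm))//= -lE win1//; last by apply/andP; split; lra.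
  by rewrite mulr1 lerDl sumr_ge0// => i _; rewrite mulr_ge0 ?win_ge0.
have mR : measurable (`[1 *- n, n%:R]%classic : set R) by exact: measurable_itv.
apply: (@le_trans _ _ (\int[mu]_(x in `[1 *- n, n%:R]) (s x)%:E)%E).
  apply: ge0_le_integral => //.
  - by move=> x _; rewrite lee_fin.
  - by apply: measurable_funTS; exact/measurable_EFinP.
  - by apply: measurable_funTS; apply/measurable_EFinP; exact: L1_measurable.
apply: (@le_trans _ _ (\int[mu]_x (s x)%:E)%E).
  apply: ge0_subset_integral => //; first by apply/measurable_EFinP; exact: L1_measurable.
  by move=> x _; rewrite lee_fin.
rewrite J_E// lee_fin; apply: (le_trans Js).
by rewrite (_ : 2^-1 - - 2^-1 = 1) ?mul1r//; field.
Qed.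

Variables (V : R -> R) (vM lV lambda : R).
Hypotheses (hV : velocity V vM lV) (l0 : 0 < lambda) (cfl : lambda * (vM + lV) <= 1).
Variables (h g delta T : R) (w0 : int -> R) (u0 : R -> R).
Hypotheses (h0 : 0 < h) (g01 : 0 < g <= 1) (hg : h / g <= delta).
Hypotheses (w01 : forall j, 0 <= w0 j <= 1) (wT : wsum_le (fun j => `|w0 (j + 1) - w0 j|) T).
Hypotheses (fu0 : field u0)
  (initial : (\int[mu]_x `|u0 x - w0 (cell_index h x)|%:E <= (h * T)%:E)%E).
Let tau := lambda * h.
Let W := scheme_W V lambda (geometric_weights g) w0.
Let C := 2 * (vM + lV).

Let T0 : 0 <= T. Proof. exact: wsum_le_ge0 wT. Qed.
Let g0 : 0 < g. Proof. by case/andP: g01. Qed.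
Let hd : h <= delta.
Proof.
apply: le_trans hg; rewrite ler_pdivlMr// -[leRHS]mulr1 ler_wpM2l ?(ltW h0)//.
by case/andP: g01.
Qed.
Let gE : h * ((1 - g) / g) = h / g - h.
Proof. by field; rewrite gt_eqF. Qed.
Let rg0 : 0 <= (1 - g) / g.
Proof. by rewrite divr_ge0 ?(ltW g0)// subr_ge0; case/andP: g01. Qed.

(** [h * (1 - g) / g] is the mean distance over which the geometric weights look ahead, and it is at
    most [delta - h]. *)
Lemma scheme_gap_integral n :
  (\int[mu]_x `|scheme_rho V lambda (geometric_weights g) w0 n (cell_index h x)
               - W n (cell_index h x)|%:E <= ((delta - h) * T)%:E)%E.
Proof.
set r := scheme_rho _ _ _ _.
have := @cell_function_integral h (fun j => `|r n j - W n j|) ((1 - g) / g * T) h0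
  (fun j => normr_ge0 _).
move=> H; apply: (le_trans (H _)).
  apply: wsum_le_le (wsum_leM rg0 (scheme_W_gap hV l0 cfl g01 w01 wT n)) => j.
  exact: (scheme_rho_W hV l0 cfl g01 w01).
by rewrite lee_fin mulrA gE ler_wpM2r// lerB.
Qed.

Lemma initial_W : (\int[mu]_x `|u0 x - W 0%N (cell_index h x)|%:E <= (delta * T)%:E)%E.
Proof.
have mw : measurable_fun [set: R] (fun x => w0 (cell_index h x)) by exact: measurable_cell_index.
have mW : measurable_fun [set: R] (fun x => W 0%N (cell_index h x)) by exact: measurable_cell_index.
have m1 : measurable_fun [set: R] (fun x => `|u0 x - w0 (cell_index h x)|).
  by apply: measurableT_comp => //; apply: measurable_funB => //; exact: fu0.1.
have m2 : measurable_fun [set: R] (fun x => `|w0 (cell_index h x) - W 0%N (cell_index h x)|).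
  by apply: measurableT_comp => //; apply: measurable_funB.
have [a1 b1] := J_ge0_le m1 (fun x => normr_ge0 _) initial.
have [a2 b2] := J_ge0_le m2 (fun x => normr_ge0 _) (scheme_gap_integral 0).
have La : L1 (fun x => `|u0 x - W 0%N (cell_index h x)|).
  apply: (L1_le _ _ (L1D a1 a2)).
    by apply: measurableT_comp => //; apply: measurable_funB => //; exact: fu0.1.
  by move=> x; rewrite normr_id; exact: ler_distD.
rewrite (J_E La) lee_fin.
apply: (@le_trans _ _ (J (fun x => `|u0 x - w0 (cell_index h x)| +
  `|w0 (cell_index h x) - W 0%N (cell_index h x)|))).
  by apply: J_le => //; [exact: L1D|move=> x; exact: ler_distD].
rewrite J_D//; apply: (le_trans (lerD b1 b2)); lra.
Qed.

Let eW : discrete_entropy V lambda W T (lV / g * T).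
Proof. exact: (scheme_W_entropy hV l0 cfl g01 w01 wT). Qed.

Section Gap.
Variable u : R -> R -> R.
Hypothesis eu : entropy_solution V u0 u.

(** The constants collect the terms of [kuznetsov], as estimated in [gap_bound]:
    [75 = 1 + 9 * 6 + 4 * 5] and [124 = 24 * 5 + 4]. *)
Definition gap_const N : R := T * (75 * delta + 124 * Num.sqrt (N.+1%:R * h * delta)).

Lemma gap_bound N M : 0 <= M ->
  J (fun t => halfline t * J (weighted_gap lambda h u W N M t)) <= tau * gap_const N.
Proof.
move=> M0; have [v0 lV0 _ _] := hV.
have h0' := h0; have T0' := T0; have hd' := hd.
have d0 : 0 < delta by exact: lt_le_trans hd.
have N0 : 0 < N.+1%:R :> R by [].
pose Y := Num.sqrt (N.+1%:R * h * delta).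
have Y0 : 0 <= Y by exact: sqrtr_ge0.
have YE : Y * Y = N.+1%:R * h * delta.
  by rewrite -expr2 sqr_sqrtr// mulr_ge0 ?(ltW d0)// mulr_ge0 ?(ltW h0).
(* [K h ~ Y] balances the initial and final errors [K h T] against [N h delta T / (K h)]. *)
pose K := (Num.truncn (Y / h)).+1.
have /andP[K1 K2] : K.-1%:R <= Y / h < K%:R by apply: truncn_itv; rewrite divr_ge0 ?(ltW h0).
have KE : K%:R = K.-1%:R + 1 :> R by rewrite /K -natr1.
have Kh : K%:R * h <= Y + h by rewrite KE mulrDl mul1r lerD2r -ler_pdivlMr.
have YK : Y <= K%:R * h by rewrite -ler_pdivrMr// ltW.
have K1' : 1 <= K%:R :> R by rewrite ler1n.
have K0 : 0 < K%:R :> R by lra.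
have kz := @kuznetsov R V vM lV lambda h K hV l0 h0 u W u0 T (lV / g * T) (delta * T)
  fu0 eu eW initial_W N M M0.
set G := J (fun t => halfline t * J (weighted_gap lambda h u W N M t)) in kz *; rewrite -(ler_pM2l K0); apply: (le_trans kz).
rewrite [leRHS]mulrCA /tau (ler_pM2l (mulr_gt0 l0 h0)) /gap_const -/Y.
have llV : lambda * lV <= 1.
  apply: le_trans cfl; rewrite ler_wpM2l ?(ltW l0)//; lra.
have lC : lambda * C <= 2 by rewrite /C mulrCA; have := cfl; lra.
have hg0 : 0 <= h / g by rewrite divr_ge0 ?ltW.
have C0 : 0 <= C by rewrite /C; lra.
have dT : 0 <= delta * T by rewrite mulr_ge0// ltW.
have hT : h * T <= delta * T by rewrite ler_wpM2r.
have hT0 : 0 <= h * T by rewrite mulr_ge0// ltW.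
have e1 : lambda * (N.+1%:R * h * (lV / g * T + C * T + C * T)) <= 5 * (K%:R * (Y * T)).
  have s1 : lambda * lV * (h / g * T) <= delta * T.
    have gT : h / g * T <= delta * T by rewrite ler_wpM2r.
    apply: le_trans gT; rewrite -[leRHS]mul1r; apply: ler_wpM2r => //.
    exact: mulr_ge0.
  have s2 : lambda * C * (h * T) <= 2 * (delta * T) by apply: (le_trans (ler_wpM2r hT0 lC)); lra.
  have s3 : N.+1%:R * (lambda * lV * (h / g * T) + 2 * (lambda * C * (h * T))) <=
      N.+1%:R * (5 * (delta * T)) by rewrite ler_wpM2l//; lra.
  have s4 : N.+1%:R * delta <= K%:R * Y.
    rewrite -(ler_pM2r h0) (_ : _ * h = Y * Y); last by rewrite YE; ring.
    by rewrite (_ : K%:R * Y * h = K%:R * h * Y); [rewrite ler_wpM2r|ring].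
  have s5 := ler_wpM2r T0 s4.
  have -> : lambda * (N.+1%:R * h * (lV / g * T + C * T + C * T)) =
    N.+1%:R * (lambda * lV * (h / g * T) + 2 * (lambda * C * (h * T))) by ring.
  lra.
have e2 : lambda * (C * ((K%:R + 2) * h * T)) <= 6 * (K%:R * (delta * T)).
  rewrite (_ : lambda * _ = lambda * C * ((K%:R + 2) * (h * T))); last by ring.
  have k0 : 0 <= (K%:R + 2) * (h * T) by apply: mulr_ge0 => //; rewrite addr_ge0.
  have k1 : (K%:R + 2) * (h * T) <= 3 * K%:R * (delta * T).
    by apply: ler_pM => //; lra.
  by apply: (le_trans (ler_wpM2r k0 lC)); lra.
have e3 : K%:R * ((K%:R + 4) * h * T) <= K%:R * (5 * (delta * T) + Y * T).
  apply: ler_wpM2l; first exact: ltW.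
  by rewrite mulrA -mulrDl; apply: ler_wpM2r => //; lra.
rewrite -/C; set a1 := lambda * _ in e1 *; set a2 := lambda * _ in e2 *.
by set a3 := K%:R * _ in e3 *; lra.
Qed.

End Gap.

Section Rate.
Variable u : R -> R -> R.
Hypothesis eu : entropy_solution V u0 u.

Lemma slice_measurable t : 0 <= t -> measurable_fun [set: R] (u t).
Proof.
move=> t0; have [m _ _] := eu.
apply: (measurable_comp (F := [set z : R * R | 0 <= z.1])
  (f := fun z : R * R => u z.1 z.2) (g := fun x : R => (t, x))) => //.
- exact: measurable_halfplane.
- by move=> _ [x _ <-].
- exact: measurable_pair1.
Qed.

Lemma window_gap_L1 n M t : 0 <= t ->
  L1 (fun x => \1_(`[- M, M]) x * `|u t x - W n (cell_index h x)|).
Proof.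
move=> t0; have [_ u01 _] := eu.
apply: (@L1_bounded _ _ 1 M).
- apply: measurable_funM => //; apply: measurableT_comp => //; apply: measurable_funB.
    exact: slice_measurable.
  exact: measurable_cell_index.
- move=> x; have U := u01 t x t0; have Wn : 0 <= W n (cell_index h x) <= 1 by exact: (scheme_W_itv hV l0 cfl g01 w01).
  rewrite normrM normr_id indicE normr_nat.
  have d1 : `|u t x - W n (cell_index h x)| <= 1 by rewrite ler_norml; lra.
  by rewrite mulr_ile1//; case: (_ \in _).
- move=> x hx; rewrite indicE memNset ?mul0r//= in_itv/= -ler_norml.
  by apply/negP; rewrite -ltNge.
Qed.

Lemma hat_ge_half (z : R) : - 2^-1 <= z <= 2^-1 -> 2^-1 <= hat z.
Proof.
move=> /andP[z1 z2]; rewrite /hat /ramp addrK.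
have [z0|z0] := leP 0 z.
  by rewrite (@posp_ge _ (z + 1)) ?(@posp_ge _ z) ?(@posp_le _ (z - 1)); lra.
by rewrite (@posp_ge _ (z + 1)) ?(@posp_le _ z) ?(@posp_le _ (z - 1)); lra.
Qed.

Lemma window_gap_le n M t : 0 <= M -> 0 <= t -> n%:R + 2^-1 <= t / tau <= n%:R + 2^-1 + 1 ->
  J (fun x => \1_(`[- M, M]) x * `|u t x - W n (cell_index h x)|) <=
  2 * J (weighted_gap lambda h u W n M t).
Proof.
move=> M0 t0 zt; rewrite /weighted_gap J_Z; last exact: window_gap_L1.
have e : 2^-1 <= eta lambda h n.+1 t.
  apply: hat_ge_half; move: zt; rewrite /= -/tau -[n.+1%:R]natr1; set z := t / tau => zt.
  by apply/andP; split; lra.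
have J0 : 0 <= J (fun x => \1_(`[- M, M]) x * `|u t x - W n (cell_index h x)|).
  by apply: J_ge0 => x; rewrite indicE mulr_ge0.
have := ler_wpM2r J0 e; lra.
Qed.

Hypothesis time_lip : forall s t, 0 <= s <= t -> L1 (fun x => u t x - u s x) /\
  J (fun x => `|u t x - u s x|) <= (t - s) / lambda * T.

Let tau0 : 0 < tau. Proof. exact: mulr_gt0. Qed.

(** [gap_bound] controls only an average in time. On the window of length [tau] around [n.+1 * tau]
    the weight is at least one half, and each time of that window is within [2 * tau] of [t], so the
    Lipschitz bound in time moves it to [t] at a cost [2 * (h * T)]. *)
Lemma rate_window n t M : 0 <= M -> 0 <= t -> n%:R * tau <= t < n.+1%:R * tau ->
  J (fun x => \1_(`[- M, M]) x * `|u t x - W n (cell_index h x)|) <=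
  2 * gap_const n + 4 * (h * T).
Proof.
move=> M0 t0 /andP[n1 n2].
set A := J (fun x => \1_(`[- M, M]) x * `|u t x - W n (cell_index h x)|); have h0' := h0; have T0' := T0; have tau0' := tau0.
have A0 : 0 <= A by apply: J_ge0 => x; rewrite indicE mulr_ge0.
have hT0 : 0 <= h * T by rewrite mulr_ge0// ltW.
have step t' : n%:R + 2^-1 <= t' / tau <= n%:R + 2^-1 + 1 -> 0 <= t' /\
    A <= 2 * J (weighted_gap lambda h u W n M t') + 2 * (h * T).
  move=> zt; have zt' := zt; move: zt' => /andP[]; rewrite ler_pdivlMr// ler_pdivrMr// => z1 z2.
  have n0 : 0 <= n%:R * tau by rewrite mulr_ge0// ltW.
  have t'0 : 0 <= t' by lra.
  split => //.
  have [Ld Jd] : L1 (fun x => u t' x - u t x) /\ J (fun x => `|u t' x - u t x|) <= 2 * (h * T).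
    have lt (d : R) : d <= 2 * tau -> d / lambda * T <= 2 * (h * T).
      move=> dt; rewrite mulrA ler_wpM2r// ler_pdivrMr//.
      by apply: (le_trans dt); rewrite /tau; lra.
    have n2' : t < n%:R * tau + tau by move: n2; rewrite -natr1 mulrDl mul1r.
    have [tt|tt] := leP t t'.
      have st : 0 <= t <= t' by rewrite t0.
      have [a b] := time_lip st; split => //; apply: (le_trans b); apply: lt; lra.
    have st : 0 <= t' <= t by rewrite t'0 ltW.
    have [a b] := time_lip st; split.
      by apply: L1_eq (L1Z (-1) a) => x; rewrite mulN1r opprB.
    have -> : J (fun x => `|u t' x - u t x|) = J (fun x => `|u t x - u t' x|).
      by apply: eq_Rintegral => x _; rewrite distrC.
    apply: (le_trans b); apply: lt; lra.
  apply: (@le_trans _ _ (J (fun x => \1_(`[- M, M]) x * `|u t' x - W n (cell_index h x)| +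
      `|u t' x - u t x|))).
    apply: J_le; [exact: window_gap_L1|by apply: L1D; [exact: window_gap_L1|exact: L1_abs]|].
    move=> x; rewrite indicE; case: (_ \in _); last by rewrite !mul0r add0r.
    by rewrite !mul1r [leRHS]addrC (distrC (u t' x) (u t x)); exact: ler_distD.
  rewrite J_D; [|exact: window_gap_L1|exact: L1_abs].
  by apply: lerD => //; exact: window_gap_le.
have [_ Lgap] := box_L1 (weighted_gap_box l0 h0 eu eW n M).
have pq : 2^-1 <= 2^-1 + 1 :> R by lra.
pose w : R -> R := win tau 2^-1 (2^-1 + 1) n%:Z.
have Lw : L1 w by exact: win_L1.
have Jw : J w = tau by rewrite /w J_win//; rewrite (_ : _ - _ = 1) ?mul1r//; ring.
have : J (fun t' => A * w t') <= J (fun t' => 2 * (halfline t' * J (weighted_gap lambda h u W n M t')) +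
    2 * (h * T) * w t').
  apply: J_le; [exact: L1Z|by apply: L1D; exact: L1Z|move=> t'].
  have gap0 : 0 <= halfline t' * J (weighted_gap lambda h u W n M t').
    rewrite mulr_ge0//; apply: J_ge0 => x.
    by rewrite /weighted_gap mulr_ge0 ?eta_ge0// indicE mulr_ge0.
  rewrite /w winE// -pmulrn.
  have [/andP[z1 z2]|_] := boolP (2^-1 <= t' / tau - n%:R <= 2^-1 + 1); last first.
    by rewrite !mulr0 addr0 mulr_ge0.
  rewrite !mulr1.
  have zt : n%:R + 2^-1 <= t' / tau <= n%:R + 2^-1 + 1 by apply/andP; split; lra.
  have [t'0 st] := step t' zt; apply: (le_trans st).
  by rewrite /halfline t'0 mul1r.
rewrite J_D; [|exact: L1Z|exact: L1Z].
rewrite !J_Z// Jw => hA.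
have gb := gap_bound eu n M0.
rewrite -(ler_pM2r tau0); apply: (le_trans hA).
have hT0t : 0 <= h * T * tau by rewrite mulr_ge0// ltW.
lra.
Qed.

Lemma rate_W n t : 0 <= t -> n%:R * tau <= t < n.+1%:R * tau ->
  (\int[mu]_x `|u t x - W n (cell_index h x)|%:E <= (2 * gap_const n + 4 * (h * T))%:E)%E.
Proof.
move=> t0 nt.
have mm : measurable_fun [set: R] (fun x => `|u t x - W n (cell_index h x)|).
  apply: measurableT_comp => //; apply: measurable_funB; first exact: slice_measurable.
  exact: measurable_cell_index.
apply: ge0_integral_exhaust.
- exact/measurable_EFinP.
- by move=> x; rewrite lee_fin.
move=> m; have := rate_window (ler0n R m) t0 nt.
rewrite -lee_fin -J_E; last exact: window_gap_L1.
apply: le_trans; rewrite integral_mkcond le_eqVlt; apply/orP; left; apply/eqP.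
apply: eq_integral => x _; rewrite patchE indicE.
by case: ifP => _; rewrite ?mul1r ?mul0r.
Qed.

End Rate.
End GapBound.

(** * Uniqueness *)

Section Uniqueness.
Context {R : realType}.
Notation mu := (@lebesgue_measure R).
Notation J f := (\int[@lebesgue_measure R]_x f x).

Lemma ae_imply2 d (X : measurableType d) (m : {measure set X -> \bar R})
  (P Q S : X -> Prop) : {ae m, forall x, P x} -> {ae m, forall x, Q x} ->
  (forall x, P x -> Q x -> S x) -> {ae m, forall x, S x}.
Proof.
move=> hP hQ PQS; apply: negligibleS (negligibleU hP hQ) => x /= nS.
have [p|np] := pselect (P x); last by left.
by right => q; apply: nS; exact: PQS.
Qed.

Lemma box_null (G : R -> R -> R) : box G -> (forall t x, 0 <= t -> 0 <= G t x) ->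
  J (fun t => halfline t * J (G t)) = 0 ->
  {ae (mu \x mu)%E, forall z : R * R, 0 <= z.1 -> G z.1 z.2 = 0}.
Proof.
move=> bG G0 JG; have [s1 s2] := box_L1 bG.
pose P (z : R * R) := (halfline z.1 * G z.1 z.2)%:E.
have mP : measurable_fun [set: R * R] P.
  by apply/measurable_EFinP; exact: measurable_halfline bG.1.
have P0 z : (0 <= P z)%E.
  rewrite lee_fin /halfline; case: (leP 0 z.1) => [z0|_]; last by rewrite mul0r.
  by rewrite mul1r G0.
have IP : (\int[(mu \x mu)%E]_z P z = 0)%E.
  rewrite (@fubini_tonelli1 _ _ _ _ R mu mu P mP P0) -[RHS]/(0%:E) -JG -(J_E s2).
  apply: eq_integral => t _; rewrite /fubini_F /P /= /halfline; case: (leP 0 t) => [t0|_].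
    rewrite mul1r -(J_E (s1 t t0)).
    by apply: eq_integral => x _; rewrite mul1r.
  by rewrite mul0r; under eq_integral do rewrite mul0r; rewrite integral0.
have /(ae_eq_integral_abs (mu \x mu)%E measurableT mP) : (\int[(mu \x mu)%E]_z `|P z| = 0)%E.
  by rewrite -IP; apply: eq_integral => z _; rewrite gee0_abs.
move=> h; apply: (ae_imply2 h h) => z /(_ I) + _ z0.
by rewrite /P /halfline z0 mul1r => -[].
Qed.

Lemma time0_null : {ae (mu \x mu)%E, forall z : R * R, z.1 != 0}.
Proof.
exists ([set 0] `*` [set: R]); split; first exact: measurableX.
  rewrite product_measure1E//; transitivity (0 * mu [set: R])%E; last exact: mul0e.
  by congr (_ * _)%E; exact: lebesgue_measure_set1.
by move=> [t x] /= /negP; rewrite negbK => /eqP ->.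
Qed.

Variables (V : R -> R) (vM lV lambda : R).
Hypotheses (hV : velocity V vM lV) (l0 : 0 < lambda) (cfl : lambda * (vM + lV) <= 1).
Variables (u0 : R -> R) (u u' : R -> R -> R).
Hypotheses (fu0 : field u0) (Tu0 : (TV u0 < +oo)%E).
Hypotheses (eu : entropy_solution V u0 u) (eu' : entropy_solution V u0 u').
Let T := 2 * fine (TV u0).

Let T0 : 0 <= T. Proof. by rewrite mulr_ge0// fine_ge0// TV_ge0. Qed.

(** The restriction [p^-1 <= t] ensures, for small time steps, that [t / tau - 2^-1] is nonnegative,
    so that [t] lies in one of the windows where a weight [eta] is at least one half. *)
Definition dist_box (p t x : R) : R :=
  \1_(`[p^-1, p]) t * (\1_(`[- p, p]) x * `|u t x - u' t x|).

Lemma dist_box_box p : box (dist_box p).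
Proof.
have [m1 b1 _] := eu; have [m2 b2 _] := eu'.
split.
  apply: measurable_funM.
    apply: measurable_funTS.
    by apply: (measurableT_comp (f := \1_(`[p^-1, p]) : R -> R)); last exact: measurable_fst.
  apply: measurable_funM.
    apply: measurable_funTS.
    by apply: (measurableT_comp (f := \1_(`[- p, p]) : R -> R)); last exact: measurable_snd.
  by apply: measurableT_comp => //; apply: measurable_funB.
exists (Num.max 1 p) => t x t0; have U := b1 t x t0; have U' := b2 t x t0.
have d1 : `|u t x - u' t x| <= 1 by rewrite ler_norml; lra.
split.
  rewrite le_max; apply/orP; left; rewrite /dist_box !indicE !normrM normr_id !normr_nat.
  by do ! case: (_ \in _); rewrite ?mul1r ?mul0r.
rewrite !gt_max => -[/andP[_ h]|/andP[_ h]]; rewrite /dist_box !indicE.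
  by rewrite memNset ?mul0r//= in_itv/= => /andP[_]; rewrite leNgt h.
have -> : (x \in `[- p, p]%classic) = false.
  by apply: memNset => /=; rewrite in_itv/= -ler_norml leNgt h.
by rewrite mul0r mulr0.
Qed.

(** Both solutions are compared with the same [W], for the weight [2^-1] and so with
    [delta = 2 * h]. About [p / tau] time windows cover [[p^-1, p]], each contributing
    [tau * gap_const] for either solution; the factor 4 is two solutions times the 2 lost by a
    weight of one half. *)
Lemma dist_box_small p h : 0 < p -> 0 < h -> lambda * h <= 1 -> lambda * h <= p^-1 ->
  J (fun t => halfline t * J (dist_box p t)) <=
  4 * (p + 1) * (T * (150 * h + 124 * Num.sqrt (2 * (p + 1) / lambda * h))).
Proof.
move=> p0 h0 th1 thp; pose tau := lambda * h.
have tau0 : 0 < tau by rewrite mulr_gt0.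
have g01 : 0 < (2^-1 : R) <= 1 by apply/andP; split; lra.
have hg : h / 2^-1 <= 2 * h by rewrite invrK mulrC.
pose w0 := cell_average u0 h.
have w01 j : 0 <= w0 j <= 1 by apply: cell_average_itv => //; [exact: fu0.1|exact: fu0.2].
have wT : wsum_le (fun j => `|w0 (j + 1) - w0 j|) T.
  by apply: cell_average_wsum => //; [exact: fu0.1|exact: fu0.2].
have ini : (\int[mu]_x `|u0 x - w0 (cell_index h x)|%:E <= (h * T)%:E)%E.
  rewrite /T mulrCA mulrA.
  by apply: cell_average_L1 => //; [exact: fu0.1|exact: fu0.2].
pose W := scheme_W V lambda (geometric_weights 2^-1) w0.
have eW : discrete_entropy V lambda W T (lV / 2^-1 * T).
  exact: (scheme_W_entropy hV l0 cfl g01 w01 wT).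
pose gp v N t := halfline t * J (weighted_gap lambda h v W N p t).
have [_ LD] := box_L1 (dist_box_box p).
have Lg N : L1 (gp u N) by exact: (box_L1 (weighted_gap_box l0 h0 eu eW N p)).2.
have Lg' N : L1 (gp u' N) by exact: (box_L1 (weighted_gap_box l0 h0 eu' eW N p)).2.
have gp0 v N t : 0 <= gp v N t.
  rewrite mulr_ge0//; apply: J_ge0 => x.
  by rewrite /weighted_gap mulr_ge0 ?eta_ge0// indicE mulr_ge0.
pose N0 := (Num.truncn (p / tau)).+1.
have /andP[N01 N02] : N0.-1%:R <= p / tau < N0%:R.
  by apply: truncn_itv; rewrite divr_ge0 ?(ltW p0)// ltW.
have N0E : N0%:R * tau <= p + 1.
  have -> : N0%:R = N0.-1%:R + 1 :> R by rewrite /N0 -natr1.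
  by rewrite mulrDl mul1r lerD// -ler_pdivlMr.
have LS := @L1_sum R N0 (fun N t => 2 * (gp u N t + gp u' N t))
  (fun N => L1Z 2 (L1D (Lg N) (Lg' N))).
apply: (@le_trans _ _ (J (fun t => \sum_(N < N0) 2 * (gp u N t + gp u' N t)))).
  apply: J_le => // t; have [t0|t0] := leP 0 t; last first.
    by rewrite {1}/halfline (lt_geF t0) mul0r sumr_ge0// => N _; rewrite mulr_ge0// addr_ge0.
  have [tp|tp] := boolP (t \in `[p^-1, p]%classic); last first.
    have -> : J (dist_box p t) = 0.
      have -> : dist_box p t = fun=> 0.
        by apply/funext => x; rewrite /dist_box indicE (negbTE tp) mul0r.
      by rewrite Rintegral_cst// mul0r.
    by rewrite mulr0 sumr_ge0// => N _; rewrite mulr_ge0// addr_ge0.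
  move: (tp); rewrite inE/= in_itv/= => /andP[tp1 tp2].
  have zt : 0 <= t / tau - 2^-1.
    have : 1 <= t / tau by rewrite ler_pdivlMr// mul1r (le_trans thp).
    lra.
  have /andP[n1 n2] := truncn_itv zt; set n := Num.truncn _ in n1 n2.
  have nN0 : (n < N0)%N.
    rewrite -(ltr_nat R); apply: le_lt_trans N02; apply: (le_trans n1).
    have : t / tau <= p / tau by rewrite ler_pM2r// invr_gt0.
    lra.
  rewrite -[n.+1%:R]natr1 in n2.
  have znt : n%:R + 2^-1 <= t / tau <= n%:R + 2^-1 + 1 by apply/andP; split; lra.
  have a1 := window_gap_le hV l0 cfl h0 g01 w01 eu (ltW p0) t0 znt.
  have a2 := window_gap_le hV l0 cfl h0 g01 w01 eu' (ltW p0) t0 znt.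
  have L1a := window_gap_L1 hV l0 cfl h0 g01 w01 eu n p t0.
  have L1b := window_gap_L1 hV l0 cfl h0 g01 w01 eu' n p t0.
  have main : J (dist_box p t) <= 2 * J (weighted_gap lambda h u W n p t) +
      2 * J (weighted_gap lambda h u' W n p t).
    apply: le_trans (lerD a1 a2); rewrite -J_D//.
    apply: J_le; [exact: (box_L1 (dist_box_box p)).1|exact: L1D|move=> x].
    rewrite /dist_box indicE tp mul1r -mulrDr ler_wpM2l ?indicE//.
    by rewrite [X in _ <= _ + X]distrC; exact: ler_distD.
  rewrite (bigD1 (Ordinal nN0))//= /gp {1}/halfline t0 mul1r -[leLHS]addr0 lerD//.
    by rewrite /halfline t0 !mul1r mulrDr.
  by apply: sumr_ge0 => N _; apply: mulr_ge0 => //; apply: addr_ge0; exact: gp0.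
rewrite (@J_sum R N0 (fun N t => 2 * (gp u N t + gp u' N t))); last first.
  by move=> N; apply: L1Z; exact: L1D.
set Q := T * (150 * h + 124 * Num.sqrt (2 * (p + 1) / lambda * h)).
apply: (@le_trans _ _ (\sum_(N < N0) 4 * (tau * Q))); last first.
  rewrite sumr_const card_ord -[_ *+ N0]mulr_natl [leLHS](_ : _ = 4 * (N0%:R * tau) * Q); last by ring.
  apply: ler_wpM2r; last exact: ler_wpM2l.
  apply: mulr_ge0 => //; apply: addr_ge0; first by rewrite mulr_ge0// ltW.
  by rewrite mulr_ge0// sqrtr_ge0.
apply: ler_sum => N _; rewrite J_Z; last exact: L1D.
rewrite J_D//.
have b1 := gap_bound hV l0 cfl h0 g01 hg w01 wT fu0 ini eu N (ltW p0).
have b2 := gap_bound hV l0 cfl h0 g01 hg w01 wT fu0 ini eu' N (ltW p0).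
have bQ : gap_const h (2 * h) T N <= Q.
  rewrite /gap_const /Q; apply: ler_wpM2l => //; apply: lerD; first by rewrite mulrA -natrM.
  rewrite ler_wpM2l//; apply: ler_wsqrtr.
  have -> : N.+1%:R * h * (2 * h) = 2 * (N.+1%:R * tau) / lambda * h.
    by rewrite /tau; field; rewrite gt_eqF.
  rewrite ler_wpM2r ?(ltW h0)// ler_wpM2r ?invr_ge0 ?(ltW l0)// ler_wpM2l//.
  by apply: le_trans N0E; rewrite ler_wpM2r ?(ltW tau0)// ler_nat.
have tQ : tau * gap_const h (2 * h) T N <= tau * Q by rewrite ler_wpM2l// ltW.
apply: (@le_trans _ _ (2 * (tau * gap_const h (2 * h) T N + tau * gap_const h (2 * h) T N))).
  by apply: ler_wpM2l => //; apply: lerD; [exact: b1|exact: b2].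
by rewrite (_ : 2 * _ = 4 * (tau * gap_const h (2 * h) T N)); [exact: ler_wpM2l|ring].
Qed.

Lemma entropy_solution_unique : ae_equal u u'.
Proof.
suff D0 (p : R) : 0 < p -> J (fun t => halfline t * J (dist_box p t)) = 0.
  have ae_n n : {ae (mu \x mu)%E, forall z : R * R, 0 <= z.1 -> dist_box n.+1%:R z.1 z.2 = 0}.
    apply: box_null; [exact: dist_box_box| |exact: D0].
    by move=> t x _; rewrite /dist_box !indicE mulr_ge0// mulr_ge0.
  apply: (ae_imply2 time0_null (ae_foralln ae_n)) => -[t x] /= t0 h tp.
  have {}t0 : 0 < t by rewrite lt_neqAle eq_sym t0.
  pose n := Num.truncn (Num.max (Num.max t t^-1) `|x|).
  have m0 : 0 <= Num.max (Num.max t t^-1) `|x| by rewrite !le_max tp.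
  have /andP[_] := truncn_itv m0; rewrite -/n !gt_max => /andP[/andP[n1 n2] n3].
  have := h n tp; rewrite /dist_box !indicE !mem_set ?mul1r//=.
  - by move=> /eqP; rewrite normr_eq0 subr_eq0 => /eqP.
  - by rewrite in_itv/= -ler_norml ltW.
  - rewrite in_itv/= (ltW n1) andbT -[leRHS]invrK lef_pV2 ?posrE ?invr_gt0//.
    exact: ltW.
move=> p0; set D := J (fun t => halfline t * J (dist_box p t)); have D0 : 0 <= D.
  apply: J_ge0 => t; rewrite mulr_ge0//; apply: J_ge0 => x.
  by rewrite /dist_box !indicE mulr_ge0// mulr_ge0.
apply/eqP; rewrite eq_le D0 andbT; apply/ler_addgt0Pr => e e0; rewrite add0r.
pose Q := 4 * (p + 1) * (T * (150 + 124 * Num.sqrt (2 * (p + 1) / lambda))).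
have Q0 : 0 <= Q.
  apply: mulr_ge0; first by rewrite mulr_ge0 ?addr_ge0 ?(ltW p0).
  by apply: mulr_ge0 => //; rewrite addr_ge0// mulr_ge0 ?sqrtr_ge0.
(* The bound is of order [h + sqrt h], hence at most [Q * s] for [h = s ^+ 2] and [s <= 1]. The
   remaining entries give [Q * s <= e] and the two conditions on the time step. *)
pose s := Num.min (Num.min 1 (e / (Q + 1))) (Num.min (lambda^-1) (p^-1 / lambda)).
have Q1 : 0 < Q + 1 by rewrite ltr_wpDl.
have s0 : 0 < s by rewrite !lt_min ltr01 divr_gt0// invr_gt0 l0 divr_gt0// invr_gt0.
have [[s1 se] [sl sp]] : (s <= 1 /\ s <= e / (Q + 1)) /\ (s <= lambda^-1 /\ s <= p^-1 / lambda).
  by rewrite /s !ge_min !lexx !orbT.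
have ss : s ^+ 2 <= s by rewrite expr2 ler_piMr// ltW.
have h0 : 0 < s ^+ 2 by rewrite exprn_gt0.
have t1 : lambda * s ^+ 2 <= 1.
  by rewrite mulrC -ler_pdivlMr// mul1r (le_trans ss).
have t2 : lambda * s ^+ 2 <= p^-1.
  by rewrite mulrC -ler_pdivlMr// (le_trans ss).
apply: (le_trans (dist_box_small p0 h0 t1 t2)).
apply: (@le_trans _ _ (Q * s)); last first.
  apply: (@le_trans _ _ ((Q + 1) * s)); first by rewrite ler_wpM2r ?(ltW s0)// lerDl.
  by rewrite mulrC -ler_pdivlMr.
have q0 : 0 <= 2 * (p + 1) / lambda.
  by rewrite divr_ge0 ?(ltW l0)// mulr_ge0// addr_ge0// ltW.
rewrite sqrtrM// sqrtr_sqr (gtr0_norm s0) /Q; set r := Num.sqrt _.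
rewrite [leRHS](_ : _ = 4 * (p + 1) * (T * (150 * s + 124 * (r * s)))); last by ring.
apply: ler_wpM2l; first by rewrite mulr_ge0 ?addr_ge0 ?(ltW p0).
by apply: ler_wpM2l => //; rewrite lerD2r ler_wpM2l.
Qed.

End Uniqueness.

(** * Piecewise constant reconstructions *)

Section Reconstruction.
Context {R : realType}.

Lemma reconstructE (tau h : R) (w : nat -> int -> R) t x : 0 < tau -> 0 < h -> 0 <= t ->
  reconstruct tau h w t x = w (step_index tau t) (cell_index h x).
Proof.
move=> tau0 h0 t0; have st := step_indexP tau0 t0; have cx := cell_indexP x h0.
have out n j : (n, j) <> (step_index tau t, cell_index h x) ->
    w n j * \1_(cell tau h n j) (t, x) = 0.
  move=> nj; rewrite indicE memNset ?mulr0//= => -[/=]; rewrite !in_itv/= => a b.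
  by apply: nj; rewrite (step_index_unique tau0 a) (cell_index_unique h0 b).
rewrite /reconstruct -(@fsbig_widen _ _ _ _ [set step_index tau t])//; last first.
  move=> n [_ /= nst]; apply: fsbig1 => j _; apply: out => -[]//.
rewrite fsbig_set1 -(@fsbig_widen _ _ _ _ [set cell_index h x])//; last first.
  by move=> j [_ /= njx]; apply: out => -[].
rewrite fsbig_set1 indicE mem_set ?mulr1//=.
Qed.

Lemma measurable_reconstruct (tau h : R) (w : nat -> int -> R) : 0 < tau -> 0 < h ->
  measurable_fun [set z : R * R | 0 <= z.1] (fun z : R * R => reconstruct tau h w z.1 z.2).
Proof.
move=> tau0 h0.
apply: (eq_measurable_fun (fun z : R * R => w (step_index tau z.1) (cell_index h z.2))).
  by move=> [t x]; rewrite inE/= => t0; rewrite reconstructE.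
apply: measurable_funTS.
apply: (measurable_steps (u := fun n x => w n (cell_index h x))) => // n.
exact: measurable_cell_index.
Qed.

End Reconstruction.

(** * Convergence *)

Section AlmostEverywhereData.
Context {R : realType}.
Notation mu := (@lebesgue_measure R).
Variables (f g : R -> R).
Hypotheses (mf : measurable_fun [set: R] f) (mg : measurable_fun [set: R] g).
Hypothesis fg : {ae mu, forall x, f x = g x}.

Lemma TV_ae : TV f = TV g.
Proof.
have gf : {ae mu, forall x, g x = f x} by apply: aeS fg => x ->.
congr ereal_inf; apply/seteqP; split => _ [k hk <-]; exists k => //=.
  by apply: (ae_imply2 gf hk) => x ->.
by apply: (ae_imply2 fg hk) => x ->.
Qed.

Lemma cell_average_ae h j : cell_average f h j = cell_average g h j.
Proof.
rewrite /cell_average; congr (_ * fine _); apply: ae_eq_integral => //.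
- by apply: measurable_funTS; exact/measurable_EFinP.
- by apply: measurable_funTS; exact/measurable_EFinP.
- by apply: aeS fg => x /= -> _.
Qed.

Lemma entropy_solution_ae (V : R -> R) u : entropy_solution V f u -> entropy_solution V g u.
Proof.
move=> [m b e]; split => // k phi k01 tphi; have := e k phi k01 tphi.
congr (_ <= _ + _)%E; apply: ae_eq_integral => //.
- apply/measurable_EFinP; apply: measurable_funM.
    by apply: measurableT_comp => //; apply: measurable_funB.
  have := measurable_test tphi 0 0; congr measurable_fun.
  by apply/funext => x; rewrite addr0.
- apply/measurable_EFinP; apply: measurable_funM.
    by apply: measurableT_comp => //; apply: measurable_funB.
  have := measurable_test tphi 0 0; congr measurable_fun.
  by apply/funext => x; rewrite addr0.
- by apply: aeS fg => x /= -> _.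
Qed.

End AlmostEverywhereData.

Section Convergence.
Context {R : realType}.
Notation mu := (@lebesgue_measure R).

(** By Tonelli the space-time error is a time integral of slice errors, each at most the rate at the
    final time, which vanishes as both parameters tend to 0. *)
Lemma cvg_L1loc_of_rate (U : R -> R -> R -> R -> R) (v : R -> R -> R) (K : R) :
  (forall eps h, 0 < eps -> 0 < h ->
    measurable_fun [set z : R * R | 0 <= z.1] (fun z : R * R => U eps h z.1 z.2)) ->
  measurable_fun [set z : R * R | 0 <= z.1] (fun z : R * R => v z.1 z.2) ->
  (forall eps h t, 0 < eps -> 0 < h -> 0 <= t ->
    (\int[mu]_x `|U eps h t x - v t x|%:E <=
     (K * (eps + h + Num.sqrt (eps * t) + Num.sqrt (h * t)))%:E)%E) ->
  0 <= K -> cvg_L1loc U v.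
Proof.
move=> mU mv rate K0 T M; have [T0|T0] := ltP T 0.
  have -> : `[0, T] `*` `[- M, M] = set0 :> set (R * R).
    apply/seteqP; split => [[t x] [/=]|//]; rewrite in_itv/= => /andP[t0 tT].
    by have := le_trans t0 tT; rewrite leNgt T0.
  under eq_fun do rewrite integral_set0; exact: cvg_cst.
pose B (p : R * R) : R := T * (K * (p.1 + p.2 + Num.sqrt (p.1 * T) + Num.sqrt (p.2 * T))).
apply: (@squeeze_cvge _ _ _ _ (fun=> 0%E) _ (fun p => (B p)%:E)).
- have : \forall p \near filter_prod (0 : R)^'+ (0 : R)^'+, 0 < p.1 /\ 0 < p.2.
    exists ([set e | 0 < e], [set e | 0 < e]) => [|[a b] []//].
    by split; exact: nbhs_right_gt.
  apply: filterS => p [p1 p2].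
  apply/andP; split; first by apply: integral_ge0 => z _; rewrite lee_fin.
  set D := `[0, T] `*` `[- M, M].
  have mD : measurable (D : set (R * R)) by apply: measurableX.
  pose w (z : R * R) := (`|U p.1 p.2 z.1 z.2 - v z.1 z.2|%:E)%E.
  have mw : measurable_fun [set z : R * R | 0 <= z.1] w.
    apply/measurable_EFinP; apply: measurableT_comp => //; apply: measurable_funB => //.
    exact: mU.
  have DH : D `<=` [set z : R * R | 0 <= z.1].
    by move=> [t x] [/=]; rewrite in_itv/= => /andP[].
  have mwD : measurable_fun [set: R * R] (w \_ D).
    apply: (measurable_restrictT w mD).1; apply: (measurable_funS _ DH mw).
    exact: measurable_halfplane.
  have wD0 z : (0 <= (w \_ D) z)%E.
    by rewrite patchE; case: ifP => // _; rewrite lee_fin.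
  rewrite integral_mkcond (@fubini_tonelli1 _ _ _ _ R mu mu (w \_ D) mwD wD0).
  pose c := K * (p.1 + p.2 + Num.sqrt (p.1 * T) + Num.sqrt (p.2 * T)).
  have c0 : 0 <= c.
    by rewrite mulr_ge0// !addr_ge0 ?sqrtr_ge0// ltW.
  have mF := @measurable_fun_fubini_tonelli_F _ _ _ _ R mu (w \_ D) mwD wD0.
  apply: (@le_trans _ _ (\int[mu]_t (c * \1_(`[0, T]) t)%:E)%E); last first.
    rewrite J_E; last by apply: L1Z; exact: L1_indic_itv.
    rewrite J_Z; last exact: L1_indic_itv.
    by rewrite J_indic_itv// subr0 lee_fin /B mulrC.
  apply: ge0_le_integral => //.
  + by move=> t _; apply: integral_ge0 => x _; exact: wD0.
  + by apply/measurable_EFinP; apply: measurable_funM.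
  + move=> t _; rewrite /fubini_F; have [tT|tT] := boolP (t \in `[0, T]%classic); last first.
      rewrite indicE (negbTE tT) mulr0.
      rewrite (eq_integral (fun=> 0%E)) ?integral0// => x _; rewrite patchE.
      case: ifP => //; rewrite in_setX => /andP[h _].
      by move: tT; rewrite h.
    rewrite indicE tT mulr1; move: (tT); rewrite inE/= in_itv/= => /andP[t0 tT'].
    apply: (@le_trans _ _ (\int[mu]_x w (t, x))%E).
      apply: ge0_le_integral => //.
      * by apply: (measurableT_comp mwD); exact: measurable_pair1.
      * apply: (measurable_comp (F := [set z : R * R | 0 <= z.1]) (f := w)
          (g := fun x : R => (t, x))) => //.
        - exact: measurable_halfplane.
        - by move=> _ [x _ <-].
        - exact: measurable_pair1.
      * by move=> x _; rewrite patchE; case: ifP => // _; rewrite lee_fin.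
    apply: (le_trans (rate _ _ _ p1 p2 t0)); rewrite lee_fin ler_wpM2l//.
    by rewrite !lerD// ler_wsqrtr// ler_wpM2l// ltW.
- exact: cvg_cst.
- apply: cvg_EFin; first exact: nearW.
  have F1 : p.1 @[p --> filter_prod (0 : R)^'+ (0 : R)^'+] --> (0 : R).
    apply: (cvg_trans (@cvg_fst R R (0 : R)^'+ (0 : R)^'+ _)); exact: cvg_within.
  have F2 : p.2 @[p --> filter_prod (0 : R)^'+ (0 : R)^'+] --> (0 : R).
    apply: (cvg_trans (@cvg_snd R R (0 : R)^'+ (0 : R)^'+ _)); exact: cvg_within.
  have S (q : R * R -> R) : q p @[p --> filter_prod (0 : R)^'+ (0 : R)^'+] --> (0 : R) ->
      Num.sqrt (q p * T) @[p --> filter_prod (0 : R)^'+ (0 : R)^'+] --> (0 : R).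
    move=> hq; have h1 : q p * T @[p --> filter_prod (0 : R)^'+ (0 : R)^'+] --> 0 * T.
      by apply: cvgM => //; exact: cvg_cst.
    have := cvg_comp _ _ h1 (@sqrt_continuous R _).
    by rewrite mul0r sqrtr0.
  have e0 : T * (K * (0 + 0 + 0 + 0)) = 0 by rewrite !addr0 !mulr0.
  rewrite -[X in _ --> X]e0.
  apply: cvgM; first exact: cvg_cst.
  apply: cvgM; first exact: cvg_cst.
  by apply: cvgD; [apply: cvgD; [exact: cvgD|exact: S]|exact: S].
Qed.

Lemma time_continuous_of_lipschitz (v : R -> R -> R) (C : R) :
  (forall s t, 0 <= s <= t -> L1 (fun x => v t x - v s x) /\
    \int[mu]_x `|v t x - v s x| <= (t - s) * C) -> time_continuous_L1loc v.
Proof.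
move=> lip t0 M t00.
have bound t : 0 <= t ->
    (\int[mu]_(x in `[(- M)%R, M]) `|v t x - v t0 x|%:E <= (`|t - t0| * C)%:E)%E.
  move=> tp.
  have [Ld Jd] : L1 (fun x => v t x - v t0 x) /\ \int[mu]_x `|v t x - v t0 x| <= `|t - t0| * C.
    have [h|h] := leP t0 t.
      by rewrite ger0_norm ?subr_ge0//; apply: lip; rewrite t00.
    have st : 0 <= t <= t0 by rewrite tp ltW.
    have [a b] := lip _ _ st; rewrite distrC ger0_norm ?subr_ge0 ?(ltW h)//; split.
      by apply: L1_eq (L1Z (-1) a) => x; rewrite mulN1r opprB.
    by apply: le_trans b; under eq_Rintegral do rewrite distrC.
  apply: (@le_trans _ _ (\int[mu]_x `|v t x - v t0 x|%:E)%E).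
    apply: ge0_subset_integral => //.
    apply/measurable_EFinP; apply: measurableT_comp => //; exact: L1_measurable.
  by rewrite J_E ?lee_fin//; exact: L1_abs.
apply: (@squeeze_cvge _ _ _ _ (fun=> 0%E) _ (fun t => (`|t - t0| * C)%:E)).
- near=> t; have : `[0, +oo[%classic t by near: t; exact: withinT.
  rewrite /= in_itv/= andbT => tp.
  by rewrite bound// andbT; apply: integral_ge0 => x _; rewrite lee_fin.
- exact: cvg_cst.
- apply: cvg_within_filter; apply: cvg_EFin; first exact: nearW.
  rewrite -[X in _ --> X](mul0r C); apply: cvgM; last exact: cvg_cst.
  rewrite -[X in _ --> X](@normr0 _ R) -(subrr t0); apply: cvg_norm.
  by apply: cvgB; [exact: cvg_id|exact: cvg_cst].
Unshelve. all: by end_near.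
Qed.

End Convergence.

(** * Explicit constants in the rate *)

Section Rate.
Context {R : realType}.
Notation mu := (@lebesgue_measure R).

(** With the variation bound [2 * T], twice [gap_const] yields the coefficients 300 and 496.
    Splitting the square root and using [h <= delta] gives [804 = 300 + 496 + 8], and the distance
    between [rho] and [W] raises 804 to 806 in front of [c]. *)
Definition rate_const (lambda c : R) : R :=
  804 + 806 * c + 496 * (Num.sqrt lambda^-1 + Num.sqrt (c / lambda)).

Lemma rate_const_gt0 (lambda c : R) : 0 < c -> 0 < rate_const lambda c.
Proof.
move=> c0; have := sqrtr_ge0 lambda^-1; have := sqrtr_ge0 (c / lambda).
by rewrite /rate_const; lra.
Qed.

Lemma rate_const_dominates (a b c e h s r : R) : 0 <= a -> 0 <= b -> 0 <= c -> 0 <= e ->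
  0 <= h -> 0 <= s -> 0 <= r ->
  804 * (h + c * e) + 496 * (a * r + b * s) + 2 * (c * e) <=
  (804 + 806 * c + 496 * (a + b)) * (e + h + s + r).
Proof.
move=> a0 b0 c0 e0 h0 s0 r0; rewrite -subr_ge0.
rewrite [leRHS](_ : _ = 804 * (e + s + r) + 806 * (c * (h + s + r)) +
  496 * (a * (e + h + s) + b * (e + h + r))); last by ring.
have esr : 0 <= e + s + r by lra.
have hsr : 0 <= c * (h + s + r) by apply: mulr_ge0 => //; lra.
have ehs : 0 <= a * (e + h + s) by apply: mulr_ge0 => //; lra.
have ehr : 0 <= b * (e + h + r) by apply: mulr_ge0 => //; lra.
lra.
Qed.

Lemma gap_rate (lambda c eps h t delta T : R) (n : nat) : 0 < lambda -> 0 < c -> 0 < eps ->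
  0 < h -> 0 <= t -> 0 <= T -> delta = h + c * eps -> n%:R * (lambda * h) <= t ->
  2 * gap_const h delta (2 * T) n + 4 * (h * (2 * T)) + (delta - h) * (2 * T) <=
  rate_const lambda c * T * (eps + h + Num.sqrt (eps * t) + Num.sqrt (h * t)).
Proof.
move=> l0 c0 eps0 h0 t0 T0 dE nt; rewrite /gap_const /rate_const.
set a := Num.sqrt lambda^-1; set b := Num.sqrt (c / lambda).
set se := Num.sqrt (eps * t); set sh := Num.sqrt (h * t); set Y := Num.sqrt _.
have ce : 0 < c * eps by rewrite mulr_gt0.
have a0 : 0 <= a by exact: sqrtr_ge0.
have b0 : 0 <= b by exact: sqrtr_ge0.
have se0 : 0 <= se by exact: sqrtr_ge0.
have sh0 : 0 <= sh by exact: sqrtr_ge0.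
have d0 : 0 < delta by rewrite dE addr_gt0.
have ash : 0 <= a * sh by rewrite mulr_ge0.
have bse : 0 <= b * se by rewrite mulr_ge0.
(* The radicand is at most [(t / lambda + h) * delta], which equals the sum of the squares of
   [a * sh] and [b * se] plus [h * delta], and [h <= delta]. *)
have YE : Y <= a * sh + b * se + delta.
  have r0 : 0 <= a * sh + b * se + delta by rewrite !addr_ge0// ltW.
  rewrite -[leRHS](ger0_norm r0) -sqrtr_sqr; apply: ler_wsqrtr.
  have aE : (a * sh) ^+ 2 = h * t / lambda.
    by rewrite exprMn !sqr_sqrtr ?invr_ge0 ?mulr_ge0 ?(ltW l0) ?(ltW h0)// mulrC.
  have bE : (b * se) ^+ 2 = c * eps * t / lambda.
    rewrite exprMn !sqr_sqrtr ?mulr_ge0 ?divr_ge0 ?invr_ge0 ?(ltW l0) ?(ltW eps0) ?(ltW c0)//.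
    by ring.
  have hn : n.+1%:R * h <= t / lambda + h.
    rewrite -natr1 mulrDl mul1r lerD2r ler_pdivlMr//.
    by apply: le_trans nt; rewrite mulrAC mulrA.
  apply: (@le_trans _ _ ((t / lambda + h) * delta)); first by rewrite ler_wpM2r// ltW.
  have e1 : (t / lambda + h) * delta = (a * sh) ^+ 2 + (b * se) ^+ 2 + h * delta.
    by rewrite aE bE dE; ring.
  have hd : h * delta <= delta ^+ 2 by rewrite expr2 ler_wpM2r ?(ltW d0)// dE lerDl ltW.
  have x1 : 0 <= (a * sh) * (b * se) by rewrite mulr_ge0.
  have x2 : 0 <= (a * sh) * delta by rewrite mulr_ge0// ltW.
  have x3 : 0 <= (b * se) * delta by rewrite mulr_ge0// ltW.
  rewrite e1 [leRHS](_ : _ = (a * sh) ^+ 2 + (b * se) ^+ 2 + delta ^+ 2 +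
    2 * ((a * sh) * (b * se) + (a * sh) * delta + (b * se) * delta)); last by ring.
  lra.
have main : 804 * delta + 496 * (a * sh + b * se) + 2 * (c * eps) <=
    (804 + 806 * c + 496 * (a + b)) * (eps + h + se + sh).
  by rewrite dE; apply: rate_const_dominates => //; exact: ltW.
have := ler_wpM2r T0 main.
have YT := ler_wpM2r T0 YE.
have hT : h * T <= delta * T by rewrite ler_wpM2r// dE lerDl ltW.
have dh : (delta - h) * T = c * eps * T by rewrite dE; ring.
rewrite (_ : (804 * delta + 496 * (a * sh + b * se) + 2 * (c * eps)) * T =
  804 * (delta * T) + 496 * ((a * sh + b * se) * T) + 2 * (c * eps * T)); last by ring.
rewrite mulrDl in YT.
move=> H; apply: le_trans (_ : _ <= (804 + 806 * c + 496 * (a + b)) * (eps + h + se + sh) * T) _.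
  apply: le_trans H; rewrite (_ : 2 * _ + _ + _ = 300 * (delta * T) + 496 * (Y * T) + 8 * (h * T) +
    2 * ((delta - h) * T)); last by ring.
  by rewrite dh; lra.
by rewrite le_eqVlt; apply/orP; left; apply/eqP; ring.
Qed.

End Rate.

Theorem theorem4p3 (R : realType) (lambda normV normV' c : R) :
  0 < lambda -> 0 < c ->
  exists2 K : R, 0 < K &
  forall (rho0 V : R -> R) (gamma0 : R -> R -> R),
    measurable_fun [set: R] rho0 ->
    {ae @lebesgue_measure R, forall x, 0 <= rho0 x <= 1} ->
    (TV rho0 < +oo)%E ->
    [lipschitz V x | x in `[0, 1]] ->
    (forall x, x \in `[0, 1] -> 0 <= V x) ->
    {ae @lebesgue_measure R,
       forall x, x \in `]0, 1[ -> derivable V x 1 /\ derive1 V x <= 0} ->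
    Linfty01 V = normV%:E ->
    Linfty01 (derive1 V) = normV'%:E ->
    lambda * (normV + normV') <= 1 ->
    (forall eps h : R, 0 < eps -> 0 < h ->
       0 < gamma0 eps h < 1 /\
       (1 - gamma0 eps h) / gamma0 eps h <= c * (eps / h)) ->
    let gamma eps h := geometric_weights (gamma0 eps h) in
    let rho_num eps h := rho_approx V lambda (gamma eps h) rho0 h in
    let W_num eps h := W_approx V lambda (gamma eps h) rho0 h in
    exists rho : R -> R -> R,
      [/\ entropy_solution V rho0 rho /\ time_continuous_L1loc rho,
          forall rho', entropy_solution V rho0 rho' -> ae_equal rho' rho,
          cvg_L1loc W_num rho /\ cvg_L1loc rho_num rho &
          forall eps h t : R, 0 < eps -> 0 < h -> 0 < t ->
            let bound := ((K * (eps + h + Num.sqrt (eps * t)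
                                + Num.sqrt (h * t)))%:E * TV rho0)%E in
            (L1_dist (W_num eps h t) (rho t) <= bound)%E /\
            (L1_dist (rho_num eps h t) (rho t) <= bound)%E].
Proof.
move=> l0 c0; exists (rate_const lambda c); first exact: rate_const_gt0.
move=> rho0 V gamma0 mrho0 rho01 TVrho0 lipV V0 dV nV nV' cfl hgamma gamma rho_num W_num.
have hV := velocity_of_ae lipV V0 dV nV nV'.
(* The datum lies in [[0, 1]] only almost everywhere. Clipping makes this hold everywhere, and [TV],
   the cell averages and the entropy inequality do not see the change. *)
pose r0 := clip \o rho0.
have mr0 : measurable_fun [set: R] r0 by apply: measurableT_comp => //; exact: measurable_clip.
have fr0 : field r0 by split => // x; exact: clip_itv.
have aer : {ae @lebesgue_measure R, forall x, rho0 x = r0 x}.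
  by apply: aeS rho01 => x h; rewrite /r0/= clip_id.
have aer' : {ae @lebesgue_measure R, forall x, r0 x = rho0 x} by apply: aeS aer => x ->.
have TVr : TV r0 = TV rho0 by rewrite (TV_ae aer).
have TVr0 : (TV r0 < +oo)%E by rewrite TVr.
pose T := fine (TV r0); have T0 : 0 <= T by rewrite fine_ge0// TV_ge0.
have TE : TV rho0 = T%:E by rewrite -TVr /T fineK// ge0_fin_numE// TV_ge0.
have fT s : (\int[@lebesgue_measure R]_x `|r0 (x + s) - r0 x|%:E <= (`|s| * T)%:E)%E.
  exact: translation_le.
pose rho := limsol V lambda r0.
have eu : entropy_solution V r0 rho by exact: (limsol_entropy_solution hV l0 cfl fr0 fT).
have time s t : 0 <= s <= t -> L1 (fun x => rho t x - rho s x) /\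
    \int[@lebesgue_measure R]_x `|rho t x - rho s x| <= (t - s) / lambda * T.
  exact: (limsol_time hV l0 cfl fr0 fT).
(* Weakened to [2 * T], the variation bound of the cell averages, so that one constant serves
   throughout [rate_W]. *)
have time2 s t : 0 <= s <= t -> L1 (fun x => rho t x - rho s x) /\
    \int[@lebesgue_measure R]_x `|rho t x - rho s x| <= (t - s) / lambda * (2 * T).
  move=> st; have [a b] := time _ _ st; split => //; apply: (le_trans b).
  case/andP: st => _ st; rewrite ler_wpM2l ?divr_ge0 ?subr_ge0 ?(ltW l0)//; lra.
have [mrho _ _] := eu.
have K0 : 0 <= rate_const lambda c by exact: ltW (rate_const_gt0 _ c0).
have cells h : cell_average rho0 h = cell_average r0 h.
  by apply/funext => j; exact: cell_average_ae.
have mW eps h : 0 < eps -> 0 < h -> measurable_fun [set z : R * R | 0 <= z.1]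
    (fun z : R * R => W_num eps h z.1 z.2).
  by move=> _ h0; apply: measurable_reconstruct => //; exact: mulr_gt0.
have mR eps h : 0 < eps -> 0 < h -> measurable_fun [set z : R * R | 0 <= z.1]
    (fun z : R * R => rho_num eps h z.1 z.2).
  by move=> _ h0; apply: measurable_reconstruct => //; exact: mulr_gt0.
have rate eps h t : 0 < eps -> 0 < h -> 0 <= t ->
    (\int[@lebesgue_measure R]_x `|W_num eps h t x - rho t x|%:E <=
     (rate_const lambda c * T * (eps + h + Num.sqrt (eps * t) + Num.sqrt (h * t)))%:E)%E /\
    (\int[@lebesgue_measure R]_x `|rho_num eps h t x - rho t x|%:E <=
     (rate_const lambda c * T * (eps + h + Num.sqrt (eps * t) + Num.sqrt (h * t)))%:E)%E.
  move=> eps0 h0 t0; have [/andP[g0 g1] gc] := hgamma eps h eps0 h0.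
  set g := gamma0 eps h in g0 g1 gc.
  have tau0 : 0 < lambda * h by rewrite mulr_gt0.
  have g01 : 0 < g <= 1 by rewrite g0 ltW.
  (* [h / g] is [h + h * ((1 - g) / g)], and the hypothesis on the weights bounds the second term by
     [c * eps]. *)
  pose delta := h + c * eps.
  have hg : h / g <= delta.
    have -> : h / g = h + h * ((1 - g) / g) by field; rewrite gt_eqF.
    rewrite lerD2l; apply: (le_trans (ler_wpM2l (ltW h0) gc)).
    by rewrite le_eqVlt; apply/orP; left; apply/eqP; field; rewrite gt_eqF.
  pose w0 := cell_average r0 h.
  have w01 j : 0 <= w0 j <= 1 by apply: cell_average_itv => //; exact: fr0.2.
  have wT : wsum_le (fun j => `|w0 (j + 1) - w0 j|) (2 * T).
    by apply: cell_average_wsum => //; exact: fr0.2.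
  have ini : (\int[@lebesgue_measure R]_x `|r0 x - w0 (cell_index h x)|%:E <= (h * (2 * T))%:E)%E.
    by rewrite mulrCA mulrA; apply: cell_average_L1 => //; exact: fr0.2.
  pose n := step_index (lambda * h) t.
  have st := step_indexP tau0 t0; have /andP[nt _] := st.
  have rW := rate_W hV l0 cfl h0 g01 hg w01 wT fr0 ini eu time2 t0 st.
  have rG := scheme_gap_integral hV l0 cfl h0 g01 hg w01 wT n.
  rewrite -/n in rW.
  have gr := gap_rate l0 c0 eps0 h0 t0 T0 (erefl delta) nt; rewrite -/n in gr.
  have dh0 : 0 <= (delta - h) * (2 * T).
    by rewrite mulr_ge0 ?mulr_ge0// /delta addrAC subrr add0r mulr_ge0 ?ltW.
  set W := scheme_W V lambda (geometric_weights g) w0 in rW rG.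
  set r := scheme_rho V lambda (geometric_weights g) w0 in rG.
  have WE x : W_num eps h t x = W n (cell_index h x).
    by rewrite /W_num /W_approx reconstructE// cells.
  have rE x : rho_num eps h t x = r n (cell_index h x).
    by rewrite /rho_num /rho_approx reconstructE// cells.
  have mrt : measurable_fun [set: R] (rho t) by exact: (slice_measurable eu t0).
  have mWn : measurable_fun [set: R] (fun x => W n (cell_index h x)) by exact: measurable_cell_index.
  have mrn : measurable_fun [set: R] (fun x => r n (cell_index h x)) by exact: measurable_cell_index.
  have m1 : measurable_fun [set: R] (fun x => `|rho t x - W n (cell_index h x)|).
    by apply: measurableT_comp => //; exact: measurable_funB.
  have m2 : measurable_fun [set: R] (fun x => `|r n (cell_index h x) - W n (cell_index h x)|).
    by apply: measurableT_comp => //; exact: measurable_funB.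
  have [La Ja] := J_ge0_le m1 (fun x => normr_ge0 _) rW.
  have [Lb Jb] := J_ge0_le m2 (fun x => normr_ge0 _) rG.
  split.
    under eq_integral => x _ do rewrite WE distrC.
    by apply: (le_trans rW); rewrite lee_fin; apply: le_trans gr; rewrite lerDl.
  have dr x : `|rho_num eps h t x - rho t x| <=
      `|rho t x - W n (cell_index h x)| + `|r n (cell_index h x) - W n (cell_index h x)|.
    by rewrite rE [leRHS]addrC (distrC (rho t x)); exact: ler_distD.
  have Lc : L1 (fun x => `|rho_num eps h t x - rho t x|).
    apply: (L1_le _ _ (L1D La Lb)) => [|x]; last by rewrite normr_id dr.
    apply: measurableT_comp => //; apply: measurable_funB => //.
    by rewrite (_ : rho_num eps h t = fun x => r n (cell_index h x))//; exact/funext.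
  rewrite (J_E Lc) lee_fin; apply: le_trans gr.
  apply: (le_trans (J_le Lc (L1D La Lb) dr)).
  by rewrite J_D// lerD.
exists rho; split.
- split; first exact: (entropy_solution_ae mr0 mrho0 aer' eu).
  apply: (@time_continuous_of_lipschitz _ _ (lambda^-1 * T)) => s t st.
  by have [a b] := time s t st; rewrite mulrA.
- move=> rho' eu'; apply: (entropy_solution_unique hV l0 cfl fr0 TVr0 _ eu).
  exact: (entropy_solution_ae mrho0 mr0 aer eu').
- have KT : 0 <= rate_const lambda c * T by exact: mulr_ge0.
  split.
  + apply: (@cvg_L1loc_of_rate _ _ _ _ mW mrho _ KT) => eps h t eps0 h0 t0.
    exact: (rate eps h t eps0 h0 t0).1.
  + apply: (@cvg_L1loc_of_rate _ _ _ _ mR mrho _ KT) => eps h t eps0 h0 t0.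
    exact: (rate eps h t eps0 h0 t0).2.
- move=> eps h t eps0 h0 t0 bound.
  have -> : bound = (rate_const lambda c * T * (eps + h + Num.sqrt (eps * t) + Num.sqrt (h * t)))%:E.
    by rewrite /bound TE -EFinM mulrAC.
  exact: (rate eps h t eps0 h0 (ltW t0)).
Qed.
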